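(* Suppose that $\mathfrak{g}_\infty$ is closed under the commutator bracket $[x,y]=xy-yx$ and that there is a constant $C>0$ such that $|[x,y]|\leqslant C|x||y|$ for all $x,y\in\mathfrak{g}_\infty$. Then the group $G_\infty=\bigcup_{n=1}^\infty G_n$ is dense in the Cameron-Martin group $G_{CM}$ in the metric $d$, and $G_{CM}$ is complete in the metric $d$.
   Context: Let $H$ be a separable Hilbert space, $B(H)$ the space of bounded linear operators on $H$ with operator norm $\|\cdot\|$, $I$ the identity operator, and $GL(H)$ the group of invertible elements of $B(H)$. Let $G_1\subseteq G_2\subseteq\dots\subseteq G_n\subseteq\dots\subseteq B(H)$ be a sequence of connected finite-dimensional Lie subgroups of $GL(H)$, with Lie algebras $\mathfrak{g}_n\subseteq B(H)$, and let $\mathfrak{g}=\bigcup_{n=1}^\infty\mathfrak{g}_n$. The Lie algebra $\mathfrak{g}$ is equipped with a Hermitian inner product $(\cdot,\cdot)$ with norm $|\cdot|$. Completeness assumption: there is a subspace $\mathfrak{g}_\infty$ of $B(H)$ containing $\mathfrak{g}$ such that the inner product on $\mathfrak{g}$ extends to $\mathfrak{g}_\infty$ (the extended inner product and norm are still denoted $(\cdot,\cdot)$ and $|\cdot|$), $\mathfrak{g}_\infty$ is complete with respect to it, and $\mathfrak{g}$ is dense in $\mathfrak{g}_\infty$ in the norm $|\cdot|$. Let $C^1_{CM}$ be the space of paths $g:[0,1]\to GL(H)$ such that (1) $g(s)$ is continuous in the operator norm; (2) $\dot g=dg/ds$ exists in $B(H)$ with the operator norm; (3) $\dot g$ is piecewise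 continuous in the operator norm; (4) $g'=g^{-1}\dot g$ is in $\mathfrak{g}_\infty$ and is piecewise continuous in the norm $|\cdot|$. Define $d(y,z)=\inf_g\int_0^1|g^{-1}\dot g|\,ds$, where $g$ runs over $C^1_{CM}$ with $g(0)=y$, $g(1)=z$, and $d(y,z)=\infty$ if there is no such path. The Cameron-Martin group is $G_{CM}=\{x\in B(H): d(x,I)<\infty\}$. *)

(* Defs.v *)
From HB Require Import structures.
From mathcomp Require Import all_boot all_order all_algebra.
From mathcomp Require Import sesquilinear complex.
From mathcomp Require Import all_classical all_reals all_analysis.

Set Implicit Arguments.
Unset Strict Implicit.
Unset Printing Implicit Defensive.

Import Order.TTheory GRing.Theory Num.Theory.
Import numFieldNormedType.Exports.

Local Open Scope classical_set_scope.
Local Open Scope ring_scope.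
Local Open Scope complex_scope.

(* The norm of a complex normed module takes values in [R[i]]; all norms below
   are brought back to the real line with [complex.Re]. *)

Section BoundedOperators.
Context {R : realType} (H : completeNormedModType R[i]).

Definition bounded_op : {pred H -> H} :=
  [pred f | `[< linear f /\ exists M : R, forall x, `|f x| <= M%:C * `|x| >]].

Record bop := BOp { bop_fun :> H -> H; _ : bop_fun \in bounded_op }.

HB.instance Definition _ := [isSub for bop_fun].
HB.instance Definition _ := [Choice of bop by <:].

Lemma bounded_opP (f : H -> H) :
  reflect (linear f /\ exists M : R, 0 <= M /\ forall x, `|f x| <= M%:C * `|x|)
          (f \in bounded_op).
Proof.
apply: (iffP (asboolP _)) => [[lf [M fM]]|[lf [M [_ fM]]]]; split => //; last by exists M.
exists `|M|; split=> // x; apply: (le_trans (fM x)).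
by rewrite ler_wpM2r// lecR ler_norm.
Qed.

Lemma bounded_op_comb (a : R[i]) (f g : H -> H) :
  f \in bounded_op -> g \in bounded_op ->
  (fun x => a *: f x + g x) \in bounded_op.
Proof.
move=> /bounded_opP[lf [M [M0 fM]]] /bounded_opP[lg [N [N0 gN]]].
apply/bounded_opP; split.
  by move=> k x y; rewrite lf lg !scalerDr !scalerA (mulrC a k) addrACA.
exists (complex.Re `|a| * M + N); split.
  rewrite addr_ge0// mulr_ge0//.
  by have := normr_ge0 a; rewrite -(RRe_real (normr_real a)) lecR.
move=> x; apply: (le_trans (ler_normD _ _)).
rewrite normrZ rmorphD rmorphM/= (RRe_real (normr_real a)) mulrDl lerD//.
by rewrite -mulrA ler_wpM2l.
Qed.

Lemma bounded_op_id : id \in bounded_op.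
Proof. by apply/bounded_opP; split=> //; exists 1; split=> // x; rewrite mul1r. Qed.

Lemma bounded_op_comp (f g : H -> H) :
  f \in bounded_op -> g \in bounded_op -> f \o g \in bounded_op.
Proof.
move=> /bounded_opP[lf [M [M0 fM]]] /bounded_opP[lg [N [N0 gN]]].
apply/bounded_opP; split; first by move=> k x y /=; rewrite lg lf.
exists (M * N); split; first exact: mulr_ge0.
move=> x /=; apply: (le_trans (fM _)).
by rewrite rmorphM/= -mulrA ler_wpM2l// lecR.
Qed.

Lemma bounded_op0 : (0 : H -> H) \in bounded_op.
Proof.
apply/bounded_opP; split; first by move=> k x y; rewrite scaler0 addr0.
by exists 0; split=> // x; rewrite normr0 mul0r.
Qed.

Lemma bounded_op_zmod : zmod_closed bounded_op.
Proof.
split; first exact: bounded_op0.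
move=> f g bf bg.
have -> : f - g = fun x => -1 *: g x + f x.
  by apply/funext => x; rewrite scaleN1r addrC.
exact: bounded_op_comb.
Qed.

HB.instance Definition _ := GRing.isZmodClosed.Build (H -> H) bounded_op
  bounded_op_zmod.
HB.instance Definition _ := [SubChoice_isSubZmodule of bop by <:].

Lemma bopP (f : bop) : (f : H -> H) \in bounded_op. Proof. by case: f. Qed.

Lemma bop_ext (f g : bop) : (forall x, f x = g x) -> f = g.
Proof.
move=> fg; have e : bop_fun f = bop_fun g by apply/funext.
exact: (val_inj e).
Qed.

Lemma bopDE (f g : bop) x : (f + g) x = f x + g x.
Proof. by []. Qed.

Lemma bop_linear (f : bop) : linear f.
Proof. by have /bounded_opP[] := bopP f. Qed.

Definition bop_one : bop := BOp bounded_op_id.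
Definition bop_mul (f g : bop) : bop := BOp (bounded_op_comp (bopP f) (bopP g)).

Lemma bop_mulA : associative bop_mul. Proof. by move=> f g h; apply: bop_ext. Qed.
Lemma bop_mul1l : left_id bop_one bop_mul. Proof. by move=> f; apply: bop_ext. Qed.
Lemma bop_mul1r : right_id bop_one bop_mul. Proof. by move=> f; apply: bop_ext. Qed.
Lemma bop_mulDl : left_distributive bop_mul +%R.
Proof. by move=> f g h; apply: bop_ext. Qed.
Lemma bop_mulDr : right_distributive bop_mul +%R.
Proof.
move=> f g h; apply: bop_ext => x.
by have := bop_linear f 1 (g x) (h x); rewrite !scale1r.
Qed.

HB.instance Definition _ := GRing.Zmodule_isPzRing.Build bop
  bop_mulA bop_mul1l bop_mul1r bop_mulDl bop_mulDr.

Lemma bop_scale_subproof (a : R[i]) (f : bop) :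
  (fun x => a *: f x) \in bounded_op.
Proof.
have -> : (fun x => a *: f x) = fun x => a *: f x + (0 : H -> H) x.
  by apply/funext => x; rewrite addr0.
exact: bounded_op_comb (bopP f) bounded_op0.
Qed.

Definition bop_cscale (a : R[i]) (f : bop) : bop := BOp (bop_scale_subproof a f).

Lemma bop_scaleA (a b : R) (f : bop) :
  bop_cscale a%:C (bop_cscale b%:C f) = bop_cscale (a * b)%:C f.
Proof. by apply: bop_ext => x /=; rewrite scalerA rmorphM. Qed.
Lemma bop_scale1 : left_id 1 (fun a : R => bop_cscale a%:C).
Proof. by move=> f; apply: bop_ext => x /=; rewrite scale1r. Qed.
Lemma bop_scaleDr : right_distributive (fun a : R => bop_cscale a%:C) +%R.
Proof. by move=> a f g; apply: bop_ext => x; exact: scalerDr. Qed.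
Lemma bop_scaleDl (f : bop) :
  {morph (fun a : R => bop_cscale a%:C f) : a b / a + b}.
Proof.
move=> a b; apply: bop_ext => x.
have -> : (bop_cscale a%:C f + bop_cscale b%:C f) x = a%:C *: f x + b%:C *: f x by [].
by rewrite -scalerDl -rmorphD.
Qed.

(* Only the real scalars are registered as the module structure of [bop], so
   that paths in B(H) can be differentiated with respect to a real parameter;
   complex scalars act through [bop_cscale]. *)
HB.instance Definition _ := GRing.Zmodule_isLmodule.Build R bop
  bop_scaleA bop_scale1 bop_scaleDr bop_scaleDl.

Definition opnorm (f : bop) : R :=
  sup [set complex.Re `|f x| | x in [set x : H | `|x| <= 1]].

Let rn (x : H) : (complex.Re `|x|)%:C = `|x|.
Proof. by rewrite RRe_real. Qed.

Lemma opnorm_has_sup (f : bop) :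
  has_sup [set complex.Re `|f x| | x in [set x : H | `|x| <= 1]].
Proof.
split; first by exists (complex.Re `|f 0|); exists 0 => //=; rewrite normr0 ler01.
have /bounded_opP[_ [M [M0 fM]]] := bopP f.
exists M => _ [x /= x1 <-]; rewrite -lecR rn; apply: (le_trans (fM x)).
by rewrite ler_piMr// lecR.
Qed.

Lemma opnorm_ge0 (f : bop) : 0 <= opnorm f.
Proof.
apply: (@le_trans _ _ (complex.Re `|f 0|)); first by rewrite -lecR rn; exact: normr_ge0.
apply: ub_le_sup; first exact: (opnorm_has_sup f).2.
by exists 0 => //=; rewrite normr0 ler01.
Qed.

Lemma opnorm_le (f : bop) (M : R) :
  (forall x, `|x| <= 1 -> `|f x| <= M%:C) -> opnorm f <= M.
Proof.
move=> fM; apply: ge_sup; first exact: (opnorm_has_sup f).1.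
by move=> _ [x /= x1 <-]; rewrite -lecR rn fM.
Qed.

Lemma bop0 (f : bop) : f 0 = 0.
Proof. by have := bop_linear f (-1) 0 0; rewrite scaler0 addr0 scaleN1r addNr. Qed.

Lemma bopZ (f : bop) (a : R[i]) x : f (a *: x) = a *: f x.
Proof. by have := bop_linear f a x 0; rewrite !addr0 bop0 addr0. Qed.

Lemma opnormP (f : bop) x : `|f x| <= (opnorm f)%:C * `|x|.
Proof.
have [->|x0] := eqVneq x 0; first by rewrite bop0 normr0 mulr0.
have nx : `|x| != 0 by rewrite normr_eq0.
have : `|f (`|x|^-1 *: x)| <= (opnorm f)%:C.
  rewrite -rn lecR; apply: ub_le_sup; first exact: (opnorm_has_sup f).2.
  by exists (`|x|^-1 *: x) => //=; rewrite normrZ normfV normr_id mulVf.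
by rewrite bopZ normrZ normfV normr_id mulrC ler_pdivrMr// normr_gt0.
Qed.

Lemma opnormD (f g : bop) : opnorm (f + g) <= opnorm f + opnorm g.
Proof.
apply: opnorm_le => x x1; rewrite bopDE; apply: (le_trans (ler_normD _ _)).
rewrite rmorphD/= lerD// (le_trans (opnormP _ _))// ler_piMr// lecR.
all: exact: opnorm_ge0.
Qed.

Lemma opnormZ_le (a : R) (f : bop) : opnorm (a *: f) <= `|a| * opnorm f.
Proof.
apply: opnorm_le => x x1.
have -> : (a *: f) x = a%:C *: f x by [].
have na : `|a%:C| = `|a|%:C by rewrite normc_def/= expr0n/= addr0 sqrtr_sqr.
rewrite normrZ na rmorphM/= ler_wpM2l ?lecR//.
by rewrite (le_trans (opnormP _ _))// ler_piMr// lecR opnorm_ge0.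
Qed.

Lemma opnormZ (a : R) (f : bop) : opnorm (a *: f) = `|a| * opnorm f.
Proof.
apply/eqP; rewrite eq_le opnormZ_le/=.
have [->|a0] := eqVneq a 0; first by rewrite normr0 mul0r opnorm_ge0.
rewrite -ler_pdivlMl ?normr_gt0// -normfV.
by apply: (le_trans _ (opnormZ_le _ _)); rewrite scalerA mulVf// scale1r.
Qed.

Lemma opnorm0_eq0 (f : bop) : opnorm f = 0 -> f = 0.
Proof.
move=> f0; apply: bop_ext => x; apply/eqP; rewrite -normr_le0.
by apply: (le_trans (opnormP f x)); rewrite f0 mul0r.
Qed.

HB.instance Definition _ := Lmodule_isNormed.Build R bop
  opnormD opnormZ opnorm0_eq0.

End BoundedOperators.

Section GeneralLinearGroup.
Context {R : realType} {H : completeNormedModType R[i]}.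

Definition GL : set (bop H) := [set x | exists y, x * y = 1 /\ y * x = 1].

Definition bop_inv (x : bop H) : bop H := xget 0 [set y | x * y = 1 /\ y * x = 1].

Definition bracket (x y : bop H) : bop H := x * y - y * x.

End GeneralLinearGroup.

Section Smooth.
Context {R : realType} {V W : normedModType R}.

(* C^k on an open subset of a finite-dimensional [V]: all iterated directional
   derivatives of order at most k exist and are continuous. *)
Fixpoint Ck (k : nat) (U : set V) (f : V -> W) : Prop :=
  if k is k'.+1 then
    (forall u, U u -> {for u, continuous f}) /\
    forall v, (forall u, U u -> derivable f u v) /\ Ck k' U ('D_v f)
  else forall u, U u -> {for u, continuous f}.

Definition smooth_on (U : set V) (f : V -> W) : Prop := forall k, Ck k U f.

End Smooth.

(* A finite-dimensional Lie subgroup of GL(H) is a subgroup carrying a manifold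
   structure that makes it a Lie group and the inclusion into B(H) a smooth
   immersion (an immersed, not necessarily closed, subgroup).  The manifold is
   described by an atlas of local parametrizations, whose composites with the
   inclusion are the maps [par].  Hausdorffness is automatic since the inclusion
   is continuous and injective, and second countability since only connected
   groups are considered. *)
Section LieSubgroups.
Context {R : realType} {H : completeNormedModType R[i]}.

Record chart (m : nat) := Chart {
  dom : set 'rV[R]_m;
  par :> 'rV[R]_m -> bop H
}.

Definition coord m (c : chart m) (x : bop H) : 'rV[R]_m :=
  xget 0 [set u | dom c u /\ c u = x].

Record lie_subgroup (G : set (bop H)) (m : nat) (A : set (chart m)) : Prop := {
  lie_sub_GL : G `<=` GL;
  lie_one : G 1;
  lie_mul : forall x y, G x -> G y -> G (x * y);
  lie_inv : forall x, G x -> G (bop_inv x);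
  chart_open : forall c, A c -> open (dom c);
  chart_inj : forall c, A c ->
    forall u v, dom c u -> dom c v -> c u = c v -> u = v;
  chart_cover : \bigcup_(c in A) (c @` dom c) = G;
  chart_smooth : forall c, A c -> smooth_on (dom c) c;
  chart_immersion : forall c, A c ->
    forall u v, dom c u -> 'D_v c u = 0 -> v = 0;
  chart_transition : forall c1 c2, A c1 -> A c2 ->
    let W := [set u | dom c1 u /\ (c2 @` dom c2) (c1 u)] in
    open W /\ smooth_on W (fun u => coord c2 (c1 u));
  chart_mul : forall c1 c2 c3, A c1 -> A c2 -> A c3 ->
    let W := [set u : 'rV[R]_m * 'rV[R]_m |
      dom c1 u.1 /\ dom c2 u.2 /\ (c3 @` dom c3) (c1 u.1 * c2 u.2)] in
    open W /\ smooth_on W (fun u => coord c3 (c1 u.1 * c2 u.2));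
  chart_inv : forall c1 c2, A c1 -> A c2 ->
    let W := [set u | dom c1 u /\ (c2 @` dom c2) (bop_inv (c1 u))] in
    open W /\ smooth_on W (fun u => coord c2 (bop_inv (c1 u)))
}.

Definition manifold_open m (A : set (chart m)) (O : set (bop H)) : Prop :=
  forall c, A c -> open [set u | dom c u /\ O (c u)].

Definition manifold_connected (G : set (bop H)) m (A : set (chart m)) : Prop :=
  forall O, O `<=` G -> O !=set0 -> manifold_open A O ->
    manifold_open A (G `\` O) -> O = G.

Definition tangent_at_one m (A : set (chart m)) : set (bop H) :=
  [set X | exists c u v, [/\ A c, dom c u, c u = 1 & 'D_v c u = X]].

Definition connected_lie_subgroup (G g : set (bop H)) : Prop :=
  exists m (A : set (chart m)),
    [/\ lie_subgroup G A, manifold_connected G A & tangent_at_one A = g].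

End LieSubgroups.

Section CameronMartin.
Context {R : realType} {H : completeNormedModType R[i]}.

Definition complex_subspace (V : set (bop H)) : Prop :=
  V 0 /\ forall (a : R[i]) x y, V x -> V y -> V (bop_cscale a x + y).

(* [ip] is only meaningful on [V]. *)
Record hermitian_inner_product (V : set (bop H)) (ip : bop H -> bop H -> R[i])
  : Prop := {
  ip_linear : forall (a : R[i]) x y z, V x -> V y -> V z ->
    ip (bop_cscale a x + y) z = a * ip x z + ip y z;
  ip_herm : forall x y, V x -> V y -> ip y x = (ip x y)^*;
  ip_pos : forall x, V x -> x != 0 -> 0 < ip x x
}.

Variables (ginf : set (bop H)) (ip : bop H -> bop H -> R[i]).

Definition cmnorm (x : bop H) : R := Num.sqrt (complex.Re (ip x x)).

Definition cm_complete : Prop :=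
  forall u : nat -> bop H, (forall n, ginf (u n)) ->
    (forall e : R, 0 < e -> exists N, forall m n, (N <= m)%N -> (N <= n)%N ->
      cmnorm (u m - u n) < e) ->
    exists2 x, ginf x & cmnorm (u n - x) @[n --> \oo] --> 0.

Definition continuous_on (N : bop H -> R) (A : set R) (f : R -> bop H) : Prop :=
  forall s, A s -> N (f r - f s) @[r --> within A (nbhs s)] --> 0.

(* [f] has finitely many discontinuities in [0, 1], and one-sided limits (in [V],
   for the norm [N]) at each of them: on every open interval of a subdivision it
   agrees with a continuous function on the closed interval. *)
Definition piecewise_continuous (V : set (bop H)) (N : bop H -> R)
    (f : R -> bop H) : Prop :=
  exists t : seq R, [/\ path <%R 0 t, last 0 t = 1 &
    forall i, (i < size t)%N ->
      let a := nth 0 (0 :: t) i in let b := nth 0 t i in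
      exists F : R -> bop H,
        [/\ forall s, s \in `[a, b] -> V (F s),
            continuous_on N [set` `[a, b]] F &
            forall s, s \in `]a, b[ -> f s = F s]].

(* Derivative of a path on [0, 1], one-sided at the end points. *)
Definition path_derivative (g dg : R -> bop H) : Prop :=
  forall s, s \in `[0, 1] ->
    (r - s)^-1 *: (g r - g s) @[r --> within [set` `[0, 1]] s^'] --> dg s.

Definition log_derivative (g dg : R -> bop H) (s : R) : bop H :=
  bop_inv (g s) * dg s.

(* [g] belongs to C^1_CM, with derivative [dg]. *)
Record C1CM (g dg : R -> bop H) : Prop := {
  C1CM_GL : forall s, s \in `[0, 1] -> GL (g s);
  C1CM_continuous : {within `[0, 1], continuous g};
  C1CM_derivative : path_derivative g dg;
  C1CM_pw_continuous : piecewise_continuous setT Num.norm dg;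
  C1CM_ginf : forall s, s \in `[0, 1] -> ginf (log_derivative g dg s);
  C1CM_log_pw_continuous :
    piecewise_continuous ginf cmnorm (log_derivative g dg)
}.

Definition cm_length (g dg : R -> bop H) : \bar R :=
  (\int[lebesgue_measure]_(s in `[0%R, 1%R]) (cmnorm (log_derivative g dg s))%:E)%E.

(* [ereal_inf set0 = +oo], as required when no path joins [y] to [z]. *)
Definition cm_dist (y z : bop H) : \bar R :=
  ereal_inf [set l | exists g dg,
    [/\ C1CM g dg, g 0 = y, g 1 = z & l = cm_length g dg]].

Definition G_CM : set (bop H) := [set x | (cm_dist x 1%R < +oo)%E].

End CameronMartin.

Section ExtendedMetric.
Context {R : realType} {T : Type} (d : T -> T -> \bar R).

Definition dense_for (A X : set T) : Prop :=
  A `<=` X /\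
  forall x, X x -> forall e : R, 0 < e -> exists2 y, A y & (d x y < e%:E)%E.

Definition complete_for (X : set T) : Prop :=
  forall u : nat -> T, (forall n, X (u n)) ->
    (forall e : R, 0 < e -> exists N, forall m n, (N <= m)%N -> (N <= n)%N ->
      (d (u m) (u n) < e%:E)%E) ->
    exists2 x, X x & d (u n) x @[n --> \oo] --> 0%E.

End ExtendedMetric.

(* Main.v *)
From HB Require Import structures.
Require Import Defs.
From mathcomp Require Import all_boot all_order all_algebra.
From mathcomp Require Import sesquilinear complex.
From mathcomp Require Import all_classical all_reals all_analysis.
From mathcomp Require Import measurable_realfun.
From mathcomp Require Import ring lra.

Set Implicit Arguments.
Unset Strict Implicit.
Unset Printing Implicit Defensive.

Import Order.TTheory GRing.Theory Num.Theory.
Import numFieldNormedType.Exports.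

Local Open Scope classical_set_scope.
Local Open Scope ring_scope.
Local Open Scope complex_scope.

(** The difficulty is that the norm |.| of g_inf and the operator norm are not comparable:
    the inclusion T of the Banach space L = g_inf into B(H) is just a linear map, so that
    logarithmic derivatives that converge for |.| need not converge in B(H), and a Cauchy
    sequence for d has no evident limit in GL(H). Two devices make up for a bound on T.

    The first one is to allow more paths. The logarithmic derivative of a path of C^1_CM
    runs in the graph of T; consider also paths whose logarithmic derivative z comes with
    a continuous w in L such that (w, z) runs in the closure of this graph in L x B(H)
    ([clgraph]), and take |w| as the speed. Conjugation by exp(t T x) is the flow of the
    bracket with x, in L and in B(H) simultaneously; the bound C on the bracket makes it a
    bounded flow in L, so conjugation preserves closed-graph paths and multiplies their
    speeds by at most exp(C |x| t) ([reach_conj]). Cutting a path into short pieces, on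
    which its logarithmic derivative is almost a constant T x, one finds that its end is a
    product of exponentials of elements of g_inf times a remainder that a closed-graph
    path of speed as small as desired joins to 1 ([product_approximation]). This can be
    repeated on the remainder. The successive factors are geometrically small in both
    norms, so the concatenation of infinitely many paths converges ([infinite_product]):
    closed-graph paths lead nowhere else than paths in the graph, at no more than about
    twice the speed ([reach_clgraph_graph]).

    The second one is Baire's theorem. Some set of the x such that the operator norm of
    T x is at most n is dense in a ball of L, hence every w is a limit, for |.|, of
    elements x such that the operator norm of T x is at most K |w|
    ([baire_approximation]). With such x in the exponentials, an element at distance less
    than a from 1 becomes h r, where h is joined to 1 by a path that is short in both
    norms, and r is as close to 1 as desired for d ([controlled_approximation]).

    Completeness follows ([G_CM_complete]). A fast subsequence of a Cauchy sequence is
    shadowed by the partial products of some v h_0 h_1 h_2 ... in which the h_j are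
    geometrically small in both norms. The infinite product converges in B(H), and its
    tails are ends of paths of small speed, so it is also the limit for d.

    For density ([G_CM_dense]), take instead the x in the Lie algebras g_n, whose union
    is dense: an element of G_CM is close to a product of exponentials exp(t T x) with x
    in some g_n. If c is a chart of G_n through 1 with derivative x in the direction v,
    the logarithmic derivatives of s |-> c (u + s v) stay in the tangent space at 1,
    which has finite dimension, so that they converge to x for |.| as s tends to 0.
    Hence c (u + s v) is exp(s T x) up to an error o(s) for d ([lie_tangent]), and a power of
    c (u + s v) approximates exp(t T x) ([G_exp_approx]). Finally G_n is contained in G_CM
    because, G_n being connected, finitely many such chart segments join any of its
    elements to 1 ([lie_reach]).

    Since the elements of C^1_CM are differentiable everywhere, they cannot be
    concatenated directly. All paths are therefore run so that they stop smoothly at both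
    ends ([flat_path], [reach_reparam]). This at most doubles the speeds, which is
    harmless, since only the smallness of d matters ([reach_cm_dist], [C1CM_reach]). *)

(** * Linear combinations in a module *)

(** Identities between linear combinations are proved by reflection: both sides are
    reified over a list of atoms, and the equality reduces to that of the
    coefficients, which are polynomials in the scalars. *)
Inductive lexp (R : Type) : Type :=
  LVar of nat | LZero | LAdd of lexp R & lexp R | LOpp of lexp R
| LScale of R & lexp R.
Arguments LVar {R}. Arguments LZero {R}.

Section LmodSolver.
Context {R : comNzRingType} {V : lmodType R}.

Fixpoint lexp_eval (e : seq V) (x : lexp R) : V :=
  match x with
  | LVar i => nth 0 e i | LZero => 0
  | LAdd x y => lexp_eval e x + lexp_eval e y
  | LOpp x => - lexp_eval e x | LScale a x => a *: lexp_eval e x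
  end.

Fixpoint lexp_coef (x : lexp R) (i : nat) : R :=
  match x with
  | LVar j => (eqn j i)%:R | LZero => 0
  | LAdd x y => lexp_coef x i + lexp_coef y i
  | LOpp x => - lexp_coef x i | LScale a x => a * lexp_coef x i
  end.

Lemma lexp_evalE e x :
  lexp_eval e x = \sum_(i < size e) lexp_coef x i *: nth 0 e i.
Proof.
elim: x => [i||x IHx y IHy|x IHx|a x IHx] /=.
- under eq_bigr => j _ do rewrite (_ : eqn i j = (i == j :> nat)) //.
  have [ie|ie] := ltnP i (size e).
    rewrite (bigD1 (Ordinal ie)) //= eqxx scale1r big1 ?addr0 // => j.
    by rewrite eq_sym -val_eqE /= => /negPf ->; rewrite scale0r.
  rewrite nth_default // big1 // => j _.
  by rewrite gtn_eqF ?scale0r // (leq_trans _ ie).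
- by rewrite big1 // => i _; rewrite scale0r.
- by rewrite IHx IHy -big_split; apply: eq_bigr => i _ /=; rewrite scalerDl.
- by rewrite IHx -sumrN; apply: eq_bigr => i _; rewrite scaleNr.
- by rewrite IHx scaler_sumr; apply: eq_bigr => i _; rewrite scalerA.
Qed.

Lemma lexp_eq e x y :
  foldr (fun i P => lexp_coef x i = lexp_coef y i /\ P) True (iota 0 (size e)) ->
  lexp_eval e x = lexp_eval e y.
Proof.
move=> h; rewrite !lexp_evalE; apply: eq_bigr => i _; congr (_ *: _).
have : (i : nat) \in iota 0 (size e) by rewrite mem_iota /=.
elim: (iota _ _) h => //= j s IH [xy h]; rewrite inE => /orP[/eqP ->//|]; exact: IH.
Qed.
End LmodSolver.

(* Atoms are compared up to unification, as the same product may be elaborated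
   through different structures. *)
Ltac lmod_index v e :=
  lazymatch e with
  | ?w :: ?e' =>
      match goal with
      | _ => let _ := match goal with _ => unify v w end in constr:(O)
      | _ => let n := lmod_index v e' in constr:(S n)
      end
  end.
Ltac lmod_mem v e :=
  lazymatch e with
  | ?w :: ?e' =>
      match goal with
      | _ => let _ := match goal with _ => unify v w end in constr:(true)
      | _ => lmod_mem v e'
      end
  | _ => constr:(false)
  end.
Ltac lmod_atoms t e :=
  lazymatch t with
  | @GRing.add _ ?a ?b => let e1 := lmod_atoms a e in lmod_atoms b e1
  | @GRing.opp _ ?a => lmod_atoms a e
  | @GRing.scale _ _ ?c ?a => lmod_atoms a e
  | @GRing.zero _ => e
  | _ => lazymatch lmod_mem t e with
         | true => e
         | false => constr:(t :: e)
         end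
  end.
Ltac lmod_reify R t e :=
  lazymatch t with
  | @GRing.add _ ?a ?b =>
      let x := lmod_reify R a e in let y := lmod_reify R b e in constr:(@LAdd R x y)
  | @GRing.opp _ ?a => let x := lmod_reify R a e in constr:(@LOpp R x)
  | @GRing.scale _ _ ?c ?a => let x := lmod_reify R a e in constr:(@LScale R c x)
  | @GRing.zero _ => constr:(@LZero R)
  | _ => let i := lmod_index t e in constr:(@LVar R i)
  end.
Ltac lmod R :=
  lazymatch goal with
  | |- @eq ?V ?a ?b =>
    let e0 := constr:(@nil V) in
    let e1 := lmod_atoms a e0 in
    let e := lmod_atoms b e1 in
    let x := lmod_reify R a e in
    let y := lmod_reify R b e in
    refine (@lexp_eq R _ e x y _); cbn [foldr iota size lexp_coef eqn nat_of_bool];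
    repeat split; try ring
  end.

(** * From local to global *)

Section LocalGlobal.
Context {R : realType}.

(** This plays the role of a fine subdivision of [a, b]: a property of intervals that is
    inherited by concatenation, and holds for all short intervals ending or starting at
    a given point, holds for [a, b]. The supremum of the t for which P a t holds cannot
    be smaller than b. *)
Lemma local_to_global (a b : R) (P : R -> R -> Prop) : a < b ->
  (forall s t u, a <= s -> s < t -> t < u -> u <= b -> P s t -> P t u -> P s u) ->
  (forall s, a <= s <= b -> exists2 e : R, 0 < e &
     (forall t, s < t < s + e -> t <= b -> P s t) /\
     (forall t, s - e < t < s -> a <= t -> P t s)) ->
  P a b.
Proof.
move=> ab Ptr Ploc.
pose S := [set t | a < t <= b /\ P a t].
have [e e0 [Pa _]] := Ploc a (ltac:(by apply/andP; split; [|exact: ltW])).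
have Sne : S !=set0.
  exists (Num.min b (a + e / 2)); split.
    by rewrite lt_min ab /= ge_min lexx /= andbT; lra.
  apply: Pa; last by rewrite ge_min lexx.
  rewrite lt_min ab /= gt_min; apply/andP; split; first lra.
  by apply/orP; right; lra.
have Sub : has_ubound S by exists b => t [/andP[]].
have supS : has_sup S by [].
set c := sup S.
have cb : c <= b by apply: ge_sup => // t [/andP[]].
have ac : a < c.
  by have [t St] := Sne; have [/andP[at_ _] _] := St; apply: (lt_le_trans at_); exact: ub_le_sup.
have [f f0 [Pr Pl]] := Ploc c (ltac:(by rewrite cb ltW)).
have Pac : P a c.
  have [t St ct] := sup_adherent f0 supS.
  have [/andP[at_ tb] Pat] := St.
  have tc : t <= c by exact: ub_le_sup.
  have [<-//|tnc] := eqVneq t c.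
  have tltc : t < c by rewrite lt_neqAle tnc.
  apply: (Ptr a t c) => //; apply: Pl; last exact: ltW.
  by rewrite ct.
have [<-//|cnb] := eqVneq c b.
have cltb : c < b by rewrite lt_neqAle cnb.
pose d := Num.min b (c + f / 2).
have cd : c < d by rewrite /d lt_min cltb /=; lra.
have db : d <= b by rewrite /d ge_min lexx.
suff : S d by move=> /(ub_le_sup Sub); rewrite leNgt cd.
split; first by rewrite db (lt_trans ac).
apply: (Ptr a c d) => //; apply: Pr => //; rewrite cd /d gt_min.
by apply/orP; right; lra.
Qed.

End LocalGlobal.

(** * Derivatives and the mean value inequality *)

Section Calculus.
Context {R : realType}.
Implicit Types (V W : normedModType R) (S : set R).

(** Continuity and differentiability at s within the set S; with S = [0, 1] they are
    one-sided at the end points, as for the paths of C^1_CM. *)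
Definition cont_in V S (f : R -> V) (s : R) := forall e : R, 0 < e ->
  exists2 d : R, 0 < d & forall r, S r -> `|r - s| < d -> `|f r - f s| <= e.

Definition der_in V S (f : R -> V) (s : R) (df : V) := forall e : R, 0 < e ->
  exists2 d : R, 0 < d & forall r, S r -> `|r - s| < d ->
    `|f r - f s - (r - s) *: df| <= e * `|r - s|.

Lemma cont_in_cst V S (c : V) s : cont_in S (fun=> c) s.
Proof. by move=> e e0; exists 1 => // r _ _; rewrite subrr normr0 ltW. Qed.

Lemma der_in_affine V S (f : R -> V) s c :
  (forall r, f r - f s = (r - s) *: c) -> der_in S f s c.
Proof.
by move=> fc e e0; exists 1 => // r _ _; rewrite fc subrr normr0 mulr_ge0 // ltW.
Qed.

Lemma der_in_cst V S (c : V) s : der_in S (fun=> c) s 0.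
Proof. by apply: der_in_affine => ?; rewrite subrr scaler0. Qed.

Lemma der_in_aff S (c d s : R) : der_in S ((fun r => c * (r - d)) : R -> R^o) s c.
Proof. by apply: der_in_affine => ?; rewrite /GRing.scale /=; ring. Qed.

Lemma der_in_opp S (s : R) : der_in S ((fun r => - r) : R -> R^o) s (-1).
Proof. by apply: der_in_affine => ?; rewrite /GRing.scale /=; ring. Qed.

Lemma der_in_sub_cst S (t s : R) : der_in S ((fun r => t - r) : R -> R^o) s (-1).
Proof. by apply: der_in_affine => ?; rewrite /GRing.scale /=; ring. Qed.

Lemma cont_in_sub V S S' (f : R -> V) s : S `<=` S' -> cont_in S' f s -> cont_in S f s.
Proof. by move=> SS cf e /cf[d d0 H]; exists d => // r /SS; exact: H. Qed.

Lemma der_in_sub V S S' (f : R -> V) s df : S `<=` S' -> der_in S' f s df -> der_in S f s df.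
Proof. by move=> SS cf e /cf[d d0 H]; exists d => // r /SS; exact: H. Qed.

Lemma der_in_ext V S (f g : R -> V) s df (e0 : R) : 0 < e0 ->
  (forall r, S r -> `|r - s| < e0 -> f r = g r) -> f s = g s ->
  der_in S f s df -> der_in S g s df.
Proof.
move=> e0p fg fgs df_ e /df_[d d0 H]; exists (Num.min d e0); first by rewrite lt_min d0.
by move=> r Sr; rewrite lt_min => /andP[rd re]; rewrite -fg // -fgs; exact: H.
Qed.

Lemma cont_in_ext V S (f g : R -> V) s (e0 : R) : 0 < e0 ->
  (forall r, S r -> `|r - s| < e0 -> f r = g r) -> f s = g s ->
  cont_in S f s -> cont_in S g s.
Proof.
move=> e0p fg fgs df_ e /df_[d d0 H]; exists (Num.min d e0); first by rewrite lt_min d0.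
by move=> r Sr; rewrite lt_min => /andP[rd re]; rewrite -fg // -fgs; exact: H.
Qed.

Lemma der_in_lip V S (f : R -> V) s df : der_in S f s df ->
  exists2 d : R, 0 < d & forall r, S r -> `|r - s| < d ->
    `|f r - f s| <= (`|df| + 1) * `|r - s|.
Proof.
move=> /(_ 1 ltr01)[d d0 H]; exists d => // r Sr rs.
have := H r Sr rs; rewrite mul1r => H1.
rewrite -[f r - f s](subrK ((r - s) *: df)) (le_trans (ler_normD _ _)) //.
rewrite normrZ; lra.
Qed.

Lemma der_in_cont V S (f : R -> V) s df : der_in S f s df -> cont_in S f s.
Proof.
move=> /der_in_lip[d d0 H] e e0.
have c0 : 0 < `|df| + 1 by rewrite ltr_wpDl.
exists (Num.min d (e / (`|df| + 1))); first by rewrite lt_min d0 divr_gt0.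
move=> r Sr; rewrite lt_min => /andP[rd re].
apply: (le_trans (H r Sr rd)).
by move: re; rewrite ltr_pdivlMr // mulrC => /ltW.
Qed.

Lemma cont_in_bnd V S (f : R -> V) s : cont_in S f s ->
  exists2 d : R, 0 < d & forall r, S r -> `|r - s| < d -> `|f r| <= `|f s| + 1.
Proof.
move=> /(_ 1 ltr01)[d d0 H]; exists d => // r Sr rs.
by rewrite -[f r](subrK (f s)) addrC (le_trans (ler_normD _ _)) // lerD2l; exact: H.
Qed.

Lemma cont_inD V S (f g : R -> V) s : cont_in S f s -> cont_in S g s -> cont_in S (fun r => f r + g r) s.
Proof.
move=> cf cg e e0; have e2 : 0 < e / 2 by lra.
have [d d0 Hf] := cf _ e2; have [d' d0' Hg] := cg _ e2.
exists (Num.min d d'); first by rewrite lt_min d0.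
move=> r Sr; rewrite lt_min => /andP[rd rd'].
rewrite opprD addrACA (le_trans (ler_normD _ _)) //.
have := Hf _ Sr rd; have := Hg _ Sr rd'; lra.
Qed.

Lemma cont_inZ V S (a : R -> R) (g : R -> V) s : cont_in S a s -> cont_in S g s ->
  cont_in S (fun r => a r *: g r) s.
Proof.
move=> cf cg e e0.
have [d1 d10 Hb] := cont_in_bnd cf.
pose A := `|a s| + 1; pose B := `|g s| + 1.
have A0 : 0 < A by rewrite ltr_wpDl.
have B0 : 0 < B by rewrite ltr_wpDl.
have [d2 d20 Hf] := cf (e / 2 / B) (ltac:(by rewrite !divr_gt0)).
have [d3 d30 Hg] := cg (e / 2 / A) (ltac:(by rewrite !divr_gt0)).
exists (Num.min d1 (Num.min d2 d3)); first by rewrite !lt_min d10 d20.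
move=> r Sr; rewrite !lt_min => /and3P[h1 h2 h3].
have -> : a r *: g r - a s *: g s = a r *: (g r - g s) + (a r - a s) *: g s.
  lmod R.
rewrite (le_trans (ler_normD _ _)) // !normrZ.
have K1 : `|a r| * `|g r - g s| <= e / 2.
  by rewrite -[e / 2](divfK (lt0r_neq0 A0)) mulrC ler_pM //; [exact: Hg|exact: Hb].
have K2 : `|a r - a s| * `|g s| <= e / 2.
  rewrite -[e / 2](divfK (lt0r_neq0 B0)) ler_pM //; first exact: Hf.
  by rewrite lerDl.
lra.
Qed.

Lemma cont_in_comp V S S' (p : R -> R) (f : R -> V) s :
  (forall r, S' r -> S (p r)) -> cont_in S' p s -> cont_in S f (p s) -> cont_in S' (fun r => f (p r)) s.
Proof.
move=> pS cp cf e e0; have [d d0 Hf] := cf _ e0.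
have [d' d'0 Hp] := cp (d / 2) (ltac:(by rewrite divr_gt0)).
exists d' => // r Sr rs; apply: Hf; first exact: pS.
by apply: (le_lt_trans (Hp _ Sr rs)); lra.
Qed.

Lemma der_in_comp V S S' (p : R -> R) (f : R -> V) s dp df :
  (forall r, S' r -> S (p r)) -> der_in S' p s dp -> der_in S f (p s) df ->
  der_in S' (fun r => f (p r)) s (dp *: df).
Proof.
move=> pS dvp dvf e e0.
have [d1 d10 Hl] := der_in_lip dvp.
pose A := `|dp| + 1; pose B := `|df| + 1.
have A0 : 0 < A by rewrite ltr_wpDl.
have B0 : 0 < B by rewrite ltr_wpDl.
have [d2 d20 Hf] := dvf (e / 2 / A) (ltac:(by rewrite !divr_gt0)).
have [d3 d30 Hp] := dvp (e / 2 / B) (ltac:(by rewrite !divr_gt0)).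
exists (Num.min d1 (Num.min (d2 / A) d3)); first by rewrite !lt_min d10 d30 divr_gt0.
move=> r Sr; rewrite !lt_min => /and3P[h1 h2 h3].
have K0 := Hl _ Sr h1.
have K1 : `|p r - p s| < d2.
  by apply: (le_lt_trans K0); rewrite mulrC -ltr_pdivlMr.
have K2 := Hf _ (pS _ Sr) K1.
have K3 : `|p r - p s - (r - s) * dp| <= e / 2 / B * `|r - s| := Hp _ Sr h3.
have -> : f (p r) - f (p s) - (r - s) *: (dp *: df) =
   (f (p r) - f (p s) - (p r - p s) *: df) + (p r - p s - (r - s) * dp) *: df.
  lmod R.
rewrite (le_trans (ler_normD _ _)) // normrZ.
have K4 : `|p r - p s - (r - s) * dp| * `|df| <= e / 2 * `|r - s|.
  rewrite [X in _ <= X](_ : _ = e / 2 / B * `|r - s| * B); last first.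
    by field; rewrite gt_eqF.
  by rewrite ler_pM // lerDl.
have K5 : e / 2 / A * `|p r - p s| <= e / 2 * `|r - s|.
  rewrite [X in _ <= X](_ : _ = e / 2 / A * (A * `|r - s|)); last first.
    by field; rewrite gt_eqF.
  by rewrite ler_wpM2l // ltW // !divr_gt0.
lra.
Qed.

Lemma der_inD V S (f g : R -> V) s df dg : der_in S f s df -> der_in S g s dg ->
  der_in S (fun r => f r + g r) s (df + dg).
Proof.
move=> cf cg e e0; have e2 : 0 < e / 2 by lra.
have [d d0 Hf] := cf _ e2; have [d' d0' Hg] := cg _ e2.
exists (Num.min d d'); first by rewrite lt_min d0.
move=> r Sr; rewrite lt_min => /andP[rd rd'].
have -> : f r + g r - (f s + g s) - (r - s) *: (df + dg) =
  (f r - f s - (r - s) *: df) + (g r - g s - (r - s) *: dg) by lmod R.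
rewrite (le_trans (ler_normD _ _)) //.
have := Hf _ Sr rd; have := Hg _ Sr rd'; lra.
Qed.

Lemma der_inZ V S (a : R) (f : R -> V) s df : der_in S f s df ->
  der_in S (fun r => a *: f r) s (a *: df).
Proof.
move=> cf e e0; have A0 : 0 < `|a| + 1 by rewrite ltr_wpDl.
have [d d0 H] := cf (e / (`|a| + 1)) (ltac:(by rewrite divr_gt0)).
exists d => // r Sr rs; have := H _ Sr rs.
have -> : a *: f r - a *: f s - (r - s) *: (a *: df) = a *: (f r - f s - (r - s) *: df).
  lmod R.
rewrite normrZ => K; apply: (le_trans (ler_wpM2l (normr_ge0 a) K)).
rewrite mulrA ler_wpM2r // mulrCA ger_pMr // ler_pdivrMr // mul1r lerDl //.
Qed.

(** For any e > 0 the inequality with M + e in place of M holds around each point by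
    differentiability, and it is inherited by concatenation. *)
Lemma mean_value_le V (f df : R -> V) (a b M : R) : a <= b ->
  (forall s, a <= s <= b -> der_in `[a, b]%classic f s (df s)) ->
  (forall s, a <= s <= b -> `|df s| <= M) ->
  `|f b - f a| <= M * (b - a).
Proof.
rewrite le_eqVlt => /predU1P[<-|ab] fdf dfM; first by rewrite !subrr normr0 mulr0.
apply/ler_addgt0Pr => e e0.
have ba0 : 0 < b - a by lra.
pose e' := e / (b - a).
have e'0 : 0 < e' by rewrite divr_gt0.
suff : `|f b - f a| <= (M + e') * (b - a).
  by rewrite mulrDl /e' divfK // lt0r_neq0.
apply: (local_to_global (P := fun s t => `|f t - f s| <= (M + e') * (t - s))) => //.
  move=> s t u _ st tu _ H1 H2.
  have -> : f u - f s = (f u - f t) + (f t - f s) by lmod R.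
  apply: (le_trans (ler_normD _ _)).
  have -> : (M + e') * (u - s) = (M + e') * (u - t) + (M + e') * (t - s) by ring.
  exact: lerD.
move=> s sab; have [d d0 H] := fdf s sab e' e'0.
have loc r : a <= r <= b -> `|r - s| < d -> `|f r - f s| <= (M + e') * `|r - s|.
  move=> rab rs; have := H r; rewrite /= in_itv /= => /(_ rab rs) K.
  rewrite -[f r - f s](subrK ((r - s) *: df s)) (le_trans (ler_normD _ _)) //.
  rewrite normrZ addrC [X in _ <= X]mulrDl lerD // mulrC ler_wpM2r //; exact: dfM.
move: sab => /andP[as_ sb].
exists d => //; split=> t /andP[h1 h2] h3.
- rewrite -[X in _ * X]gtr0_norm ?subr_gt0 //; apply: loc; first by rewrite h3 (le_trans as_) // ltW.
  by rewrite gtr0_norm ?subr_gt0 //; lra.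
- rewrite distrC -[X in _ * X]gtr0_norm ?subr_gt0 // [X in _ * X]distrC.
  apply: loc; first by rewrite h3 (le_trans _ sb) // ltW.
  by rewrite ltr0_norm ?subr_lt0 //; lra.
Qed.

Lemma der0_const V (f df : R -> V) (a b : R) : a <= b ->
  (forall s, a <= s <= b -> der_in `[a, b]%classic f s (df s)) ->
  (forall s, a <= s <= b -> df s = 0) -> f b = f a.
Proof.
move=> ab H df0; apply/eqP; rewrite -subr_eq0 -normr_le0.
apply: (le_trans (mean_value_le (M := 0) ab H _)); last by rewrite mul0r.
by move=> s sab; rewrite df0 // normr0.
Qed.

Lemma cont_in_bounded V (f : R -> V) (a b : R) : a <= b ->
  (forall s, a <= s <= b -> cont_in `[a, b]%classic f s) ->
  exists M : R, forall s, a <= s <= b -> `|f s| <= M.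
Proof.
rewrite le_eqVlt => /predU1P[<-|ab] cf.
  by exists `|f a| => s; rewrite -eq_le => /eqP ->.
apply: (local_to_global (P := fun s t => exists M : R, forall r, s <= r <= t -> `|f r| <= M)) => //.
  move=> s t u _ _ _ _ [M HM] [N HN]; exists (Num.max M N) => r /andP[sr ru].
  rewrite le_max; have [rt|tr] := lerP r t; first by rewrite HM ?sr ?rt.
  by rewrite [X in _ || X]HN ?orbT // ru ltW.
move=> s sab; have [d d0 H] := cont_in_bnd (cf s sab).
move: sab => /andP[as_ sb].
exists d => //; split=> t /andP[h1 h2] h3; exists (`|f s| + 1) => r /andP[h4 h5];
  apply: H => /=; rewrite ?in_itv /= ?ltr_norml; lra.
Qed.

End Calculus.

(** * Sequences *)

Section SequenceLimits.
Context {R : realType}.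
Implicit Types V : normedModType R.

Definition seq_lim V (u : nat -> V) (l : V) := forall e : R, 0 < e ->
  exists N, forall n, (N <= n)%N -> `|u n - l| <= e.

Lemma seq_limP V (u : nat -> V) l : seq_lim u l <-> u n @[n --> \oo] --> l.
Proof.
split=> [ul|/cvgrPdist_le ul].
  apply/cvgrPdist_le => e e0; have [N HN] := ul e e0.
  by exists N => // n /= Nn; rewrite distrC; exact: HN.
move=> e e0; have [N _ HN] := ul e e0.
by exists N => n Nn; rewrite distrC; exact: HN.
Qed.

Lemma seq_lim_le V (u : nat -> V) l M : seq_lim u l -> (forall n, `|u n| <= M) -> `|l| <= M.
Proof.
move=> ul uM; apply/ler_addgt0Pr => e e0; have [N HN] := ul e e0.
rewrite -[l](subrK (u N)) addrC (le_trans (ler_normD _ _)) // lerD //.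
by rewrite distrC HN.
Qed.

Lemma seq_lim_unique V (u : nat -> V) l l' : seq_lim u l -> seq_lim u l' -> l = l'.
Proof.
move=> ul ul'; apply/eqP; rewrite -subr_eq0 -normr_le0; apply/ler_addgt0Pr => e e0.
have [N HN] := ul (e / 2) (ltac:(by rewrite divr_gt0)).
have [N' HN'] := ul' (e / 2) (ltac:(by rewrite divr_gt0)).
have -> : l - l' = (u (maxn N N') - l') - (u (maxn N N') - l) by lmod R.
rewrite (le_trans (ler_normB _ _)) //.
have := HN _ (leq_maxl N N'); have := HN' _ (leq_maxr N N'); lra.
Qed.

Lemma seq_limD V (u v : nat -> V) l l' : seq_lim u l -> seq_lim v l' -> seq_lim (fun n => u n + v n) (l + l').
Proof.
move=> ul vl e e0.
have [N HN] := ul (e / 2) (ltac:(by rewrite divr_gt0)).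
have [N' HN'] := vl (e / 2) (ltac:(by rewrite divr_gt0)).
exists (maxn N N') => n; rewrite geq_max => /andP[n1 n2].
have -> : u n + v n - (l + l') = (u n - l) + (v n - l') by lmod R.
rewrite (le_trans (ler_normD _ _)) //.
have := HN _ n1; have := HN' _ n2; lra.
Qed.

Lemma seq_lim_lip V (W : normedModType R) (f : V -> W) (M : R) u l :
  (forall x y, `|f x - f y| <= M * `|x - y|) -> seq_lim u l -> seq_lim (fun n => f (u n)) (f l).
Proof.
move=> fM ul e e0.
have M0 : 0 < `|M| + 1 by rewrite ltr_wpDl.
have [N HN] := ul (e / (`|M| + 1)) (ltac:(by rewrite divr_gt0)).
exists N => n Nn; rewrite (le_trans (fM _ _)) // (le_trans (ler_wpM2r _ (_ : M <= `|M| + 1))) //.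
  by rewrite (le_trans (ler_norm _)) // lerDl.
by rewrite mulrC -ler_pdivlMr //; exact: HN.
Qed.

Lemma seq_limS V (u : nat -> V) l : seq_lim u l -> seq_lim (fun n => u n.+1) l.
Proof. by move=> ul e /ul[N HN]; exists N => n Nn; apply: HN; exact: leqW. Qed.

Lemma seq_lim_shift V (u : nat -> V) l k : seq_lim u l -> seq_lim (fun n => u (n + k)%N) l.
Proof.
by move=> ul e /ul[N HN]; exists N => n Nn; apply: HN; rewrite (leq_trans Nn) // leq_addr.
Qed.

Lemma seq_limZ V (u : nat -> V) (a : R) l : seq_lim u l -> seq_lim (fun n => a *: u n) (a *: l).
Proof.
by apply: (seq_lim_lip (f := fun x => a *: x) (M := `|a|)) => x y; rewrite -scalerBr normrZ.
Qed.

Lemma seq_limB V (u v : nat -> V) l l' : seq_lim u l -> seq_lim v l' -> seq_lim (fun n => u n - v n) (l - l').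
Proof.
move=> ul /(seq_limZ (-1)) vl; have := seq_limD ul vl.
by rewrite scaleN1r => K e /K[N HN]; exists N => n /HN; rewrite scaleN1r.
Qed.

Lemma seq_lim_le2 V (u : nat -> V) (v : nat -> R^o) l (c : R) :
  seq_lim u l -> seq_lim v c -> (forall n, `|u n| <= v n) -> `|l| <= c.
Proof.
move=> ul vc uv; apply/ler_addgt0Pr => e e0.
have [N HN] := ul (e / 2) (ltac:(by rewrite divr_gt0)).
have [N' HN'] := vc (e / 2) (ltac:(by rewrite divr_gt0)).
have {HN} h1 := HN _ (leq_maxl N N'); have {HN'} h2 := HN' _ (leq_maxr N N').
move: h2; rewrite ler_norml => /andP[_ h2].
have h3 := uv (maxn N N').
have h4 : `|l| <= `|u (maxn N N')| + `|u (maxn N N') - l|.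
  have E : l = u (maxn N N') - (u (maxn N N') - l) by lmod R.
  by rewrite [X in `|X| <= _]E; exact: ler_normB.
lra.
Qed.

(** The increments form an absolutely convergent series. *)
Lemma seq_lim_summable (V : completeNormedModType R) (u : nat -> V) (v : nat -> R) :
  (forall n, `|u n.+1 - u n| <= v n) -> cvgn (series v) -> exists l, seq_lim u l.
Proof.
move=> uv cv.
have cn : cvgn [normed series (fun n => u n.+1 - u n)].
  apply: series_le_cvg cv => n /=; [exact: normr_ge0| |exact: uv].
  by apply: le_trans (uv n).
have := normed_cvg cn => /cvg_ex[l /= ul].
exists (u 0%N + l); move/seq_limP: ul => ul.
move=> e /ul[N HN]; exists N => n /HN.
rewrite /series /= telescope_sumr //.
by have -> : u n - u 0%N - l = u n - (u 0%N + l) by lmod R.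
Qed.

(** A Cauchy filter contains balls of radius 1/(n+1); their centres form a Cauchy
    sequence, and its limit is also that of the filter. *)
Lemma complete_of_cauchy_seq (V : normedModType R) :
  (forall u : nat -> V, (forall e : R, 0 < e -> exists N, forall m n,
      (N <= m)%N -> (N <= n)%N -> `|u m - u n| <= e) -> exists l, seq_lim u l) ->
  forall F : set_system V, ProperFilter F -> cauchy F -> cvg F.
Proof.
move=> seqc F FF /cauchyP cF.
have /choice[x Hx] n : exists x : V, F (ball x (n.+1%:R^-1 : R)) by exact: cF.
have xx m n : `|x m - x n| < m.+1%:R^-1 + n.+1%:R^-1.
  have [y [ym yn]] := filter_ex (filterI (Hx m) (Hx n)).
  have -> : x m - x n = (x m - y) + (y - x n) by lmod R.
  rewrite (le_lt_trans (ler_normD _ _)) // ltrD //.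
    by move: ym; rewrite -ball_normE.
  by move: yn; rewrite -ball_normE /= distrC.
have inv (e : R) : 0 < e -> exists N, forall n, (N <= n)%N -> n.+1%:R^-1 <= e.
  move=> e0; have [N HN] : exists N : nat, e^-1 <= N.+1%:R.
    exists (Num.truncn e^-1); apply: ltW.
    by have /truncn_itv/andP[] : 0 <= e^-1 by rewrite invr_ge0 ltW.
  exists N => n Nn; rewrite -[e]invrK lef_pV2 ?posrE ?invr_gt0 //.
  by rewrite (le_trans HN) // ler_nat ltnS.
have [l xl] : exists l, seq_lim x l.
  apply: seqc => e e0; have [N HN] := inv (e / 2) (ltac:(by rewrite divr_gt0)).
  exists N => m n /HN h1 /HN h2; by apply: ltW; apply: (lt_le_trans (xx _ _)); rewrite (splitr e) lerD.
apply: (cvgP l); apply/fcvgrPdist_lt => e e0.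
have [N HN] := inv (e / 2) (ltac:(by rewrite divr_gt0)).
have [N' HN'] := xl (e / 2) (ltac:(by rewrite divr_gt0)).
pose n := maxn N N'.
apply: filterS (Hx n) => y; rewrite -ball_normE /= => yn.
have -> : l - y = (x n - y) - (x n - l) by lmod R.
rewrite (le_lt_trans (ler_normB _ _)) // (splitr e) ltr_leD //; last by apply: HN'; exact: leq_maxr.
by apply: (lt_le_trans yn); apply: HN; exact: leq_maxl.
Qed.

End SequenceLimits.

(** * The Banach algebra of bounded operators *)

Section BopAlgebra.
Context {R : realType} {H : completeNormedModType R[i]}.
Local Notation B := (bop H).

Lemma bop_normE (f : B) : `|f| = opnorm f. Proof. by []. Qed.

Lemma bop_normM (f g : B) : `|f * g| <= `|f| * `|g|.
Proof.
rewrite !bop_normE; apply: opnorm_le => x x1.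
have -> : (f * g) x = f (g x) by [].
apply: (le_trans (opnormP _ _)); rewrite rmorphM /= ler_wpM2l ?lecR ?opnorm_ge0 //.
by apply: (le_trans (opnormP _ _)); rewrite ler_piMr // lecR opnorm_ge0.
Qed.

Lemma bop_norm1 : `|1 : B| <= 1.
Proof. by rewrite bop_normE; apply: opnorm_le => x x1. Qed.

Lemma bop_scalerAl (a : R) (f g : B) : a *: (f * g) = (a *: f) * g.
Proof. exact: bop_ext. Qed.

Lemma bop_scalerAr (a : R) (f g : B) : a *: (f * g) = f * (a *: g).
Proof. by apply: bop_ext => x /=; rewrite -[RHS]/(f (a%:C *: g x)) bopZ. Qed.

(* The ring laws restated at the type [bop H]: rewriting with them keeps products
   in the form in which they are elaborated, so that [lmod] recognizes them. *)
Lemma bmulDl (x y z : B) : (x + y) * z = x * z + y * z. Proof. exact: mulrDl. Qed.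
Lemma bmulDr (x y z : B) : x * (y + z) = x * y + x * z. Proof. exact: mulrDr. Qed.
Lemma bmulBl (x y z : B) : (x - y) * z = x * z - y * z. Proof. exact: mulrBl. Qed.
Lemma bmulBr (x y z : B) : x * (y - z) = x * y - x * z. Proof. exact: mulrBr. Qed.
Lemma bmulA (x y z : B) : x * (y * z) = x * y * z. Proof. exact: mulrA. Qed.
Lemma bmul1l (x : B) : 1 * x = x. Proof. exact: mul1r. Qed.
Lemma bmul1r (x : B) : x * 1 = x. Proof. exact: mulr1. Qed.
Lemma bmul0l (x : B) : 0 * x = 0. Proof. exact: mul0r. Qed.
Lemma bmul0r (x : B) : x * 0 = 0. Proof. exact: mulr0. Qed.
Lemma bmulNl (x y : B) : - x * y = - (x * y). Proof. exact: mulNr. Qed.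
Lemma bmulNr (x y : B) : x * - y = - (x * y). Proof. exact: mulrN. Qed.

Definition inverse_of (h hb : B) := h * hb = 1 /\ hb * h = 1.

Lemma inverse_unique (x y z : B) : inverse_of x y -> x * z = 1 -> y = z.
Proof. by move=> [xy yx] xz; rewrite -[z]bmul1l -yx -bmulA xz bmul1r. Qed.

Lemma inverse_sym (x y : B) : inverse_of x y -> inverse_of y x. Proof. by case. Qed.

Lemma inverse_mul (x xb y yb : B) : inverse_of x xb -> inverse_of y yb -> inverse_of (x * y) (yb * xb).
Proof.
move=> [e1 e2] [e3 e4]; split; first by rewrite !bmulA -[x * y * yb]bmulA e3 bmul1r.
by rewrite !bmulA -[yb * xb * x]bmulA e2 bmul1r.
Qed.

(** The limit is the pointwise one; the Cauchy estimates pass to it uniformly on the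
    unit ball. *)
Lemma bop_complete_seq (u : nat -> B) :
  (forall e : R, 0 < e -> exists N, forall m n,
      (N <= m)%N -> (N <= n)%N -> `|u m - u n| <= e) -> exists l, seq_lim u l.
Proof.
move=> cu.
have ux (x : H) m n : `|u m x - u n x| <= `|u m - u n|%:C * `|x|.
  exact: (opnormP (u m - u n)).
have rn (x : H) : (complex.Re `|x|)%:C = `|x| by rewrite RRe_real.
have rp (x : H) : 0 <= complex.Re `|x| by rewrite -lecR rn; exact: normr_ge0.
have cx (x : H) : cvg (u n x @[n --> \oo]).
  apply: cauchy_cvg; apply/cauchyP => e e0.
  have [eR er] : exists eR : R, e = eR%:C.
    by exists (complex.Re e); rewrite RRe_real // gtr0_real.
  rewrite er; have eR0 : 0 < eR by move: e0; rewrite er ltcR.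
  have p0 : 0 < complex.Re `|x| + 1 by rewrite ltr_wpDl.
  have [N HN] := cu (eR / 2 / (complex.Re `|x| + 1)) (ltac:(by rewrite !divr_gt0)).
  exists (u N x); exists N => // n /= Nn; rewrite -ball_normE /=.
  apply: (le_lt_trans (ux _ _ _)); rewrite -rn -rmorphM ltcR /=.
  apply: (@le_lt_trans _ _ (eR / 2)); last lra.
  apply: (le_trans (ler_wpM2r (rp x) (HN _ _ (leqnn _) Nn))).
  have E0 : 0 <= eR / 2 by rewrite divr_ge0 // ltW.
  by rewrite -[_ / _ / _ * _]mulrA ler_piMr // mulrC ler_pdivrMr // mul1r lerDl.
pose l (x : H) := lim (u n x @[n --> \oo]).
have lx x : u n x @[n --> \oo] --> l x := cx x.
have cl x (e : R) N : (forall n, (N <= n)%N -> `|u N x - u n x| <= e%:C) -> `|u N x - l x| <= e%:C.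
  move=> h; rewrite -rn lecR; apply/ler_addgt0Pr => d d0.
  have /cvgrPdist_le/(_ d%:C) := lx x; rewrite ltcR => /(_ d0)[N' _ HN'].
  rewrite -lecR rn -[_ - _](subrKA (u (maxn N N') x)).
  apply: (le_trans (ler_normD _ _)); rewrite rmorphD lerD //.
    by apply: h; exact: leq_maxl.
  by rewrite distrC; apply: HN'; exact: leq_maxr.
have llin : linear l.
  move=> a x y.
  have h1 : u n (a *: x + y) @[n --> \oo] --> a *: l x + l y.
    under eq_fun do rewrite bop_linear.
    by apply: cvgD => //; apply: cvgZr.
  exact: (cvg_unique _ (lx _) h1).
have [N1 HN1] := cu 1 ltr01.
have lb : l \in bounded_op (H := H).
  apply/bounded_opP; split=> //; exists (1 + `|u N1|); split; first by rewrite addr_ge0.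
  move=> x; rewrite -[l x](subrK (u N1 x)) (le_trans (ler_normD _ _)) //.
  rewrite rmorphD mulrDl lerD //; last exact: opnormP.
  rewrite mul1r distrC -[leRHS]rn; apply: cl => n Nn.
  apply: (le_trans (ux _ _ _)); rewrite rn ler_piMl // -[1]/(1%:C) lecR.
  exact: HN1.
exists (BOp lb) => e e0; have [N HN] := cu e e0; exists N => n Nn.
rewrite bop_normE; apply: opnorm_le => x x1.
rewrite -[X in `|X|]/(u n x - l x); apply: cl => m nm.
apply: (le_trans (ux _ _ _)); apply: (@le_trans _ _ (e%:C * 1)); last by rewrite mulr1.
apply: ler_pM => //; rewrite lecR //; apply: HN => //; exact: leq_trans nm.
Qed.

HB.instance Definition _ := Uniform_isComplete.Build (bop H)
  (complete_of_cauchy_seq bop_complete_seq).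

End BopAlgebra.

Section BopCalculus.
Context {R : realType} {H : completeNormedModType R[i]}.
Local Notation B := (bop H).
Implicit Types (f g k kb : R -> B) (S : set R) (s : R).

Lemma cont_inM S f g s : cont_in S f s -> cont_in S g s -> cont_in S (fun r => f r * g r) s.
Proof.
move=> cf cg e e0.
have [d1 d10 Hb] := cont_in_bnd cf.
have A0 : 0 < `|f s| + 1 by rewrite ltr_wpDl.
have B0 : 0 < `|g s| + 1 by rewrite ltr_wpDl.
have [d2 d20 Hf] := cf (e / 2 / (`|g s| + 1)) (ltac:(by rewrite !divr_gt0)).
have [d3 d30 Hg] := cg (e / 2 / (`|f s| + 1)) (ltac:(by rewrite !divr_gt0)).
exists (Num.min d1 (Num.min d2 d3)); first by rewrite !lt_min d10 d20.
move=> r Sr; rewrite !lt_min => /and3P[h1 h2 h3].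
have -> : f r * g r - f s * g s = f r * (g r - g s) + (f r - f s) * g s.
  rewrite bmulBr bmulBl; lmod R.
rewrite (le_trans (ler_normD _ _)) //.
have K1 : `|f r| * `|g r - g s| <= e / 2.
  by rewrite -[e / 2](divfK (lt0r_neq0 A0)) mulrC ler_pM //; [exact: Hg|exact: Hb].
have K2 : `|f r - f s| * `|g s| <= e / 2.
  by rewrite -[e / 2](divfK (lt0r_neq0 B0)) ler_pM //; [exact: Hf|rewrite lerDl].
have := bop_normM (f r) (g r - g s); have := bop_normM (f r - f s) (g s); lra.
Qed.

Lemma der_inM S f g s df dg : der_in S f s df -> der_in S g s dg ->
  der_in S (fun r => f r * g r) s (df * g s + f s * dg).
Proof.
move=> dvf dvg e e0.
have [d1 d10 Hb] := cont_in_bnd (der_in_cont dvf).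
have A0 : 0 < `|f s| + 1 by rewrite ltr_wpDl.
have B0 : 0 < `|g s| + 1 by rewrite ltr_wpDl.
have C0 : 0 < `|dg| + 1 by rewrite ltr_wpDl.
have [d2 d20 Hf] := dvf (e / 3 / (`|g s| + 1)) (ltac:(by rewrite !divr_gt0)).
have [d3 d30 Hg] := dvg (e / 3 / (`|f s| + 1)) (ltac:(by rewrite !divr_gt0)).
have [d4 d40 Hc] := der_in_cont dvf (e := e / 3 / (`|dg| + 1)) (ltac:(by rewrite !divr_gt0)).
exists (Num.min (Num.min d1 d4) (Num.min d2 d3)); first by rewrite !lt_min d10 d20 d40.
move=> r Sr; rewrite !lt_min => /andP[/andP[h1 h4] /andP[h2 h3]].
have -> : f r * g r - f s * g s - (r - s) *: (df * g s + f s * dg) =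
  f r * (g r - g s - (r - s) *: dg) + (f r - f s - (r - s) *: df) * g s
   + (r - s) *: ((f r - f s) * dg).
  rewrite bmulBr bmulBr !bmulBl -bop_scalerAl -bop_scalerAr; lmod R.
rewrite (le_trans (ler_normD _ _)) // normrZ.
have K1 : `|f r * (g r - g s - (r - s) *: dg)| <= e / 3 * `|r - s|.
  rewrite (le_trans (bop_normM _ _)) //.
  rewrite [leRHS](_ : _ = (`|f s| + 1) * (e / 3 / (`|f s| + 1) * `|r - s|)).
    by rewrite ler_pM //; [exact: Hb|exact: Hg].
  by field; rewrite lt0r_neq0.
have K2 : `|(f r - f s - (r - s) *: df) * g s| <= e / 3 * `|r - s|.
  rewrite (le_trans (bop_normM _ _)) //.
  rewrite [leRHS](_ : _ = (e / 3 / (`|g s| + 1) * `|r - s|) * (`|g s| + 1)).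
    by rewrite ler_pM //; [exact: Hf|rewrite lerDl].
  by field; rewrite lt0r_neq0.
have K3 : `|r - s| * `|(f r - f s) * dg| <= e / 3 * `|r - s|.
  rewrite mulrC ler_wpM2r // (le_trans (bop_normM _ _)) //.
  by rewrite -[e / 3](divfK (lt0r_neq0 C0)) ler_pM //; [exact: Hc|rewrite lerDl].
have := ler_normD (f r * (g r - g s - (r - s) *: dg)) ((f r - f s - (r - s) *: df) * g s).
lra.
Qed.

Lemma inv_diff (k kb l lb : B) : k * kb = 1 -> lb * l = 1 ->
  lb - kb = - (lb * (l - k) * kb).
Proof.
move=> kkb lbl; rewrite bmulBr bmulBl lbl bmul1l -bmulA kkb bmul1r; lmod R.
Qed.

(** From k(r)^-1 - k(s)^-1 = - k(r)^-1 (k(r) - k(s)) k(s)^-1, first |k(r)^-1| is at most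
    twice |k(s)^-1| when r is close to s, and then continuity follows. *)
Lemma cont_in_inv S k kb s : S s -> (forall r, S r -> k r * kb r = 1 /\ kb r * k r = 1) ->
  cont_in S k s -> cont_in S kb s.
Proof.
move=> Ss kkb ck.
have A0 : 0 < `|kb s| + 1 by rewrite ltr_wpDl.
have [d1 d10 H1] := ck (2^-1 / (`|kb s| + 1)) (ltac:(by rewrite !divr_gt0)).
have inve r : S r -> `|kb r - kb s| <= `|kb r| * `|k r - k s| * `|kb s|.
  move=> Sr; rewrite (@inv_diff (k s) (kb s) (k r)); [|by case: (kkb s Ss)|by case: (kkb r Sr)].
  by rewrite normrN (le_trans (bop_normM _ _)) // ler_wpM2r // bop_normM.
have bnd r : S r -> `|r - s| < d1 -> `|kb r| <= 2 * `|kb s|.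
  move=> Sr rs; have h1 := inve _ Sr; have h2 := H1 _ Sr rs.
  have h3 : `|k r - k s| * `|kb s| <= 2^-1.
    by rewrite -[2^-1](divfK (lt0r_neq0 A0)) ler_pM // lerDl.
  have h4 : `|kb r| * `|k r - k s| * `|kb s| <= `|kb r| * 2^-1.
    by rewrite -mulrA ler_wpM2l.
  have h5 : `|kb r| <= `|kb r - kb s| + `|kb s|.
    by rewrite -[X in `|X| <= _](subrK (kb s)) ler_normD.
  lra.
move=> e e0.
have D0 : 0 < 2 * (`|kb s| + 1) * (`|kb s| + 1) by rewrite !mulr_gt0.
have [d2 d20 H2] := ck (e / (2 * (`|kb s| + 1) * (`|kb s| + 1))) (ltac:(by rewrite divr_gt0)).
exists (Num.min d1 d2); first by rewrite lt_min d10.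
move=> r Sr; rewrite lt_min => /andP[r1 r2]; apply: (le_trans (inve _ Sr)).
rewrite [e](_ : _ = (2 * (`|kb s| + 1)) * (e / (2 * (`|kb s| + 1) * (`|kb s| + 1))) * (`|kb s| + 1)); last first.
  by field; rewrite lt0r_neq0.
apply: ler_pM; rewrite ?mulr_ge0 // ?lerDl //.
apply: ler_pM => //; last exact: H2.
by apply: (le_trans (bnd _ Sr r1)); rewrite ler_wpM2l // lerDl.
Qed.

End BopCalculus.

(** * A smooth step *)

Section SmoothStep.
Context {R : realType}.

Definition clamp (s : R) : R := if s <= 0 then 0 else if 1 <= s then 1 else s.
(** A path precomposed with this step has zero velocity at 0 and at 1, so it extends by
    constants and can be concatenated with another one. *)
Definition smoothstep (s : R) : R := 3 * clamp s ^+ 2 - 2 * clamp s ^+ 3.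
Definition dsmoothstep (s : R) : R := 6 * clamp s * (1 - clamp s).

Lemma clamp_le0 s : s <= 0 -> clamp s = 0. Proof. by rewrite /clamp => ->. Qed.
Lemma clamp_ge1 s : 1 <= s -> clamp s = 1.
Proof. by rewrite /clamp => s1; rewrite s1 leNgt (lt_le_trans ltr01). Qed.
Lemma clamp01 s : 0 <= clamp s <= 1.
Proof.
by rewrite /clamp; case: (leP s 0) => ?; [|case: (leP 1 s) => ?]; apply/andP; split; lra.
Qed.

Lemma clamp_lip r s : `|clamp r - clamp s| <= `|r - s|.
Proof.
rewrite /clamp; case: (leP s 0) => s0; case: (leP r 0) => r0;
 case: (leP 1 s) => s1; case: (leP 1 r) => r1;
 have a2 := ler_norm (r - s); have := ler_norm (- (r - s)); rewrite normrN => a1;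
 rewrite ler_norml; apply/andP; split; lra.
Qed.

Lemma smoothstep_le0 s : s <= 0 -> smoothstep s = 0.
Proof. by rewrite /smoothstep => /clamp_le0 ->; ring. Qed.
Lemma dsmoothstep_le0 s : s <= 0 -> dsmoothstep s = 0.
Proof. by rewrite /dsmoothstep => /clamp_le0 ->; ring. Qed.
Lemma smoothstep_ge1 s : 1 <= s -> smoothstep s = 1.
Proof. by rewrite /smoothstep => /clamp_ge1 ->; ring. Qed.
Lemma dsmoothstep_ge1 s : 1 <= s -> dsmoothstep s = 0.
Proof. by rewrite /dsmoothstep => /clamp_ge1 ->; ring. Qed.

Lemma smoothstep01 s : 0 <= smoothstep s <= 1.
Proof.
have /andP[x0 x1] := clamp01 s; rewrite /smoothstep; set x := clamp s in x0 x1 *.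
have u0 : 0 <= 3 - 2 * x by lra.
have v0 : 0 <= 1 + 2 * x by lra.
have h1 := mulr_ge0 (sqr_ge0 x) u0; have h2 := mulr_ge0 (sqr_ge0 (1 - x)) v0.
have e1 : x ^+ 2 * (3 - 2 * x) = 3 * x ^+ 2 - 2 * x ^+ 3 by ring.
have e2 : (1 - x) ^+ 2 * (1 + 2 * x) = 1 - (3 * x ^+ 2 - 2 * x ^+ 3) by ring.
lra.
Qed.

Lemma smoothstep_in s : 0 < s < 1 -> 0 < smoothstep s < 1.
Proof.
move=> /andP[s0 s1]; rewrite /smoothstep /clamp !leNgt s0 s1 /=.
have u0 : 0 < 3 - 2 * s by lra.
have v0 : 0 < 1 + 2 * s by lra.
have t0 : 0 < 1 - s by lra.
have h1 := mulr_gt0 (exprn_gt0 2 s0) u0; have h2 := mulr_gt0 (exprn_gt0 2 t0) v0.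
have e1 : s ^+ 2 * (3 - 2 * s) = 3 * s ^+ 2 - 2 * s ^+ 3 by ring.
have e2 : (1 - s) ^+ 2 * (1 + 2 * s) = 1 - (3 * s ^+ 2 - 2 * s ^+ 3) by ring.
lra.
Qed.

Lemma dsmoothstep02 s : 0 <= dsmoothstep s <= 2.
Proof.
have /andP[x0 x1] := clamp01 s; rewrite /dsmoothstep; set x := clamp s in x0 x1 *.
have h1 : 0 <= x * (1 - x) by rewrite mulr_ge0 // subr_ge0.
have h2 := sqr_ge0 (2 * x - 1).
have e1 : (2 * x - 1) ^+ 2 = 1 - 4 * (x * (1 - x)) by ring.
rewrite -mulrA; lra.
Qed.

Lemma dsmoothstep_cont S s : cont_in S (dsmoothstep : R -> R^o) s.
Proof.
move=> e e0; exists (e / 6); first by rewrite divr_gt0.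
move=> r _ rs; apply: (@le_trans _ _ (6 * `|r - s|)); last by rewrite mulrC -ler_pdivlMr // ltW.
rewrite /dsmoothstep (_ : _ - _ = 6 * ((clamp r - clamp s) * (1 - clamp r - clamp s))); last by ring.
rewrite !normrM (ger0_norm (ler0n _ 6)) ler_wpM2l // -[leRHS]mulr1 ler_pM ?clamp_lip //.
by rewrite ler_norml; have := clamp01 r; have := clamp01 s; lra.
Qed.

(** If s is in ]0, 1[ and r is outside, then r - clamp r and the distance from s to the
    end of [0, 1] on the side of r are both at most |r - s|. *)
Lemma clamp_quad r s : `|(clamp r - r) * (clamp s * (1 - clamp s))| <= (r - s) ^+ 2.
Proof.
rewrite /clamp; have [s0|s0] := leP s 0; first by rewrite mul0r mulr0 normr0 sqr_ge0.
have [s1|s1] := leP 1 s; first by rewrite subrr !mulr0 normr0 sqr_ge0.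
rewrite ler_norml; have [r0|r0] := leP r 0; last have [r1|r1] := leP 1 r.
- have h : (r - s) ^+ 2 = r ^+ 2 - 2 * r * s + s ^+ 2 by ring.
  have h1 := sqr_ge0 r; have h2 := sqr_ge0 s.
  have h3 : 0 <= (- r) * s by rewrite mulr_ge0 ?oppr_ge0 // ltW.
  have h4 : 0 <= (- r) * s * s by rewrite mulr_ge0 // ltW.
  have h5 : 0 <= (- r) * s * (1 - s) by rewrite mulr_ge0 // subr_ge0 ltW.
  lra.
- have p1 : 0 <= r - 1 by lra.
  have p2 : 0 <= 1 - s by lra.
  have h : (r - s) ^+ 2 = (r - 1) ^+ 2 + 2 * ((r - 1) * (1 - s)) + (1 - s) ^+ 2 by ring.
  have h1 := sqr_ge0 (r - 1); have h2 := sqr_ge0 (1 - s); have h3 := mulr_ge0 p1 p2.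
  have h4 := mulr_ge0 h3 (ltW s0); have h5 := mulr_ge0 h3 p2.
  have e1 : (1 - r) * (s * (1 - s)) = - ((r - 1) * (1 - s) * s) by ring.
  have e2 : (r - 1) * (1 - s) = (r - 1) * (1 - s) * s + (r - 1) * (1 - s) * (1 - s) by ring.
  lra.
- by rewrite subrr mul0r oppr_le0 sqr_ge0.
Qed.

(** With p(x) = 3 x^2 - 2 x^3 one has p(y) - p(x) = p'(x) (y - x) + (y - x)^2 (3 - 2 y -
    4 x); for x = clamp s and y = clamp r, replacing y - x by r - s in the first term
    costs an error of the second order, by [clamp_quad]. *)
Lemma smoothstep_der S s : der_in S (smoothstep : R -> R^o) s (dsmoothstep s).
Proof.
have H r : `|smoothstep r - smoothstep s - (r - s) * dsmoothstep s| <= 9 * `|r - s| ^+ 2.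
  have h1 := clamp_quad r s.
  have h2 : `|(clamp r - clamp s) ^+ 2 * (3 - 2 * clamp r - 4 * clamp s)| <= (r - s) ^+ 2 * 3.
    rewrite normrM ler_pM // ?normrX -?[(r - s) ^+ 2]real_normK ?num_real //.
      by rewrite ler_pXn2r ?nnegrE ?clamp_lip.
    by rewrite ler_norml; have := clamp01 r; have := clamp01 s; lra.
  rewrite real_normK ?num_real //.
  rewrite (_ : _ - _ = (clamp r - clamp s) ^+ 2 * (3 - 2 * clamp r - 4 * clamp s)
    + 6 * ((clamp r - r) * (clamp s * (1 - clamp s)) + (s - clamp s) * (clamp s * (1 - clamp s)))).
    have -> : (s - clamp s) * (clamp s * (1 - clamp s)) = 0.
      by rewrite /clamp; case: leP => _; [|case: leP => _]; ring.
    rewrite addr0 (le_trans (ler_normD _ _)) // [`|6 * _|]normrM (ger0_norm (ler0n _ 6)); lra.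
  rewrite /smoothstep /dsmoothstep; ring.
move=> e e0; exists (e / 9); first by rewrite divr_gt0.
move=> r _ rs; apply: (le_trans (H _)).
by rewrite expr2 mulrA ler_wpM2r // mulrC -ler_pdivlMr // ltW.
Qed.

End SmoothStep.

(** * The flow of a bounded linear map *)

Section FlowSums.
Context {R : realType}.

Definition bounded_linear (V : normedModType R) (A : V -> V) (M : R) : Prop :=
  [/\ 0 <= M, forall a x y, A (a *: x + y) = a *: A x + A y & forall x, `|A x| <= M * `|x|].

Definition flow_sum (V : normedModType R) (A : V -> V) (t : R) (w : V) (N : nat) : V :=
  \sum_(n < N) (t ^+ n / n`!%:R) *: iter n A w.

(** The remainder of (x + h)^(n+1) after the first-order term in h. *)
Definition binrem (n : nat) (x h : R) : R :=
  (x + h) ^+ n.+1 - x ^+ n.+1 - n.+1%:R * h * x ^+ n.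

Lemma binremS n x h : binrem n.+1 x h = (x + h) * binrem n x h + n.+1%:R * h ^+ 2 * x ^+ n.
Proof. rewrite /binrem -![in LHS]natr1 -[in RHS]natr1 !exprS expr0; ring. Qed.

(** This remainder is a polynomial in x and h with nonnegative coefficients. Hence the
    increments of the operator exponential are dominated, term by term, by those of the
    real one. *)
Lemma binrem_le n x h : `|binrem n x h| <= binrem n `|x| `|h|.
Proof.
elim: n => [|n IH]; first by rewrite /binrem !expr1 expr0 (_ : _ - _ = 0) ?normr0; [rewrite (_ : _ - _ = 0) //; ring|ring].
rewrite !binremS (le_trans (ler_normD _ _)) // lerD //.
  rewrite normrM ler_pM // ler_normD //.
by rewrite !normrM !normrX normr_nat.
Qed.

Section Identity.
Context {V : normedModType R} (A : V -> V).
Lemma flow_sum_increment t h w N :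
  flow_sum A (t + h) w N.+1 - flow_sum A t w N.+1 - h *: flow_sum A t (A w) N =
  \sum_(n < N) (binrem n t h / n.+1`!%:R) *: iter n.+1 A w.
Proof.
rewrite /flow_sum !big_ord_recl /= !expr0 opprD addrACA subrr add0r.
rewrite scaler_sumr -!sumrB; apply: eq_bigr => i _; rewrite -iterSr /bump /= add1n.
rewrite scalerA -!scalerBl; congr (_ *: _).
rewrite /binrem factS natrM invfM.
have f0 : (i`!%:R : R) != 0 by rewrite pnatr_eq0 -lt0n fact_gt0.
have i0 : (i.+1%:R : R) != 0 by rewrite pnatr_eq0.
by rewrite /GRing.scale /=; field; rewrite f0 ?i0 ?nat1r.
Qed.
End Identity.

Context {V : normedModType R} (A : V -> V) (M : R) (AM : bounded_linear A M).

Lemma iter_norm n w : `|iter n A w| <= M ^+ n * `|w|.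
Proof.
case: AM => M0 _ AMM; elim: n => [|n IH]; first by rewrite expr0 mul1r.
by rewrite iterS (le_trans (AMM _)) // exprS -mulrA ler_wpM2l.
Qed.

Lemma iterZD n a x y : iter n A (a *: x + y) = a *: iter n A x + iter n A y.
Proof. by case: AM => _ Al _; elim: n => //= n ->; rewrite Al. Qed.

Lemma flow_term_norm n t w :
  `|(t ^+ n / n`!%:R) *: iter n A w| <= ((`|t| * M) ^+ n / n`!%:R) * `|w|.
Proof.
rewrite normrZ normrM normfV normr_nat normrX exprMn.
rewrite [leRHS](_ : _ = (`|t| ^+ n / n`!%:R) * (M ^+ n * `|w|)); last by ring.
by rewrite ler_wpM2l ?iter_norm // divr_ge0 // exprn_ge0.
Qed.

Lemma flow_sum_norm t w N : `|flow_sum A t w N| <= expR (`|t| * M) * `|w|.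
Proof.
have M0 : 0 <= M by case: AM.
rewrite (le_trans (ler_norm_sum _ _ _)) //.
apply: (@le_trans _ _ (\sum_(n < N) ((`|t| * M) ^+ n / n`!%:R) * `|w|)).
  by apply: ler_sum => n _; exact: flow_term_norm.
rewrite -mulr_suml ler_wpM2r //.
have -> : \sum_(n < N) ((`|t| * M) ^+ n / n`!%:R) = series (exp_coeff (`|t| * M)) N.
  by rewrite /series /= big_mkord.
apply: nondecreasing_cvgn_le; last exact: is_cvg_series_exp_coeff.
apply: nondecreasing_series => n _ _; exact: exp_coeff_ge0 (mulr_ge0 _ _).
Qed.

Lemma flow_sumZD a x y t N :
  flow_sum A t (a *: x + y) N = a *: flow_sum A t x N + flow_sum A t y N.
Proof.
rewrite /flow_sum scaler_sumr -big_split; apply: eq_bigr => n _ /=.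
by rewrite iterZD; lmod R.
Qed.

Lemma flow_sum_A t w N : A (flow_sum A t w N) = flow_sum A t (A w) N.
Proof.
case: AM => _ Al _.
have A0 : A 0 = 0 by have := Al (-1) 0 0; rewrite scaler0 addr0 scaleN1r addNr.
rewrite /flow_sum; elim: N => [|N IH]; first by rewrite !big_ord0.
by rewrite !big_ord_recr /= addrC Al IH addrC -iterS iterSr.
Qed.

Lemma flow_sum_increment_norm t h w N :
  `|flow_sum A (t + h) w N.+1 - flow_sum A t w N.+1 - h *: flow_sum A t (A w) N| <=
  (flow_sum (fun x : R^o => M * x) (`|t| + `|h|) (1 : R^o) N.+1
   - flow_sum (fun x : R^o => M * x) `|t| (1 : R^o) N.+1
   - `|h| * flow_sum (fun x : R^o => M * x) `|t| (M * 1 : R^o) N) * `|w|.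
Proof.
rewrite flow_sum_increment.
have := flow_sum_increment (V := R^o) (fun x : R^o => M * x) `|t| `|h| 1 N.
rewrite {3}/GRing.scale /= => ->.
rewrite (le_trans (ler_norm_sum _ _ _)) // mulr_suml; apply: ler_sum => n _.
rewrite normrZ normrM normfV normr_nat.
have -> : M * iter n (fun x : R^o => M * x) 1 = M ^+ n.+1.
  by elim: (n : nat) => [|m IH]; rewrite ?mulr1 ?expr1 //= IH -exprS.
rewrite /GRing.scale /= -[leRHS]mulrA ler_pM ?iter_norm // ?mulr_ge0 ?invr_ge0 //.
  by rewrite ler_wpM2r ?invr_ge0 // binrem_le.
by rewrite -iterS iter_norm.
Qed.

End FlowSums.

Section Flow.
Context {R : realType} {V : completeNormedModType R} (A : V -> V) (M : R).
Hypothesis AM : bounded_linear A M.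

Lemma flow_ex t w : exists l, seq_lim (flow_sum A t w) l.
Proof.
apply: (seq_lim_summable (v := fun n => ((`|t| * M) ^+ n / n`!%:R) * `|w|)).
  by move=> n; rewrite /flow_sum big_ord_recr /= [X in `|X|]addrC addKr; exact: flow_term_norm.
have -> : (fun n => ((`|t| * M) ^+ n / n`!%:R) * `|w|) = `|w| *: exp_coeff (`|t| * M).
  by apply/funext => n; rewrite /= mulrC.
by apply: is_cvg_seriesZ; exact: is_cvg_series_exp_coeff.
Qed.

End Flow.

Definition flow {R : realType} {V : normedModType R} (A : V -> V) (t : R) (w : V) : V :=
  lim (flow_sum A t w n @[n --> \oo]).

Section FlowTheory.
Context {R : realType} {V : completeNormedModType R} (A : V -> V) (M : R).
Hypothesis AM : bounded_linear A M.

Lemma flow_lim t w : seq_lim (flow_sum A t w) (flow A t w).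
Proof.
have [l /seq_limP ll] := flow_ex AM t w.
by apply/seq_limP; apply/cvg_ex; exists l.
Qed.

Lemma flow_norm t w : `|flow A t w| <= expR (`|t| * M) * `|w|.
Proof. by apply: seq_lim_le (flow_lim t w) _ => n; exact: flow_sum_norm. Qed.

Lemma flowZD t a x y : flow A t (a *: x + y) = a *: flow A t x + flow A t y.
Proof.
apply: (seq_lim_unique (flow_lim t _)).
have := seq_limD (seq_lim_lip (f := fun x => a *: x) (M := `|a|) _ (flow_lim t x)) (flow_lim t y).
have h : forall x y : V, `|a *: x - a *: y| <= `|a| * `|x - y|.
  by move=> u v; rewrite -scalerBr normrZ.
move=> /(_ h) K e /K[N HN]; exists N => n /HN.
by rewrite -(flow_sumZD AM).
Qed.

Lemma flowB t x y : flow A t (x - y) = flow A t x - flow A t y.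
Proof. by have := flowZD t (-1) y x; rewrite !scaleN1r ![- _ + _]addrC. Qed.

Lemma flow_comm t w : flow A t (A w) = A (flow A t w).
Proof.
apply: (seq_lim_unique (flow_lim t _)).
have [M0 Al Ab] := AM.
have h : forall x y, `|A x - A y| <= M * `|x - y|.
  move=> x y; have -> : A x - A y = A (x - y).
    by have := Al (-1) y x; rewrite !scaleN1r ![- _ + _]addrC => ->.
  exact: Ab.
move=> e /(seq_lim_lip h (flow_lim t w))[N HN]; exists N => n /HN.
by rewrite (flow_sum_A AM).
Qed.

Lemma flow0 w : flow A 0 w = w.
Proof.
apply: (seq_lim_unique (flow_lim 0 w)) => e e0; exists 1%N => -[//|n] _.
rewrite /flow_sum big_ord_recl /= expr0 fact0 divr1 scale1r big1.
  by rewrite addr0 subrr normr0 ltW.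
by move=> i _; rewrite /bump /= add1n exprS !mul0r scale0r.
Qed.

Lemma flow_sum_real t (c : R) N :
  flow_sum (fun x : R^o => M * x) t (c : R^o) N = c * series (exp_coeff (t * M)) N.
Proof.
rewrite /flow_sum /series /= big_mkord mulr_sumr; apply: eq_bigr => n _.
have -> : iter n (fun x : R^o => M * x) c = M ^+ n * c.
  by elim: (n : nat) => [|m IH]; rewrite ?mul1r //= IH exprS mulrA.
rewrite /GRing.scale /= /exp_coeff /= exprMn; ring.
Qed.

(** Domination by the real exponential t |-> exp(t M) reduces the differentiability of
    the flow to that of exp, with a locally uniform remainder. *)
Lemma flow_increment_norm t h w :
  `|flow A (t + h) w - flow A t w - h *: flow A t (A w)| <=
  (expR ((`|t| + `|h|) * M) - expR (`|t| * M) - `|h| * (M * expR (`|t| * M))) * `|w|.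
Proof.
have sE x : seq_lim (series (exp_coeff x) : nat -> R^o) (expR x).
  by apply/seq_limP; exact: is_cvg_series_exp_coeff.
have fl := seq_limB (seq_limB (seq_limS (flow_lim (t + h) w)) (seq_limS (flow_lim t w))) (seq_limZ h (flow_lim t (A w))).
have gl := seq_limZ `|w| (seq_limB (seq_limB (seq_limS (sE ((`|t| + `|h|) * M))) (seq_limS (sE (`|t| * M))))
  (seq_limZ (`|h| * M) (sE (`|t| * M)))).
have := seq_lim_le2 fl gl; rewrite {2}/GRing.scale /= => K.
rewrite mulrC mulrA; apply: K => N.
have := flow_sum_increment_norm AM t h w N.
by rewrite !flow_sum_real !mul1r mulr1 mulrC /GRing.scale /= !mulrA.
Qed.

Lemma expR_upper (u : R) : 0 <= u -> u <= 2^-1 -> expR u <= 1 + u + 2 * (u * u).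
Proof.
move=> u0 u1; have := expR_ge1Dx (- u); have := expRxMexpNx_1 u; have := expR_gt0 u => e0 e1 e2.
have h : expR u * (1 - u) <= 1 by rewrite -[leRHS]e1 ler_wpM2l // ltW.
have u3 : 0 < 1 - u by lra.
rewrite -(ler_pM2r u3) (le_trans h) //.
have u4 : 0 <= 1 - 2 * u by lra.
have u5 := mulr_ge0 (mulr_ge0 u0 u0) u4.
have -> : (1 + u + 2 * (u * u)) * (1 - u) = 1 + u * u * (1 - 2 * u) by ring.
lra.
Qed.

Lemma der_in_flow S t w : der_in S (fun r => flow A r w) t (flow A t (A w)).
Proof.
have M0 : 0 <= M by case: AM.
have M1 : 0 < M + 1 by rewrite ltr_wpDl.
pose E := expR (`|t| * M) * (2 * (M * M)) * `|w|.
have E0 : 0 <= E by rewrite !mulr_ge0 // ltW // expR_gt0.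
have E1 : 0 < E + 1 by rewrite ltr_wpDl.
move=> e e0; exists (Num.min (2^-1 / (M + 1)) (e / (E + 1))); first by rewrite lt_min !divr_gt0.
move=> r _; rewrite lt_min => /andP[r1 r2].
have := flow_increment_norm t (r - t) w; rewrite [t + (r - t)]addrC subrK => /le_trans; apply.
set h := `|r - t| in r1 r2 *.
have h0 : 0 <= h by exact: normr_ge0.
have hM : h * M <= 2^-1.
  apply: (@le_trans _ _ (h * (M + 1))); first by rewrite ler_wpM2l // lerDl.
  by rewrite -ler_pdivlMr // ltW.
have -> : (`|t| + h) * M = `|t| * M + h * M by ring.
rewrite expRD; have K := expR_upper (mulr_ge0 h0 M0) hM.
have -> : expR (`|t| * M) * expR (h * M) - expR (`|t| * M) - h * (M * expR (`|t| * M)) =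
  expR (`|t| * M) * (expR (h * M) - 1 - h * M) by ring.
apply: (@le_trans _ _ (E * h * h)).
  have -> : E * h * h = expR (`|t| * M) * (2 * (h * M * (h * M))) * `|w| by rewrite /E; ring.
  by rewrite ler_wpM2r // ler_wpM2l ?expR_ge0 //; lra.
rewrite ler_wpM2r //; apply: (@le_trans _ _ ((E + 1) * h)); first by rewrite ler_wpM2r // lerDl.
by rewrite mulrC -ler_pdivlMr // ltW.
Qed.

Lemma flow_split t t' x y : flow A t' y - flow A t x =
  flow A t' (y - x) + (flow A t' x - flow A t x).
Proof. rewrite flowB; lmod R. Qed.

Lemma flow_norm_near S (p : R -> R) s : cont_in S (p : R -> R^o) s ->
  exists2 d : R, 0 < d & forall r v, S r -> `|r - s| < d ->
    `|flow A (p r) v| <= expR ((`|p s| + 1) * M) * `|v|.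
Proof.
move=> /cont_in_bnd[d d0 H]; exists d => // r v Sr rs.
apply: (le_trans (flow_norm _ _)); rewrite ler_wpM2r // ler_expR ler_wpM2r ?H //.
by case: AM.
Qed.

Lemma cont_in_flow S (p : R -> R) (f : R -> V) s : cont_in S (p : R -> R^o) s -> cont_in S f s ->
  cont_in S (fun r => flow A (p r) (f r)) s.
Proof.
move=> cp cf e e0; have [d1 d10 H1] := flow_norm_near cp.
set E := expR _ in H1; have E0 : 0 < E by exact: expR_gt0.
have [d2 d20 H2] := cf (e / 2 / E) (ltac:(by rewrite !divr_gt0)).
have cfl : cont_in S (fun r => flow A (p r) (f s)) s.
  exact: (cont_in_comp (S := setT) (f := fun r => flow A r (f s)) _ cp (der_in_cont (der_in_flow _ _ _))).
have [d3 d30 H3] := cfl (e / 2) (ltac:(by rewrite divr_gt0)).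
exists (Num.min d1 (Num.min d2 d3)); first by rewrite !lt_min d10 d20.
move=> r Sr; rewrite !lt_min => /and3P[r1 r2 r3].
rewrite flow_split (le_trans (ler_normD _ _)) //.
have h1 := H1 _ (f r - f s) Sr r1; have h3 := H3 _ Sr r3.
have h2 : E * `|f r - f s| <= e / 2 by rewrite mulrC -ler_pdivlMr // H2.
lra.
Qed.

Lemma der_in_flow_comp S (p : R -> R) (f : R -> V) s dp df :
  der_in S (p : R -> R^o) s dp -> der_in S f s df ->
  der_in S (fun r => flow A (p r) (f r)) s (dp *: flow A (p s) (A (f s)) + flow A (p s) df).
Proof.
move=> vp vf e e0; have [d1 d10 H1] := flow_norm_near (der_in_cont vp).
set E := expR _ in H1; have E0 : 0 < E by exact: expR_gt0.
have [d2 d20 H2] := vf (e / 3 / E) (ltac:(by rewrite !divr_gt0)).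
have cfl : cont_in S (fun r => flow A (p r) df) s by apply: cont_in_flow (der_in_cont vp) _; exact: cont_in_cst.
have [d3 d30 H3] := cfl (e / 3) (ltac:(by rewrite divr_gt0)).
have vfl := der_in_comp (S := setT) (f := fun r => flow A r (f s)) (fun _ _ => I) vp (der_in_flow _ _ _).
have [d4 d40 H4] := vfl (e / 3) (ltac:(by rewrite divr_gt0)).
exists (Num.min (Num.min d1 d2) (Num.min d3 d4)); first by rewrite !lt_min d10 d20 d30.
move=> r Sr; rewrite !lt_min => /andP[/andP[r1 r2] /andP[r3 r4]].
have -> : flow A (p r) (f r) - flow A (p s) (f s) - (r - s) *: (dp *: flow A (p s) (A (f s)) + flow A (p s) df) =
  flow A (p r) (f r - f s - (r - s) *: df) + (r - s) *: (flow A (p r) df - flow A (p s) df)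
  + (flow A (p r) (f s) - flow A (p s) (f s) - (r - s) *: (dp *: flow A (p s) (A (f s)))).
  have -> : f r - f s - (r - s) *: df = (- (r - s)) *: df + (f r - f s) by lmod R.
  by rewrite flowZD flowB; lmod R.
rewrite (le_trans (ler_normD _ _)) //.
have h1 := H1 _ (f r - f s - (r - s) *: df) Sr r1.
have h2 : E * `|f r - f s - (r - s) *: df| <= e / 3 * `|r - s|.
  rewrite [leRHS](_ : _ = E * (e / 3 / E * `|r - s|)); last by field; rewrite lt0r_neq0.
  by rewrite ler_wpM2l ?H2 // ltW.
have h3 : `|(r - s) *: (flow A (p r) df - flow A (p s) df)| <= e / 3 * `|r - s|.
  by rewrite normrZ mulrC ler_wpM2r // H3.
have h4 := H4 _ Sr r4.
have := ler_normD (flow A (p r) (f r - f s - (r - s) *: df)) ((r - s) *: (flow A (p r) df - flow A (p s) df)).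
lra.
Qed.

(** The derivative of s |-> flow A (t - s) (f s) vanishes. *)
Lemma flow_unique (f : R -> V) t : 0 <= t ->
  (forall s, 0 <= s <= t -> der_in `[0, t]%classic f s (A (f s))) -> f t = flow A t (f 0).
Proof.
move=> t0 df.
pose F s := flow A (t - s) (f s).
have -> : f t = F t by rewrite /F subrr flow0.
have -> : flow A t (f 0) = F 0 by rewrite /F subr0.
apply: (der0_const (df := fun=> 0)) => // s st.
have := der_in_flow_comp (der_in_sub_cst _ t s) (df s st).
by rewrite scaleN1r addNr.
Qed.

End FlowTheory.

(** * Exponentials and conjugation *)

Section Exponential.
Context {R : realType} {H : completeNormedModType R[i]}.
Local Notation B := (bop H).
Implicit Types (y z : B).

(** The exponential exp(t y). *)
Definition bop_exp y (t : R) : B := flow (fun x => y * x) t 1.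

Lemma lmul_bounded y : bounded_linear (fun x => y * x) `|y|.
Proof.
split=> //; last by move=> x; exact: bop_normM.
by move=> a u v; rewrite bmulDr -bop_scalerAr.
Qed.

Lemma bop_exp0 y : bop_exp y 0 = 1. Proof. exact: flow0 (lmul_bounded y) _. Qed.

(** Right multiplication by y commutes with left multiplications, hence with every term
    of the series. *)
Lemma bop_expC y t : bop_exp y t * y = y * bop_exp y t.
Proof.
rewrite -[RHS](flow_comm (lmul_bounded y)) bmul1r.
have L := flow_lim (lmul_bounded y) t.
have K : forall u v : B, `|u * y - v * y| <= `|y| * `|u - v|.
  by move=> u v; rewrite -bmulBl mulrC bop_normM.
have S1 := seq_lim_lip K (L 1).
apply: (seq_lim_unique S1); move=> e /(L y)[N HN]; exists N => n /HN.
suff -> : flow_sum (fun x => y * x) t 1 n * y = flow_sum (fun x => y * x) t y n by [].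
rewrite /flow_sum mulr_suml; apply: eq_bigr => i _.
rewrite -bop_scalerAl; congr (_ *: _).
by elim: (i : nat) => [|m IH] /=; rewrite ?bmul1l // -IH bmulA.
Qed.

Lemma der_in_bop_exp S y t : der_in S (bop_exp y) t (bop_exp y t * y).
Proof. by have := der_in_flow (lmul_bounded y) S t 1; rewrite bmul1r bop_expC -(flow_comm (lmul_bounded y)) bmul1r. Qed.

Lemma der_in_bop_exp_comp S y (p : R -> R) s dp : der_in S (p : R -> R^o) s dp ->
  der_in S (fun r => bop_exp y (p r)) s (bop_exp y (p s) * (dp *: y)).
Proof.
move=> vp; rewrite -bop_scalerAr.
exact: (der_in_comp (S := setT) (fun _ _ => I) vp (der_in_bop_exp _ _ _)).
Qed.

Lemma bop_expVr y t : bop_exp y t * bop_exp y (- t) = 1.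
Proof.
pose F t := bop_exp y t * bop_exp y (- t).
have dF S s : der_in S F s 0.
  have := der_inM (der_in_bop_exp S y s) (der_in_bop_exp_comp y (der_in_opp S s)).
  by rewrite scaleN1r !bmulNr [bop_exp y (- s) * y]bop_expC bmulA addrN.
have -> : 1 = F 0 by rewrite /F oppr0 bop_exp0 bmul1l.
rewrite -/(F t); have [t0|t0] := leP 0 t.
  by apply: (der0_const (df := fun=> 0)).
by apply/esym; apply: (der0_const (df := fun=> 0)) => //; exact: ltW.
Qed.

Lemma bop_expVl y t : bop_exp y (- t) * bop_exp y t = 1.
Proof. by have := bop_expVr y (- t); rewrite opprK. Qed.

(** The derivative of u |-> exp((s + u) y) exp(- u y) vanishes. *)
Lemma bop_expD (y : B) s t : bop_exp y (s + t) = bop_exp y s * bop_exp y t.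
Proof.
pose F u := bop_exp y (s + u) * bop_exp y (- u).
have dF S u : der_in S F u 0.
  have v : der_in S ((fun r => s + r) : R -> R^o) u 1.
    by apply: der_in_affine => ?; rewrite /GRing.scale /=; ring.
  have := der_inM (der_in_bop_exp_comp y v) (der_in_bop_exp_comp y (der_in_opp S u)).
  by rewrite scale1r scaleN1r !bmulNr [bop_exp y (- u) * y]bop_expC bmulA addrN.
have FE : F t = F 0.
  have [t0|t0] := leP 0 t; first by apply: (der0_const (df := fun=> 0)).
  by apply/esym; apply: (der0_const (df := fun=> 0)) => //; exact: ltW.
have : F t * bop_exp y t = bop_exp y (s + t) by rewrite /F -bmulA bop_expVl bmul1r.
by rewrite FE /F addr0 oppr0 bop_exp0 bmul1r => <-.
Qed.

Lemma ad_bounded y : bounded_linear (fun z => bracket z y) (2 * `|y|).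
Proof.
split; first by rewrite mulr_ge0.
  move=> a u v; rewrite /bracket bmulDl bmulDr -bop_scalerAl -bop_scalerAr; lmod R.
move=> z; rewrite /bracket (le_trans (ler_normB _ _)) //.
have := bop_normM z y; have := bop_normM y z; rewrite [`|z| * _]mulrC; lra.
Qed.

(** Both sides solve f' = [f, y] with f(0) = z. Since this flow also makes sense in
    g_inf, conjugation by an exponential will act on g_inf. *)
Lemma conj_bop_exp y z t : 0 <= t ->
  bop_exp y (- t) * z * bop_exp y t = flow (fun z => bracket z y) t z.
Proof.
move=> t0; pose f s := bop_exp y (- s) * z * bop_exp y s.
have f0 : f 0 = z by rewrite /f oppr0 bop_exp0 bmul1l bmul1r.
rewrite -/(f t) -[X in flow _ _ X]f0; apply: (flow_unique (ad_bounded y)) => // s _.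
have := der_inM (der_inM (der_in_bop_exp_comp y (der_in_opp `[0, t]%classic s)) (der_in_cst _ z s)) (der_in_bop_exp _ y s).
rewrite scaleN1r !bmulNr !bmulNl bop_expC bmul0r addr0 /bracket /f.
by rewrite !bmulA addrC.
Qed.

End Exponential.

(** * Flat paths *)

Section Reach.
Context {R : realType} {H : completeNormedModType R[i]} {L : completeNormedModType R}.
Local Notation B := (bop H).

Definition linear_rel (Rel : L -> B -> Prop) : Prop :=
  Rel 0 0 /\ forall a w w' z z', Rel w z -> Rel w' z' -> Rel (a *: w + w') (a *: z + z').

(** A path k in GL(H) with inverse kb, from 1 to q, whose logarithmic derivative z is
    related by [Rel] to a path w in L. It is defined on the whole line, and at rest
    before 0 and after 1, so that paths can be rescaled, reversed and multiplied
    pointwise. The speed |w| is bounded by a; the bound b on the operator norm of z is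
    imposed only when the flag o is set. *)
Record flat_path (Rel : L -> B -> Prop) (o : bool) (a b : R) (q : B)
    (k kb : R -> B) (w : R -> L) (z : R -> B) : Prop := FlatPath {
  fp_inv : forall s, k s * kb s = 1 /\ kb s * k s = 1;
  fp_d : forall s, der_in setT k s (k s * z s);
  fp_cw : forall s, cont_in setT w s;
  fp_cz : forall s, cont_in setT z s;
  fp_rel : forall s, Rel (w s) (z s);
  fp_w : forall s, `|w s| <= a;
  fp_z : o -> forall s, `|z s| <= b;
  fp_l : forall s, s <= 0 -> [/\ k s = 1, w s = 0 & z s = 0];
  fp_r : forall s, 1 <= s -> [/\ k s = q, w s = 0 & z s = 0] }.

Definition reach Rel o a b q := exists k kb w z, flat_path Rel o a b q k kb w z.

Lemma reach_le Rel (o o' : bool) a a' b b' q : a <= a' -> (o' -> o /\ b <= b') ->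
  reach Rel o a b q -> reach Rel o' a' b' q.
Proof.
move=> aa ob [k [kb [w [z [f1 f2 f3 f4 f5 f6 f7 f8 f9]]]]]; exists k, kb, w, z; split => //.
  by move=> s; exact: le_trans aa.
by move=> /ob[oo bb] s; apply: le_trans bb; exact: f7.
Qed.

Lemma reach_forget Rel o a b q : reach Rel o a b q -> reach Rel false a 0 q.
Proof. exact: reach_le. Qed.

Lemma reach_bounded Rel o a b q : reach Rel o a b q -> exists2 b', 0 <= b' & reach Rel true a b' q.
Proof.
move=> [k [kb [w [z [f1 f2 f3 f4 f5 f6 f7 f8 f9]]]]].
have [M HM] := cont_in_bounded ler01 (fun s _ => cont_in_sub (S := `[0, 1]%classic) (fun _ _ => I) (f4 s)).
have M0 : 0 <= M by apply: le_trans (HM 0 _); rewrite ?lexx ?ler01.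
exists M => //; exists k, kb, w, z; split => // _ s.
have [s0|s0] := lerP s 0; first by have [_ _ ->] := f8 _ s0; rewrite normr0.
have [s1|s1] := lerP 1 s; first by have [_ _ ->] := f9 _ s1; rewrite normr0.
by apply: HM; rewrite !ltW.
Qed.

Lemma reach_ge0 Rel o a b q : reach Rel o a b q -> 0 <= a /\ (o -> 0 <= b).
Proof.
move=> [k [kb [w [z [f1 f2 f3 f4 f5 f6 f7 f8 f9]]]]]; split; first exact: le_trans (f6 0).
by move=> /f7 h; exact: le_trans (h 0).
Qed.

(** The piece of path on [s, t] is translated to start at 1 and run along [smoothstep];
    the factor 2 bounds the derivative of the latter. The logarithmic derivative z is
    only required to agree with a continuous z1 in the open interval, because
    [dsmoothstep] vanishes at the two ends. *)
Lemma reach_reparam Rel (o : bool) a b (s t : R) (k kb : R -> B) (w1 : R -> L) (z z1 : R -> B) :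
  linear_rel Rel -> s < t ->
  (forall r, s <= r <= t -> k r * kb r = 1 /\ kb r * k r = 1) ->
  (forall r, s <= r <= t -> der_in `[s, t]%classic k r (k r * z r)) ->
  (forall r, s <= r <= t -> cont_in `[s, t]%classic w1 r) ->
  (forall r, s <= r <= t -> cont_in `[s, t]%classic z1 r) ->
  (forall r, s < r < t -> [/\ z r = z1 r, Rel (w1 r) (z1 r), `|w1 r| <= a & o -> `|z1 r| <= b]) ->
  reach Rel o (2 * (t - s) * a) (2 * (t - s) * b) (kb s * k t).
Proof.
move=> [rel0 relD] st kkb dk cw cz rel.
pose p (r : R) := (t - s) * smoothstep r + s.
pose dp (r : R) := (t - s) * dsmoothstep r.
have ts0 : 0 < t - s by rewrite subr_gt0.
have pst r : s <= p r <= t.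
  have /andP[h1 h2] := smoothstep01 r; rewrite /p lerDr mulr_ge0 //=; last exact: ltW.
  by rewrite -lerBrDr ler_piMr // ltW.
have pin r : [set: R] r -> `[s, t]%classic (p r) by move=> _; rewrite /= in_itv /= pst.
have vp r : der_in setT (p : R -> R^o) r (dp r).
  by have := der_inD (der_inZ (t - s) (smoothstep_der setT r)) (der_in_cst setT (s : R^o) r); rewrite addr0.
have cdp r : cont_in setT (dp : R -> R^o) r.
  exact: (cont_inZ (cont_in_cst _ (t - s : R^o) r) (dsmoothstep_cont setT r)).
have mid : s < (s + t) / 2 < t by lra.
have [_ _ w0 z0] := rel _ mid.
have a0 : 0 <= a by exact: le_trans w0.
have dpin r : (dp r = 0) \/ (s < p r < t).
  have [r0|r0] := lerP r 0; first by left; rewrite /dp dsmoothstep_le0 ?mulr0.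
  have [r1|r1] := lerP 1 r; first by left; rewrite /dp dsmoothstep_ge1 ?mulr0.
  right; have /andP[h1 h2] := smoothstep_in (ltac:(by rewrite r0) : 0 < r < 1).
  rewrite /p ltrDr mulr_gt0 //=.
  by rewrite -ltrBrDr gtr_pMr.
have dp2 r : `|dp r| <= 2 * (t - s).
  rewrite normrM (gtr0_norm ts0) mulrC ler_wpM2r ?(ltW ts0) //.
  by have /andP[d1 d2] := dsmoothstep02 r; rewrite (ger0_norm d1).
have [e1 e2] := kkb s (ltac:(by rewrite lexx ltW)).
exists (fun r => kb s * k (p r)), (fun r => kb (p r) * k s),
  (fun r => dp r *: w1 (p r)), (fun r => dp r *: z1 (p r)); split.
- move=> r; have [e3 e4] := kkb _ (pst r); split.
    by rewrite bmulA -[kb s * k (p r) * _]bmulA e3 bmul1r.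
  by rewrite bmulA -[kb (p r) * k s * _]bmulA e1 bmul1r.
- move=> r; have := der_inM (der_in_cst setT (kb s) r) (der_in_comp pin (vp r) (dk _ (pst r))).
  rewrite bmul0l add0r.
  have -> : kb s * (dp r *: (k (p r) * z (p r))) = kb s * k (p r) * (dp r *: z1 (p r)).
    have [->|/rel[-> _ _ _]] := dpin r; first by rewrite !scale0r !bmul0r.
    by rewrite -bmulA -!bop_scalerAr.
  by [].
- by move=> r; apply: cont_inZ => //; exact: (cont_in_comp pin (der_in_cont (vp r)) (cw _ (pst r))).
- by move=> r; apply: cont_inZ => //; exact: (cont_in_comp pin (der_in_cont (vp r)) (cz _ (pst r))).
- move=> r; have [->|/rel[_ h _ _]] := dpin r; first by rewrite !scale0r.
  by have := relD (dp r) _ _ _ _ h rel0; rewrite !addr0.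
- move=> r; rewrite normrZ; have [->|/rel[_ _ h _]] := dpin r.
    by rewrite normr0 mul0r !mulr_ge0 // ltW.
  by rewrite ler_pM.
- move=> oo r; rewrite normrZ; have [->|/rel[_ _ _ h]] := dpin r.
    have b0 : 0 <= b by apply: le_trans (z0 oo).
    by rewrite normr0 mul0r !mulr_ge0 // ltW.
  by rewrite ler_pM // h.
- move=> r r0; rewrite /dp dsmoothstep_le0 // mulr0 !scale0r /p smoothstep_le0 // mulr0 add0r; split => //.
- by move=> r r1; rewrite /dp dsmoothstep_ge1 // mulr0 !scale0r /p smoothstep_ge1 // mulr1 subrK.
Qed.

(** The two paths are run during the fractions th and 1 - th of the time, so their
    speeds are divided by th and 1 - th. *)
Lemma reach_concat Rel (o : bool) a1 b1 a2 b2 a b q1 q2 (th : R) :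
  linear_rel Rel -> 0 < th < 1 ->
  a1 <= th * a -> a2 <= (1 - th) * a -> (o -> b1 <= th * b /\ b2 <= (1 - th) * b) ->
  reach Rel o a1 b1 q1 -> reach Rel o a2 b2 q2 -> reach Rel o a b (q1 * q2).
Proof.
move=> [rel0 relD] /andP[th0 th1] ha1 ha2 hb
  [k1 [kb1 [w1 [z1 [f1 f2 f3 f4 f5 f6 f7 f8 f9]]]]]
  [k2 [kb2 [w2 [z2 [g1 g2 g3 g4 g5 g6 g7 g8 g9]]]]].
have th1' : 0 < 1 - th by lra.
pose u := th^-1; pose v := (1 - th)^-1.
have u0 : 0 < u by rewrite invr_gt0.
have v0 : 0 < v by rewrite invr_gt0.
have ut : u * th = 1 by rewrite mulVf // lt0r_neq0.
have vt : v * (1 - th) = 1 by rewrite mulVf // lt0r_neq0.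
pose p1 r := u * (r - 0); pose p2 r := v * (r - th).
have side r : p2 r <= 0 \/ 1 <= p1 r.
  have [rt|rt] := lerP r th; [left|right].
    by rewrite /p2 pmulr_rle0 // subr_le0.
  by rewrite /p1 subr0 -ut ler_wpM2l // ltW.
exists (fun r => k1 (p1 r) * k2 (p2 r)), (fun r => kb2 (p2 r) * kb1 (p1 r)),
  (fun r => u *: w1 (p1 r) + v *: w2 (p2 r)), (fun r => u *: z1 (p1 r) + v *: z2 (p2 r)); split.
- move=> r; have [e1 e2] := f1 (p1 r); have [e3 e4] := g1 (p2 r); split.
    by rewrite bmulA -[_ * k2 _ * _]bmulA e3 bmul1r.
  by rewrite bmulA -[_ * kb1 _ * _]bmulA e2 bmul1r.
- move=> r.
  have d1 := der_in_comp (S := setT) (S' := setT) (fun _ _ => I) (der_in_aff setT u 0 r) (f2 (p1 r)).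
  have d2 := der_in_comp (S := setT) (S' := setT) (fun _ _ => I) (der_in_aff setT v th r) (g2 (p2 r)).
  have := der_inM d1 d2; rewrite -/(p1 r) -/(p2 r).
  have [h|h] := side r.
    have [-> _ ->] := g8 _ h; rewrite !bmul0r !scaler0 !bmul1r !bmul0r !addr0.
    by rewrite bop_scalerAr.
  have [_ _ ->] := f9 _ h; rewrite !bmul0r !scaler0 !bmul0l !add0r.
  by rewrite bop_scalerAr bmulA.
- by move=> r; apply: cont_inD; apply: cont_inZ; try exact: cont_in_cst;
    apply: (cont_in_comp (S := setT)) => //; exact: der_in_cont (der_in_aff _ _ _ _).
- by move=> r; apply: cont_inD; apply: cont_inZ; try exact: cont_in_cst;
    apply: (cont_in_comp (S := setT)) => //; exact: der_in_cont (der_in_aff _ _ _ _).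
- move=> r; apply: (relD) => //.
  by rewrite -[v *: w2 _]addr0 -[v *: z2 _]addr0; exact: relD.
- move=> r; have [h|h] := side r.
    have [_ -> _] := g8 _ h; rewrite scaler0 addr0 normrZ gtr0_norm //.
    by rewrite -(ler_pM2l th0) mulrA [th * u]mulrC ut mul1r (le_trans (f6 _)).
  have [_ -> _] := f9 _ h; rewrite scaler0 add0r normrZ gtr0_norm //.
  by rewrite -(ler_pM2l th1') mulrA [_ * v]mulrC vt mul1r (le_trans (g6 _)).
- move=> oo r; have [hb1 hb2] := hb oo; have [h|h] := side r.
    have [_ _ ->] := g8 _ h; rewrite scaler0 addr0 normrZ gtr0_norm //.
    by rewrite -(ler_pM2l th0) mulrA [th * u]mulrC ut mul1r (le_trans (f7 oo _)).
  have [_ _ ->] := f9 _ h; rewrite scaler0 add0r normrZ gtr0_norm //.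
  by rewrite -(ler_pM2l th1') mulrA [_ * v]mulrC vt mul1r (le_trans (g7 oo _)).
- move=> r r0.
  have [-> -> ->] : [/\ k1 (p1 r) = 1, w1 (p1 r) = 0 & z1 (p1 r) = 0].
    by apply: f8; rewrite /p1 subr0 pmulr_rle0.
  have [-> -> ->] : [/\ k2 (p2 r) = 1, w2 (p2 r) = 0 & z2 (p2 r) = 0].
    by apply: g8; rewrite /p2 pmulr_rle0 //; lra.
  by rewrite !scaler0 !addr0 bmul1l.
- move=> r r1.
  have [-> -> ->] : [/\ k1 (p1 r) = q1, w1 (p1 r) = 0 & z1 (p1 r) = 0].
    by apply: f9; rewrite /p1 subr0 -ut ler_wpM2l ?ltW // (lt_le_trans th1).
  have [-> -> ->] : [/\ k2 (p2 r) = q2, w2 (p2 r) = 0 & z2 (p2 r) = 0].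
    by apply: g9; rewrite /p2 -vt ler_wpM2l ?lerB // ltW.
  by rewrite !scaler0 !addr0.
Qed.

(** The path run backwards, from q to 1, and translated to start at 1. *)
Lemma reach_inv Rel o a b q : linear_rel Rel -> reach Rel o a b q ->
  exists qb, [/\ q * qb = 1, qb * q = 1 & reach Rel o a b qb].
Proof.
move=> [rel0 relD] [k [kb [w [z [f1 f2 f3 f4 f5 f6 f7 f8 f9]]]]].
have kE : k 1 = q by have [] := f9 1 (lexx _).
exists (kb 1); rewrite -kE; have [e1 e2] := f1 1; split => //.
pose p (r : R) := - 1 * (r - 1).
have vp r : der_in setT (p : R -> R^o) r (-1) by exact: der_in_aff.
exists (fun r => kb 1 * k (p r)), (fun r => kb (p r) * k 1),
  (fun r => - 1 *: w (p r)), (fun r => - 1 *: z (p r)); split.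
- move=> r; have [e3 e4] := f1 (p r); split.
    by rewrite bmulA -[kb 1 * k (p r) * _]bmulA e3 bmul1r.
  by rewrite bmulA -[kb (p r) * k 1 * _]bmulA e1 bmul1r.
- move=> r; have := der_inM (der_in_cst setT (kb 1) r) (der_in_comp (S := setT) (fun _ _ => I) (vp r) (f2 (p r))).
  by rewrite bmul0l add0r bop_scalerAr bmulA.
- by move=> r; apply: cont_inZ; [exact: cont_in_cst|apply: (cont_in_comp (S := setT)) => //; exact: der_in_cont (vp r)].
- by move=> r; apply: cont_inZ; [exact: cont_in_cst|apply: (cont_in_comp (S := setT)) => //; exact: der_in_cont (vp r)].
- by move=> r; have := relD (-1) _ _ _ _ (f5 (p r)) rel0; rewrite !addr0.
- by move=> r; rewrite normrZ normrN1 mul1r.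
- by move=> oo r; rewrite normrZ normrN1 mul1r f7.
- move=> r r0; have [-> -> ->] := f9 (p r) (ltac:(rewrite /p; lra)).
  by rewrite -kE e2 !scaler0.
- move=> r r0; have [-> -> ->] := f8 (p r) (ltac:(rewrite /p; lra)).
  by rewrite bmul1r !scaler0.
Qed.

Lemma reach1 (Rel : L -> B -> Prop) o a b : linear_rel Rel -> 0 <= a -> 0 <= b -> reach Rel o a b 1.
Proof.
move=> [rel0 _] a0 b0; exists (fun=> 1), (fun=> 1), (fun=> 0), (fun=> 0); split => //.
- by move=> s; rewrite bmul1l.
- by move=> s; rewrite bmul0r; exact: der_in_cst.
- by move=> s; exact: cont_in_cst.
- by move=> s; exact: cont_in_cst.
- by move=> s; rewrite normr0.
- by move=> s; rewrite normr0.
Qed.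

(** A special case of [reach_concat], time being divided in proportion to the speeds. *)
Lemma reach_add (Rel : L -> B -> Prop) a1 a2 b1 b2 q1 q2 : linear_rel Rel ->
  reach Rel false a1 b1 q1 -> reach Rel false a2 b2 q2 -> 0 < a1 -> 0 < a2 ->
  reach Rel false (a1 + a2) 0 (q1 * q2).
Proof.
move=> Rlin r1 r2 a10 a20; have a0 : 0 < a1 + a2 by rewrite addr_gt0.
have th : 0 < a1 / (a1 + a2) < 1.
  by apply/andP; split; [rewrite divr_gt0|rewrite ltr_pdivrMr // mul1r ltrDl].
apply: (reach_concat Rlin th _ _ _ r1 r2) => //.
  by rewrite divfK // lt0r_neq0.
by rewrite mulrBl divfK ?lt0r_neq0 // mul1r [a1 + a2]addrC addrK.
Qed.

Lemma reach_inverse (Rel : L -> B -> Prop) o a b q qb : linear_rel Rel -> inverse_of q qb ->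
  reach Rel o a b q -> reach Rel o a b qb.
Proof.
move=> Rlin iq /(reach_inv Rlin)[qb' [e1 e2 h]].
by rewrite (inverse_unique iq e1).
Qed.

(** The maximum m of |k| on [0, 1] satisfies m <= 1 + m b by the mean value inequality,
    and b <= 1/2. *)
Lemma gronwall_small (k z : R -> B) b : b <= 2^-1 -> k 0 = 1 ->
  (forall s, der_in setT k s (k s * z s)) -> (forall s, `|z s| <= b) ->
  forall s, 0 <= s <= 1 -> `|k s| <= 2 /\ `|k s - 1| <= 2 * b.
Proof.
move=> b2 k0 dk zb.
have b0 : 0 <= b by exact: le_trans (zb 0).
have [M HM] := cont_in_bounded ler01 (fun s _ => cont_in_sub (S := `[0, 1]%classic) (fun _ _ => I) (der_in_cont (dk s))).
pose S := [set `|k s| | s in [set s : R | 0 <= s <= 1]].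
have S0 : S !=set0 by exists `|k 0|; exists 0 => //=; rewrite lexx ler01.
have Sb : has_ubound S by exists M => _ [s /= s01 <-]; exact: HM.
set m := sup S.
have km s : 0 <= s <= 1 -> `|k s| <= m by move=> s01; apply: ub_le_sup => //; exists s.
have k1 s : 0 <= s <= 1 -> `|k s - 1| <= m * b.
  move=> /andP[s0 s1]; rewrite -k0.
  have m0 : 0 <= m by apply: le_trans (km 0 _); rewrite ?lexx ?ler01.
  apply: (le_trans (mean_value_le (M := m * b) s0 (fun r _ => der_in_sub (fun _ _ => I) (dk r)) _)).
    move=> r /andP[r0 rs]; rewrite (le_trans (bop_normM _ _)) // ler_pM // km // r0 /=.
    exact: le_trans rs s1.
  by rewrite ler_piMr ?mulr_ge0 //; lra.
have m2 : m <= 2.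
  have : m <= 1 + m * b.
    apply: ge_sup => // _ [s /= s01 <-]; rewrite -[k s](subrK 1) addrC (le_trans (ler_normD _ _)) //.
    by rewrite lerD ?bop_norm1 // k1.
  have m0 : 0 <= m by apply: le_trans (km 0 _); rewrite ?lexx ?ler01.
  have : m * b <= m * 2^-1 by rewrite ler_wpM2l.
  lra.
move=> s s01; split; first by rewrite (le_trans (km _ s01)).
by rewrite (le_trans (k1 _ s01)) // ler_wpM2r.
Qed.

Lemma reach_small Rel a b q : b <= 2^-1 -> reach Rel true a b q ->
  `|q| <= 2 /\ `|q - 1| <= 2 * b.
Proof.
move=> b2 [k [kb [w [z [f1 f2 f3 f4 f5 f6 f7 f8 f9]]]]].
have [<- _ _] := f9 1 (lexx _); have [k0 _ _] := f8 0 (lexx _).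
by apply: (gronwall_small b2 k0 f2 (f7 isT)); rewrite lexx ler01.
Qed.

End Reach.

(** * Infinite products of flat paths *)

Section InfiniteProduct.
Context {R : realType} {H : completeNormedModType R[i]} {L : completeNormedModType R}.
Local Notation B := (bop H).

Lemma half_pow_small (e : R) : 0 < e -> exists N, forall n, (N <= n)%N -> (2^-1) ^+ n <= e.
Proof.
move=> e0; have h : `|(2^-1 : R)| < 1 by rewrite ger0_norm ?invr_ge0 // invf_lt1 // ltr1n.
have /cvgrPdist_le/(_ e e0)[N _ HN] := cvg_expr h.
exists N => n Nn; have := HN n Nn; rewrite sub0r normrN ger0_norm //.
Qed.

Lemma quarter_pow n : (4^-1 : R) ^+ n = (2^-1) ^+ n * (2^-1) ^+ n.
Proof. by rewrite -exprMn; congr (_ ^+ n); field. Qed.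

Lemma pow_half n : (2 : R) ^+ n * (2^-1) ^+ n = 1.
Proof. by rewrite -exprMn mulfV // expr1n. Qed.

Context (Rel : L -> B -> Prop) (Rlin : linear_rel Rel) (c : R) (c2 : c <= 2^-1).
Context (h : nat -> B) (k kb : nat -> R -> B) (w : nat -> R -> L) (z : nat -> R -> B).
Hypothesis hP : forall n,
  flat_path Rel true (c * (4^-1) ^+ n.+1) (c * (4^-1) ^+ n.+1) (h n) (k n) (kb n) (w n) (z n).

(* The n-th path occupies the interval [t n, t (n+1)] of length 2^-(n+1), to which [p n]
   rescales the time. *)
Let t n : R := 1 - (2^-1) ^+ n.
Let p n (s : R) : R := 2 ^+ n.+1 * (s - t n).

Let t_lt n : t n < t n.+1.
Proof.
have : 0 < (2^-1 : R) ^+ n by rewrite exprn_gt0 // invr_gt0.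
rewrite /t exprS; lra.
Qed.
Let t_mono m n : (m <= n)%N -> t m <= t n.
Proof.
move=> mn; rewrite -(subnK mn); elim: (n - m)%N => [|i IH]; first by rewrite add0n.
by rewrite addSn (le_trans IH) // ltW.
Qed.
Let t_lt1 n : t n < 1.
Proof. by rewrite /t ltrBlDr ltrDl exprn_gt0 // invr_gt0. Qed.
Let t0 : t 0 = 0. Proof. by rewrite /t expr0 subrr. Qed.
Let p_le0 n s : s <= t n -> p n s <= 0.
Proof. by move=> st; rewrite /p pmulr_rle0 ?exprn_gt0 // subr_le0. Qed.
Let p_ge1 n s : t n.+1 <= s -> 1 <= p n s.
Proof.
move=> st; rewrite /p -[leLHS](pow_half n.+1) ler_wpM2l ?exprn_ge0 //.
move: st; rewrite /t exprS; have : 0 < (2^-1 : R) ^+ n by rewrite exprn_gt0 // invr_gt0.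
lra.
Qed.
Let p_d S n s : der_in S (p n : R -> R^o) s (2 ^+ n.+1). Proof. exact: der_in_aff. Qed.

Fixpoint prodK N s : B := if N is N'.+1 then prodK N' s * k N' (p N' s) else 1.
Fixpoint prodKb N s : B := if N is N'.+1 then kb N' (p N' s) * prodKb N' s else 1.
Fixpoint sumW N s : L := if N is N'.+1 then sumW N' s + 2 ^+ N'.+1 *: w N' (p N' s) else 0.
Fixpoint sumZ N s : B := if N is N'.+1 then sumZ N' s + 2 ^+ N'.+1 *: z N' (p N' s) else 0.
Fixpoint prodQ N : B := if N is N'.+1 then prodQ N' * h N' else 1.

Let late N s : t N <= s -> [/\ prodK N s = prodQ N, sumW N s = 0 & sumZ N s = 0].
Proof.
elim: N => [//|N IH] ts /=; have [-> -> ->] := IH (le_trans (ltW (t_lt N)) ts).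
have [-> -> ->] := fp_r (hP N) (p_ge1 ts).
by rewrite !scaler0 !addr0.
Qed.

Let early M N s : (M <= N)%N -> s <= t M ->
  [/\ prodK N s = prodK M s, prodKb N s = prodKb M s, sumW N s = sumW M s & sumZ N s = sumZ M s].
Proof.
move=> MN st; rewrite -(subnK MN); elim: (N - M)%N => [|i [e1 e2 e3 e4]] //=.
have [h1 h2 h3] := fp_l (hP (i + M)%N) (p_le0 (le_trans st (t_mono (leq_addl i M)))).
have kb1 : kb (i + M)%N (p (i + M)%N s) = 1.
  by have [] := fp_inv (hP (i + M)%N) (p (i + M)%N s); rewrite h1 bmul1l.
by rewrite h1 h2 h3 kb1 !scaler0 !addr0 bmul1l bmul1r e1 e2 e3 e4.
Qed.

Let c0 : 0 <= c.
Proof.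
have := le_trans (normr_ge0 _) (fp_w (hP 0) 0).
by rewrite pmulr_lge0 // exprn_gt0 // invr_gt0.
Qed.

Let step_bound n : 2 ^+ n.+1 * (c * (4^-1) ^+ n.+1) = c * (2^-1) ^+ n.+1.
Proof.
rewrite quarter_pow; have := pow_half n.+1.
set x := 2^-1 ^+ n.+1; set y := 2 ^+ n.+1 => yx.
have -> : y * (c * (x * x)) = c * x * (y * x) by ring.
by rewrite yx mulr1.
Qed.

Let side N s : s <= t N \/ t N <= s.
Proof. by have [?|/ltW ?] := lerP s (t N); [left|right]. Qed.

Let W_bound M N s : t M <= s ->
  `|sumW N s| <= c * (2^-1) ^+ M.+1 /\ `|sumZ N s| <= c * (2^-1) ^+ M.+1.
Proof.
move=> ts; have cM : 0 <= c * (2^-1) ^+ M.+1 by rewrite mulr_ge0 // exprn_ge0 // invr_ge0.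
elim: N => [|N [IH1 IH2]] /=; first by rewrite !normr0.
have [sN|sN] := side N s.
  have [_ -> ->] := fp_l (hP N) (p_le0 sN).
  by rewrite !scaler0 !addr0.
have [_ -> ->] := late sN; rewrite !add0r !normrZ (ger0_norm (exprn_ge0 _ (ler0n _ _))).
have [NM|MN] := ltnP N M.
  have [_ -> ->] := fp_r (hP N) (p_ge1 (le_trans (t_mono NM) ts)).
  by rewrite !normr0 !mulr0.
have cc : c * 2^-1 ^+ N.+1 <= c * 2^-1 ^+ M.+1.
  by rewrite ler_wpM2l // ler_wiXn2l ?invr_ge0 // ?invf_le1 // ler1n.
split; apply: le_trans cc; rewrite -step_bound ler_wpM2l ?exprn_ge0 //.
  exact: fp_w (hP N) _.
exact: fp_z (hP N) isT _.
Qed.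

Let finite_path N : flat_path Rel true c c (prodQ N) (prodK N) (prodKb N) (sumW N) (sumZ N).
Proof.
have [rel0 relD] := Rlin.
have cb M : c * (2^-1) ^+ M.+1 <= c.
  by rewrite ler_piMr // exprn_ile1 ?invr_ge0 // invf_le1 // ler1n.
have Wb s : `|sumW N s| <= c /\ `|sumZ N s| <= c.
  have [s0|s0] := lerP 0 s.
    have [h1 h2] := W_bound N (M := 0) (ltac:(by rewrite t0) : t 0 <= s).
    by split; apply: le_trans (cb 0).
  have [_ _ -> ->] := early (leq0n N) (ltac:(by rewrite t0 ltW) : s <= t 0).
  by rewrite /= !normr0.
split.
- move=> s; elim: N {Wb} => [|N [e1 e2]] /=; first by rewrite bmul1l.
  have [e3 e4] := fp_inv (hP N) (p N s); split.
    by rewrite bmulA -[_ * k N _ * _]bmulA e3 bmul1r.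
  by rewrite bmulA -[_ * prodKb N _ * _]bmulA e2 bmul1r.
- move=> s; elim: N {Wb} => [|N IH] /=; first by rewrite bmul0r; exact: der_in_cst.
  have d2 := der_in_comp (S := setT) (S' := setT) (fun _ _ => I) (p_d setT N s) (fp_d (hP N) (p N s)).
  have := der_inM IH d2.
  have [sN|sN] := side N s.
    have [-> _ ->] := fp_l (hP N) (p_le0 sN).
    by rewrite bmul0r !scaler0 bmul0r !bmul1r !addr0.
  have [_ _ ->] := late sN.
  by rewrite bmul0r bmul0l !add0r bop_scalerAr bmulA.
- move=> s; elim: N {Wb} => [|N IH] /=; first exact: cont_in_cst.
  apply: cont_inD => //; apply: cont_inZ; first exact: cont_in_cst.
  by apply: (cont_in_comp (S := setT)) => //; [exact: der_in_cont (p_d _ _ _)|exact: fp_cw (hP N) _].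
- move=> s; elim: N {Wb} => [|N IH] /=; first exact: cont_in_cst.
  apply: cont_inD => //; apply: cont_inZ; first exact: cont_in_cst.
  by apply: (cont_in_comp (S := setT)) => //; [exact: der_in_cont (p_d _ _ _)|exact: fp_cz (hP N) _].
- move=> s; elim: N {Wb} => [|N IH] //=; rewrite addrC [X in Rel _ X]addrC.
  by apply: (relD) => //; exact: fp_rel (hP N) _.
- by move=> s; have [] := Wb s.
- by move=> _ s; have [] := Wb s.
- move=> s s0; have s0' : s <= t 0 by rewrite t0.
  by have [-> _ -> ->] := early (leq0n N) s0'.
- by move=> s s1; apply: late; exact: le_trans (ltW (t_lt1 N)) s1.
Qed.

Lemma prodQ_flat N : reach Rel true c c (prodQ N).
Proof. by exists (prodK N), (prodKb N), (sumW N), (sumZ N). Qed.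

Lemma geo_cvg (a : R) : cvgn (series (fun n => a * (2^-1) ^+ n)).
Proof.
have : `|(2^-1 : R)| < 1 by rewrite ger0_norm ?invr_ge0 // invf_lt1 // ltr1n.
exact: is_cvg_geometric_series.
Qed.

(** The inverses of the partial products converge for the same reason as the products
    themselves, so that the limit is invertible. *)
Lemma prodQ_lim : exists Q Qb, [/\ seq_lim prodQ Q, Q * Qb = 1 & Qb * Q = 1].
Proof.
have h2 n : c * (4^-1) ^+ n.+1 <= 2^-1 ^+ n.
  have c1 : c <= 1 by rewrite (le_trans c2) // invf_le1 // ler1n.
  have h1 : (2^-1 : R) ^+ n.+1 <= 1 by rewrite exprn_ile1 ?invr_ge0 // invf_le1 // ler1n.
  have h3 : 0 <= (2^-1 : R) ^+ n.+1 by rewrite exprn_ge0 // invr_ge0.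
  have h4 : (2^-1 : R) ^+ n.+1 <= 2^-1 ^+ n by rewrite ler_wiXn2l ?invr_ge0 // invf_le1 // ler1n.
  rewrite quarter_pow (le_trans _ h4) // -[leRHS]mul1r ler_pM // ?mulr_ge0 //.
  by rewrite -[leRHS]mulr1 ler_pM.
have c4 n : c * (4^-1) ^+ n.+1 <= 2^-1.
  have h1 : (4^-1 : R) ^+ n.+1 <= 1 by rewrite exprn_ile1 ?invr_ge0 // invf_le1 // ler1n.
  by rewrite (le_trans _ c2) // ler_piMr.
have hn n : reach Rel true (c * (4^-1) ^+ n.+1) (c * (4^-1) ^+ n.+1) (h n).
  by exists (k n), (kb n), (w n), (z n).
have [Q HQ] : exists l, seq_lim prodQ l.
  apply: (seq_lim_summable (v := fun n => 4 * (2^-1) ^+ n)); last exact: geo_cvg.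
  move=> n /=; have -> : prodQ n * h n - prodQ n = prodQ n * (h n - 1) by rewrite bmulBr bmul1r.
  have [q1 _] := reach_small c2 (prodQ_flat n); have [_ q2] := reach_small (c4 n) (hn n).
  rewrite (le_trans (bop_normM _ _)) // (_ : 4 = 2 * 2); last by ring.
  rewrite -mulrA ler_pM // (le_trans q2) // ler_wpM2l //.
have hq n : exists qb, [/\ prodQ n * qb = 1, qb * prodQ n = 1 & `|qb| <= 2].
  have [qb [e1 e2 e3]] := reach_inv Rlin (prodQ_flat n).
  by exists qb; split => //; have [] := reach_small c2 e3.
have hh n : exists qb, [/\ h n * qb = 1, qb * h n = 1 & `|qb - 1| <= 2 * 2^-1 ^+ n].
  have [qb [e1 e2 e3]] := reach_inv Rlin (hn n).
  exists qb; split => //; have [_ H2] := reach_small (c4 n) e3.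
  by rewrite (le_trans H2) // ler_wpM2l.
have /choice[qb Hqb] := hq; have /choice[hb Hhb] := hh.
have qbS n : qb n.+1 = hb n * qb n.
  have [e1 e2 _] := Hqb n.+1; have [e3 e4 _] := Hqb n; have [e5 e6 _] := Hhb n.
  have : (hb n * qb n) * (prodQ n.+1 * qb n.+1) = hb n * qb n by rewrite e1 bmul1r.
  by rewrite /= bmulA bmulA -[hb n * qb n * _]bmulA e4 bmul1r e6 bmul1l.
have [Qb HQb] : exists l, seq_lim qb l.
  apply: (seq_lim_summable (v := fun n => 4 * (2^-1) ^+ n)); last exact: geo_cvg.
  move=> n /=; rewrite qbS; have -> : hb n * qb n - qb n = (hb n - 1) * qb n by rewrite bmulBl bmul1l.
  have [_ _ q1] := Hqb n; have [_ _ q2] := Hhb n.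
  rewrite (le_trans (bop_normM _ _)) // (_ : 4 * 2^-1 ^+ n = (2 * 2^-1 ^+ n) * 2); last by ring.
  by rewrite ler_pM.
have lim1 (u v : nat -> B) U V : seq_lim u U -> seq_lim v V -> (forall n, u n * v n = 1) -> (forall n, `|u n| <= 2) -> U * V = 1.
  move=> uU vV uv u2; apply/eqP; rewrite -subr_eq0 -normr_le0; apply/ler_addgt0Pr => e e0.
  have V0 : 0 < `|V| + 1 by rewrite ltr_wpDl.
  have [N HN] := uU (e / 2 / (`|V| + 1)) (ltac:(by rewrite !divr_gt0)).
  have [N' HN'] := vV (e / 4) (ltac:(by rewrite divr_gt0)).
  pose m := maxn N N'.
  have -> : U * V - 1 = - ((u m - U) * V) - u m * (v m - V).
    by rewrite bmulBl bmulBr uv; lmod R.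
  have h1 : `|(u m - U) * V| <= e / 2.
    rewrite (le_trans (bop_normM _ _)) // -[e / 2](divfK (lt0r_neq0 V0)) ler_pM ?lerDl //.
    by apply: HN; exact: leq_maxl.
  have h3 : `|u m * (v m - V)| <= e / 2.
    rewrite (le_trans (bop_normM _ _)) // (_ : e / 2 = 2 * (e / 4)); last by field.
    by rewrite ler_pM //; apply: HN'; exact: leq_maxr.
  rewrite (le_trans (ler_normB _ _)) // normrN; lra.
exists Q, Qb; split => //.
  by apply: (lim1 _ _ _ _ HQ HQb) => n; [have [] := Hqb n|have [] := reach_small c2 (prodQ_flat n)].
by apply: (lim1 _ _ _ _ HQb HQ) => n; have [] := Hqb n.
Qed.

(** Away from time 1 the concatenation is locally one of the finite ones. At time 1 the
    logarithmic derivatives tend to 0, because the n-th path has speed at most c /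
    2^(n+1) after acceleration; the mean value inequality, uniform in the number of
    factors, then gives the derivative 0 there. *)
Lemma infinite_product : exists2 Q, seq_lim prodQ Q & reach Rel true c c Q.
Proof.
have [rel0 relD] := Rlin.
have [Q [Qb [QL QQb QbQ]]] := prodQ_lim.
exists Q => //.
have exN s : exists N, s < 1 -> s < t N.
  have [s1|s1] := ltP s 1; last by exists 0%N.
  have [N HN] := half_pow_small (e := (1 - s) / 2) (ltac:(by rewrite divr_gt0 // subr_gt0)).
  by exists N => _; have := HN N (leqnn _); rewrite /t; lra.
have /choice[nn Hnn] := exN.
pose K s := if s < 1 then prodK (nn s) s else Q.
pose Kb s := if s < 1 then prodKb (nn s) s else Qb.
pose W s := if s < 1 then sumW (nn s) s else 0.
pose Z s := if s < 1 then sumZ (nn s) s else 0.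
have KE N s : s < t N -> [/\ K s = prodK N s, Kb s = prodKb N s, W s = sumW N s & Z s = sumZ N s].
  move=> sN; have s1 : s < 1 by exact: lt_trans (t_lt1 N).
  rewrite /K /Kb /W /Z s1; have /ltW snn := Hnn s s1.
  have [nN|/ltnW Nn] := leqP (nn s) N.
    by have [-> -> -> ->] := early nN snn.
  by have [-> -> -> ->] := early Nn (ltW sN).
have K1 s : 1 <= s -> [/\ K s = Q, Kb s = Qb, W s = 0 & Z s = 0].
  by move=> s1; rewrite /K /Kb /W /Z ltNge s1.
have near_t N s r : s < t N -> `|r - s| < t N - s -> r < t N.
  by move=> sN; rewrite ltr_norml; lra.
have WZ M r : t M <= r -> `|W r| <= c * (2^-1) ^+ M.+1 /\ `|Z r| <= c * (2^-1) ^+ M.+1.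
  move=> tr; rewrite /W /Z; case: ifP => _; first exact: W_bound.
  by rewrite !normr0 mulr_ge0 // exprn_ge0 // invr_ge0.
have tail e : 0 < e -> exists2 M, c * (2^-1) ^+ M.+1 <= e & 0 < 1 - t M.
  move=> e0; have [M HM] := half_pow_small e0; exists M; last by rewrite subr_gt0.
  rewrite (le_trans _ (HM M.+1 (leqnSn _))) // ler_piMl ?exprn_ge0 ?invr_ge0 //.
  by rewrite (le_trans c2) // invf_le1 // ler1n.
exists K, Kb, W, Z; split.
- move=> s; have [s1|s1] := ltP s 1; last by have [-> -> _ _] := K1 s s1.
  have [-> -> _ _] := KE _ _ (Hnn s s1); exact: fp_inv (finite_path (nn s)) s.
- move=> s; have [s1|s1] := ltP s 1.
    have sN := Hnn s s1; have [eK _ _ eZ] := KE _ _ sN.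
    have := fp_d (finite_path (nn s)) s; rewrite -eK -eZ.
    apply: (der_in_ext (e0 := t (nn s) - s)); first by rewrite subr_gt0.
      by move=> r _ rs; have [-> _ _ _] := KE _ _ (near_t _ _ _ sN rs).
    by rewrite eK.
  have [eK _ _ eZ] := K1 s s1; rewrite eZ bmul0r.
  move=> e e0; have [M Mc tM] := tail (e / 2) (ltac:(by rewrite divr_gt0)).
  exists (1 - t M) => // r _ rs; rewrite scaler0 subr0 eK.
  have [r1|r1] := ltP r 1; last by have [-> _ _ _] := K1 r r1; rewrite subrr normr0 mulr_ge0 // ltW.
  have tr : t M <= r by move: rs; rewrite ltr_norml; lra.
  have rN := Hnn r r1; have [-> _ _ _] := KE _ _ rN.
  rewrite distrC.
  apply: (seq_lim_le (u := fun n => prodQ (n + nn r)%N - prodK (nn r) r)).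
    apply: seq_limB; first exact: seq_lim_shift.
    by move=> d d0; exists 0%N => n _; rewrite subrr normr0 ltW.
  move=> n; pose N := (n + nn r)%N.
  have rN' : r <= t N by rewrite (le_trans (ltW rN)) // t_mono // leq_addl.
  have [<- _ _ _] := early (leq_addl n (nn r)) (ltW rN); rewrite -/N.
  have [<- _ _] := late (lexx (t N)).
  have FN := finite_path N.
  have Kn x : `|prodK N x| <= 2.
    have [x0|x0] := lerP x 0.
      by have [-> _ _] := fp_l FN x0; rewrite (le_trans bop_norm1) // ler1n.
    have [x1|x1] := lerP 1 x.
      by have [-> _ _] := fp_r FN x1; have [] := reach_small c2 (prodQ_flat N).
    have [k0 _ _] := fp_l FN (lexx _).
    by have [] := gronwall_small c2 k0 (fp_d FN) (fp_z FN isT) (s := x) (ltac:(by rewrite !ltW)).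
  apply: (le_trans (mean_value_le (M := e) rN' (fun x _ => der_in_sub (fun _ _ => I) (fp_d FN x)) _)).
    move=> x /andP[rx _]; rewrite (le_trans (bop_normM _ _)) //.
    have -> : e = 2 * (e / 2) by field.
    rewrite ler_pM //; apply: le_trans Mc.
    by have [] := W_bound N (le_trans tr rx).
  rewrite ler_wpM2l ?(ltW e0) //; have := t_lt1 N; have := ler_norm (- (r - s)); rewrite normrN; lra.
- move=> s; have [s1|s1] := ltP s 1.
    have sN := Hnn s s1; have [_ _ eW _] := KE _ _ sN.
    have := fp_cw (finite_path (nn s)) s.
    apply: (cont_in_ext (e0 := t (nn s) - s)); [by rewrite subr_gt0| |by rewrite eW].
    by move=> r _ rs; have [_ _ -> _] := KE _ _ (near_t _ _ _ sN rs).
  have [_ _ eW _] := K1 s s1.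
  move=> e /tail[M Mc tM]; exists (1 - t M) => // r _; rewrite eW subr0 ltr_norml => rs.
  by have [h1 _] := WZ M r (ltac:(lra)); exact: le_trans Mc.
- move=> s; have [s1|s1] := ltP s 1.
    have sN := Hnn s s1; have [_ _ _ eW] := KE _ _ sN.
    have := fp_cz (finite_path (nn s)) s.
    apply: (cont_in_ext (e0 := t (nn s) - s)); [by rewrite subr_gt0| |by rewrite eW].
    by move=> r _ rs; have [_ _ _ ->] := KE _ _ (near_t _ _ _ sN rs).
  have [_ _ _ eW] := K1 s s1.
  move=> e /tail[M Mc tM]; exists (1 - t M) => // r _; rewrite eW subr0 ltr_norml => rs.
  by have [_ h1] := WZ M r (ltac:(lra)); exact: le_trans Mc.
- move=> s; rewrite /W /Z; case: ifP => _ //; exact: fp_rel (finite_path _) s.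
- move=> s; rewrite /W; case: ifP => _; rewrite ?normr0 //; exact: fp_w (finite_path _) s.
- move=> _ s; rewrite /Z; case: ifP => _; rewrite ?normr0 //; exact: fp_z (finite_path _) isT s.
- move=> s s0; have s1 : s < 1 by exact: le_lt_trans s0 ltr01.
  by rewrite /K /W /Z s1; have [-> -> ->] := fp_l (finite_path (nn s)) s0.
- by move=> s /K1[-> _ -> ->].
Qed.

End InfiniteProduct.

(** * The closed graph and products of exponentials *)

Section ClosedGraph.
Context {R : realType} {H : completeNormedModType R[i]} {L : completeNormedModType R}.
Local Notation B := (bop H).
Context (T : L -> B) (T_lin : forall a x y, T (a *: x + y) = a *: T x + T y).
Context (br : L -> L -> L) (C : R) (C0 : 0 <= C).
Hypothesis br_lin : forall a w w' x, br (a *: w + w') x = a *: br w x + br w' x.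
Hypothesis br_norm : forall w x, `|br w x| <= C * `|w| * `|x|.
Hypothesis T_br : forall w x, T (br w x) = bracket (T w) (T x).

Definition graph (w : L) (z : B) : Prop := z = T w.

(** The closure of the graph of T in L x B(H). *)
Definition clgraph (w : L) (z : B) : Prop :=
  forall e : R, 0 < e -> exists2 x, `|x - w| <= e & `|T x - z| <= e.

Lemma T0 : T 0 = 0.
Proof. by have := T_lin (-1) 0 0; rewrite scaler0 addr0 scaleN1r addNr. Qed.

Lemma TB x y : T (x - y) = T x - T y.
Proof. by have := T_lin (-1) y x; rewrite !scaleN1r ![- _ + _]addrC. Qed.

Lemma graph_lin : linear_rel graph.
Proof. by split=> [|a w w' z z' -> ->]; rewrite /graph ?T0 // T_lin. Qed.

Lemma graph_clgraph w z : graph w z -> clgraph w z.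
Proof. by move=> -> e e0; exists w; rewrite subrr normr0 ltW. Qed.

Lemma clgraph_lin : linear_rel clgraph.
Proof.
split=> [|a w w' z z' h h' e e0]; first by apply: graph_clgraph; rewrite /graph T0.
have A0 : 0 < `|a| + 1 by rewrite ltr_wpDl.
have [x x1 x2] := h (e / 2 / (`|a| + 1)) (ltac:(by rewrite !divr_gt0)).
have [y y1 y2] := h' (e / 2) (ltac:(by rewrite divr_gt0)).
have sm (u : R) : 0 <= u -> u <= e / 2 / (`|a| + 1) -> `|a| * u <= e / 2.
  move=> u0 hu; rewrite -[e / 2](divfK (lt0r_neq0 A0)) mulrC ler_pM // lerDl //.
exists (a *: x + y).
  have -> : a *: x + y - (a *: w + w') = a *: (x - w) + (y - w') by lmod R.
  by rewrite (le_trans (ler_normD _ _)) // normrZ (splitr e) lerD // sm.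
have -> : T (a *: x + y) - (a *: z + z') = a *: (T x - z) + (T y - z') by rewrite T_lin; lmod R.
by rewrite (le_trans (ler_normD _ _)) // normrZ (splitr e) lerD // sm.
Qed.

Lemma clgraph_closed (u : nat -> L) (v : nat -> B) w z :
  seq_lim u w -> seq_lim v z -> (forall n, clgraph (u n) (v n)) -> clgraph w z.
Proof.
move=> uw vz uv e e0; have e20 : 0 < e / 2 by rewrite divr_gt0.
have [N HN] := uw _ e20; have [N' HN'] := vz _ e20.
have [x x1 x2] := uv (maxn N N') _ e20.
have h1 := HN _ (leq_maxl N N'); have h2 := HN' _ (leq_maxr N N').
exists x.
  have -> : x - w = (x - u (maxn N N')) + (u (maxn N N') - w) by lmod R.
  by rewrite (le_trans (ler_normD _ _)) // (splitr e) lerD.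
have -> : T x - z = (T x - v (maxn N N')) + (v (maxn N N') - z) by lmod R.
by rewrite (le_trans (ler_normD _ _)) // (splitr e) lerD.
Qed.

Lemma br_bounded x : bounded_linear (fun w => br w x) (C * `|x|).
Proof.
split; [by rewrite mulr_ge0|by move=> a u v; exact: br_lin|].
by move=> w; rewrite mulrAC.
Qed.

Lemma clgraph_bracket w z x : clgraph w z -> clgraph (br w x) (bracket z (T x)).
Proof.
move=> h e e0.
have [a0 a1 a2] := br_bounded x; have [b0 b1 b2] := ad_bounded (T x).
have A0 : 0 < C * `|x| + 2 * `|T x| + 1 by rewrite ltr_wpDl // addr_ge0.
have [y y1 y2] := h (e / (C * `|x| + 2 * `|T x| + 1)) (ltac:(by rewrite !divr_gt0)).
have sm (c u : R) : 0 <= c -> c <= C * `|x| + 2 * `|T x| + 1 -> 0 <= u ->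
   u <= e / (C * `|x| + 2 * `|T x| + 1) -> c * u <= e.
  move=> c0 hc u0 hu; rewrite -[leRHS](divfK (lt0r_neq0 A0)) mulrC ler_pM //.
exists (br y x).
  have -> : br y x - br w x = br (y - w) x.
    by have := br_lin (-1) w y x; rewrite !scaleN1r ![- _ + _]addrC.
  by rewrite (le_trans (a2 _)) // sm //; lra.
rewrite T_br; have -> : bracket (T y) (T x) - bracket z (T x) = bracket (T y - z) (T x).
  by rewrite /bracket bmulBl bmulBr; lmod R.
by rewrite (le_trans (b2 _)) // sm //; lra.
Qed.

(** The partial sums of the two series are the same combinations of iterated brackets,
    to which [clgraph_bracket] applies; the closed graph contains limits of its
    elements. *)
Lemma clgraph_flow w z x t : clgraph w z ->
  clgraph (flow (fun w => br w x) t w) (flow (fun z => bracket z (T x)) t z).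
Proof.
move=> h.
apply: (clgraph_closed (flow_lim (br_bounded x) t w) (flow_lim (ad_bounded (T x)) t z)) => n.
have hi m : clgraph (iter m (fun w => br w x) w) (iter m (fun z => bracket z (T x)) z).
  by elim: m => //= m IH; exact: clgraph_bracket.
rewrite /flow_sum; elim: n => [|n IH]; first by rewrite !big_ord0; exact: clgraph_lin.1.
rewrite !big_ord_recr /= addrC [X in clgraph _ X]addrC.
by apply: clgraph_lin.2.
Qed.

Lemma clgraph_conj w z x t : 0 <= t -> clgraph w z ->
  clgraph (flow (fun w => br w x) t w) (bop_exp (T x) (- t) * z * bop_exp (T x) t).
Proof. by move=> t0 h; rewrite conj_bop_exp //; exact: clgraph_flow. Qed.

Lemma conj_norm x t z : 0 <= t ->
  `|bop_exp (T x) (- t) * z * bop_exp (T x) t| <= expR (2 * `|T x| * t) * `|z|.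
Proof.
move=> t0; rewrite conj_bop_exp //; apply: (le_trans (flow_norm (ad_bounded (T x)) _ _)).
by rewrite (ger0_norm t0) [t * _]mulrC.
Qed.

Lemma br_flow_norm x t w : 0 <= t ->
  `|flow (fun w => br w x) t w| <= expR (C * `|x| * t) * `|w|.
Proof.
move=> t0; apply: (le_trans (flow_norm (br_bounded x) _ _)).
by rewrite (ger0_norm t0) [t * _]mulrC.
Qed.

Lemma bop_exp_conj_inv x t k kb : k * kb = 1 ->
  (bop_exp (T x) (- t) * k * bop_exp (T x) t) * (bop_exp (T x) (- t) * kb * bop_exp (T x) t) = 1.
Proof.
move=> e; rewrite !bmulA -[_ * bop_exp (T x) t * bop_exp (T x) (- t)]bmulA bop_expVr bmul1r.
by rewrite -[_ * k * kb]bmulA e bmul1r bop_expVl.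
Qed.

(** By [conj_bop_exp] the conjugated path has the logarithmic derivative obtained from z
    by the flow of the bracket with T x; the corresponding w is obtained by the flow of
    the bracket with x in L, and [clgraph_flow] keeps the pair in the closed graph. This
    is where the closed graph is needed: nothing says that T exchanges the two flows. *)
Lemma reach_conj o a b r x t : 0 <= t -> reach clgraph o a b r ->
  reach clgraph o (expR (C * `|x| * t) * a) (expR (2 * `|T x| * t) * b)
    (bop_exp (T x) (- t) * r * bop_exp (T x) t).
Proof.
move=> t0 [k [kb [w [z [f1 f2 f3 f4 f5 f6 f7 f8 f9]]]]].
pose E := bop_exp (T x) t; pose E' := bop_exp (T x) (- t).
exists (fun s => E' * k s * E), (fun s => E' * kb s * E),
  (fun s => flow (fun w => br w x) t (w s)), (fun s => E' * z s * E); split.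
- by move=> s; have [e1 e2] := f1 s; split; exact: bop_exp_conj_inv.
- move=> s; have := der_inM (der_inM (der_in_cst setT E' s) (f2 s)) (der_in_cst setT E s).
  rewrite bmul0l add0r bmul0r addr0.
  have -> : E' * (k s * z s) * E = E' * k s * E * (E' * z s * E).
    by rewrite !bmulA -[_ * E * E']bmulA bop_expVr bmul1r.
  by [].
- by move=> s; apply: (cont_in_flow (br_bounded x)) => //; exact: cont_in_cst.
- by move=> s; apply: cont_inM (cont_in_cst _ _ _); apply: cont_inM (cont_in_cst _ _ _) _.
- by move=> s; exact: clgraph_conj.
- by move=> s; rewrite (le_trans (br_flow_norm _ _ t0)) // ler_wpM2l ?expR_ge0.
- by move=> oo s; rewrite (le_trans (conj_norm _ _ t0)) // ler_wpM2l ?expR_ge0 ?f7.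
- move=> s /f8[-> -> ->]; rewrite bmul1r bop_expVl bmul0r bmul0l.
  by have := flowB (br_bounded x) t 0 0; rewrite !subrr.
- move=> s /f9[-> -> ->]; rewrite bmul0r bmul0l.
  by have := flowB (br_bounded x) t 0 0; rewrite !subrr.
Qed.

(** The path r |-> exp(- (t - s) T x) k(s)^-1 k(r) exp((t - r) T x) starts at 1, and
    ends at the given element. Its logarithmic derivative is the conjugate of z - T x by
    exp((t - r) T x). *)
Lemma reach_near_exp (o : bool) (d b s t : R) x (k kb : R -> B) (w1 : R -> L) (z z1 : R -> B) :
  s < t ->
  (forall r, s <= r <= t -> k r * kb r = 1 /\ kb r * k r = 1) ->
  (forall r, s <= r <= t -> der_in `[s, t]%classic k r (k r * z r)) ->
  (forall r, s <= r <= t -> cont_in `[s, t]%classic w1 r) ->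
  (forall r, s <= r <= t -> cont_in `[s, t]%classic z1 r) ->
  (forall r, s < r < t ->
    [/\ z r = z1 r, clgraph (w1 r) (z1 r), `|w1 r - x| <= d & o -> `|z1 r - T x| <= b]) ->
  reach clgraph o (2 * (t - s) * (expR (C * `|x| * (t - s)) * d))
    (2 * (t - s) * (expR (2 * `|T x| * (t - s)) * b)) (bop_exp (T x) (- (t - s)) * (kb s * k t)).
Proof.
move=> st kkb dk cw cz rel.
have [relc0 relc] := clgraph_lin.
pose E r := bop_exp (T x) (t - r); pose E' r := bop_exp (T x) (- (t - r)).
have EE r : E r * E' r = 1 by exact: bop_expVr.
have E'E r : E' r * E r = 1 by exact: bop_expVl.
pose K r := E' s * (kb s * k r) * E r.
pose Kb r := E' r * (kb r * k s) * E s.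
have [e1 e2] := kkb s (ltac:(by rewrite lexx ltW)).
have Ks : Kb s * K t = E' s * (kb s * k t).
  by rewrite /Kb e2 bmul1r E'E bmul1l /K /E subrr bop_exp0 bmul1r.
rewrite -Ks.
pose ZZ (u : R -> B) r := E' r * (u r - T x) * E r.
have dE r : der_in `[s, t]%classic E r (- (E r * T x)).
  have := der_in_bop_exp_comp (T x) (der_in_sub_cst `[s, t]%classic t r).
  by rewrite scaleN1r bmulNr.
have dE' r : der_in `[s, t]%classic E' r (E' r * T x).
  have v : der_in `[s, t]%classic ((fun r => - (t - r)) : R -> R^o) r 1.
    by apply: der_in_affine => ?; rewrite /GRing.scale /=; ring.
  by have := der_in_bop_exp_comp (T x) v; rewrite scale1r.
apply: (reach_reparam (w1 := fun r => flow (fun w => br w x) (t - r) (w1 r - x)) (z := ZZ z) (z1 := ZZ z1) clgraph_lin st).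
- move=> r rst; have [e3 e4] := kkb r rst; split.
    rewrite /K /Kb !bmulA -[_ * E r * E' r]bmulA EE bmul1r -[_ * k r * kb r]bmulA e3 bmul1r.
    by rewrite -[_ * kb s * k s]bmulA e2 bmul1r E'E.
  rewrite /K /Kb !bmulA -[_ * E s * E' s]bmulA EE bmul1r -[_ * k s * kb s]bmulA e1 bmul1r.
  by rewrite -[_ * kb r * k r]bmulA e4 bmul1r E'E.
- move=> r rst.
  have := der_inM (der_inM (der_in_cst _ (E' s) r) (der_inM (der_in_cst _ (kb s) r) (dk r rst))) (dE r).
  rewrite !bmul0l !add0r.
  suff -> : E' s * (kb s * (k r * z r)) * E r + E' s * (kb s * k r) * - (E r * T x) = K r * ZZ z r by [].
  rewrite /K /ZZ !bmulA -[_ * E r * E' r]bmulA EE bmul1r bmulBr bmulBl bmulNr.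
  by rewrite bop_expC !bmulA.
- move=> r rst; apply: (cont_in_flow (br_bounded x)); first exact: der_in_cont (der_in_sub_cst _ _ _).
  by apply: cont_inD; [exact: cw|exact: cont_in_cst].
- move=> r rst; apply: cont_inM; last exact: der_in_cont (dE r).
  apply: cont_inM; first exact: der_in_cont (dE' r).
  by apply: cont_inD; [exact: cz|exact: cont_in_cst].
- move=> r rst; have [e3 e4 e5 e6] := rel r rst.
  have /andP[sr rt] := rst.
  have tr : 0 <= t - r by lra.
  have mono (c u : R) : 0 <= c -> 0 <= u -> expR (c * (t - r)) * u <= expR (c * (t - s)) * u.
    by move=> c0 u0; rewrite ler_wpM2r // ler_expR ler_wpM2l //; lra.
  split.
  + by rewrite /ZZ e3.
  + apply: clgraph_conj => //; have := relc (-1) _ _ _ _ (graph_clgraph (erefl (T x))) e4.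
    by rewrite !scaleN1r ![- _ + _]addrC.
  + apply: (le_trans (br_flow_norm _ _ tr)).
    apply: (le_trans (mono _ _ (mulr_ge0 C0 (normr_ge0 _)) (normr_ge0 _))).
    by rewrite ler_wpM2l ?expR_ge0.
  + move=> oo; apply: (le_trans (conj_norm _ _ tr)).
    apply: (le_trans (mono _ _ (mulr_ge0 (ler0n _ 2) (normr_ge0 _)) (normr_ge0 _))).
    by rewrite ler_wpM2l ?expR_ge0 ?e6.
Qed.

Lemma reach_bop_exp o x t : 0 < t ->
  reach graph o (2 * t * `|x|) (2 * t * `|T x|) (bop_exp (T x) t).
Proof.
move=> t0.
have := reach_reparam (Rel := graph) (o := o) (a := `|x|) (b := `|T x|) (s := 0) (t := t)
  (k := bop_exp (T x)) (kb := fun r => bop_exp (T x) (- r)) (w1 := fun=> x) (z := fun=> T x)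
  (z1 := fun=> T x) graph_lin t0.
rewrite subr0 oppr0 bop_exp0 bmul1l; apply.
- by move=> r _; split; [exact: bop_expVr|exact: bop_expVl].
- by move=> r _; exact: der_in_bop_exp.
- by move=> r _; exact: cont_in_cst.
- by move=> r _; exact: cont_in_cst.
- by [].
Qed.

Lemma reach_graph_cl o a b q : reach graph o a b q -> reach clgraph o a b q.
Proof.
move=> [k [kb [w [z [f1 f2 f3 f4 f5 f6 f7 f8 f9]]]]]; exists k, kb, w, z; split => //.
by move=> s; exact: graph_clgraph.
Qed.

(** The element q is h times a remainder hb q. The factor h has the property [Q], it is
    joined to 1 by a path in the graph, and conjugation by it distorts the speeds of
    closed-graph paths by factors exp(C a tau) and exp(2 b tau), as if h were a product
    of exponentials of total duration tau with exponents of norms at most a and b. The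
    remainder has speed of the order of a' tau and b' tau. *)
Definition near_product (Q : B -> Prop) (o : bool) (a b a' b' : R) (q : B) (tau : R) :=
  exists h hb, [/\ inverse_of h hb, Q h,
    reach graph o (2 * a * tau) (2 * b * tau) h,
    (forall c c' r, reach clgraph o c c' r ->
       reach clgraph o (expR (C * a * tau) * c) (expR (2 * b * tau) * c') (hb * r * h)) &
    reach clgraph o (4 * tau * (expR (C * a * tau) * a')) (4 * tau * (expR (2 * b * tau) * b')) (hb * q)].

(** If q_i = h_i r_i then q_1 q_2 = (h_1 h_2) (h_2^-1 r_1 h_2) r_2, which is why
    [near_product] keeps track of the conjugation by h. The distortion factors are
    exponentials in tau, hence multiplicative; concatenating in proportion to the
    durations t1 and t2 preserves the form of all bounds. *)
Lemma near_product_mul (Q : B -> Prop) o a b a' b' q1 q2 t1 t2 :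
  (forall h h', Q h -> Q h' -> Q (h * h')) -> 0 <= a -> 0 <= b -> 0 <= a' -> 0 <= b' ->
  0 < t1 -> 0 < t2 ->
  near_product Q o a b a' b' q1 t1 -> near_product Q o a b a' b' q2 t2 ->
  near_product Q o a b a' b' (q1 * q2) (t1 + t2).
Proof.
move=> Qm a0 b0 a'0 b'0 t10 t20 [h1 [hb1 [[i1 j1] Q1 r1 c1 e1]]] [h2 [hb2 [[i2 j2] Q2 r2 c2 e2]]].
have t0 : 0 < t1 + t2 by rewrite addr_gt0.
pose th := t1 / (t1 + t2).
have th1 : th * (t1 + t2) = t1 by rewrite divfK // lt0r_neq0.
have th2 : (1 - th) * (t1 + t2) = t2 by rewrite mulrBl th1 mul1r; ring.
have th01 : 0 < th < 1.
  by rewrite divr_gt0 //= ltr_pdivrMr // mul1r ltrDl.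
have /andP[th0 th'] := th01.
have E c : 0 <= c -> expR (c * t1) * expR (c * t2) = expR (c * (t1 + t2)).
  by move=> _; rewrite -expRD -mulrDr.
have E2 c x : expR (c * t2) * (expR (c * t1) * x) = expR (c * (t1 + t2)) * x.
  by rewrite mulrA -expRD -mulrDr [t2 + t1]addrC.
have Em c u v : 0 <= c -> u <= v -> expR (c * u) <= expR (c * v).
  by move=> cc uv; rewrite ler_expR ler_wpM2l.
have CA : 0 <= C * a by rewrite mulr_ge0.
have CB : 0 <= 2 * b by rewrite mulr_ge0.
exists (h1 * h2), (hb2 * hb1); split.
- split; first by rewrite !bmulA -[h1 * h2 * hb2]bmulA i2 bmul1r.
  by rewrite !bmulA -[hb2 * hb1 * h1]bmulA j1 bmul1r.
- exact: Qm.
- apply: (reach_concat graph_lin th01 _ _ _ r1 r2).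
  + by rewrite mulrCA th1.
  + by rewrite mulrCA th2.
  + by move=> _; rewrite ![_ * (2 * b * _)]mulrCA th1 th2.
- move=> c c' r hr; have := c2 _ _ _ (c1 _ _ _ hr).
  rewrite (E2 (C * a) c) (E2 (2 * b) c').
  by have -> : hb2 * (hb1 * r * h1) * h2 = hb2 * hb1 * r * (h1 * h2) by rewrite !bmulA.
- have -> : hb2 * hb1 * (q1 * q2) = hb2 * (hb1 * q1) * h2 * (hb2 * q2).
    by rewrite !bmulA -[_ * q1 * h2 * hb2]bmulA i2 bmul1r.
  apply: (reach_concat clgraph_lin th01 _ _ _ (c2 _ _ _ e1) e2).
  + rewrite -[X in _ <= _ * (4 * X * _)]mul1r.
    have -> : expR (C * a * t2) * (4 * t1 * (expR (C * a * t1) * a')) =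
      4 * t1 * ((expR (C * a * t1) * expR (C * a * t2)) * a') by ring.
    rewrite E // mul1r -{1}th1 le_eqVlt; apply/orP; left; apply/eqP; ring.
  + have -> : (1 - th) * (4 * (t1 + t2) * (expR (C * a * (t1 + t2)) * a')) =
      4 * t2 * (expR (C * a * (t1 + t2)) * a') by rewrite -{3}th2; ring.
    by rewrite ler_wpM2l ?mulr_ge0 ?(ltW t20) // ler_wpM2r // Em // lerDr ltW.
  + move=> _; split.
      have -> : expR (2 * b * t2) * (4 * t1 * (expR (2 * b * t1) * b')) =
        4 * t1 * ((expR (2 * b * t1) * expR (2 * b * t2)) * b') by ring.
      rewrite E // -{1}th1 le_eqVlt; apply/orP; left; apply/eqP; ring.
    have -> : (1 - th) * (4 * (t1 + t2) * (expR (2 * b * (t1 + t2)) * b')) =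
      4 * t2 * (expR (2 * b * (t1 + t2)) * b') by rewrite -{3}th2; ring.
    by rewrite ler_wpM2l ?mulr_ge0 ?(ltW t20) // ler_wpM2r // Em // lerDr ltW.
Qed.

(** Around each time s the pair (w, z) stays close to (x, T x), so on a short interval
    the path is close to an exponential of x; [near_product_mul] and [local_to_global]
    assemble the intervals. When the flag o is not set, nothing is asked of T x, and x
    only has to be close to w in L. *)
Lemma product_approximation (Q : B -> Prop) (o o' : bool) (al be a b a' b' : R) (q : B) k kb w z :
  flat_path clgraph o' al be q k kb w z ->
  (forall h h', Q h -> Q h' -> Q (h * h')) ->
  0 <= a -> 0 <= b -> 0 < a' -> 0 < b' ->
  (forall s, 0 <= s <= 1 -> exists x, [/\ `|x| <= a, o -> `|T x| <= b, `|w s - x| <= a',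
     o -> `|z s - T x| <= b' & forall t, 0 < t <= 1 -> Q (bop_exp (T x) t)]) ->
  near_product Q o a b a' b' q 1.
Proof.
move=> fp Qm a0 b0 a'0 b'0 appr.
have [f1 f2 f3 f4 f5 f6 f7 f8 f9] := fp.
have kb0 : kb 0 = 1 by have [_] := f1 0; have [-> _ _] := f8 0 (lexx _); rewrite bmul1r.
have [k1 _ _] := f9 1 (lexx _).
have -> : q = kb 0 * k 1 by rewrite kb0 bmul1l k1.
have -> : 1 = 1 - 0 :> R by rewrite subr0.
rewrite subr0 -[X in near_product _ _ _ _ _ _ _ X](subr0 1).
have loc s : 0 <= s <= 1 -> exists2 e : R, 0 < e & forall u v, 0 <= u -> u < v -> v <= 1 ->
    (forall r, u < r < v -> `|r - s| < e) ->
    near_product Q o a b a' b' (kb u * k v) (v - u).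
  move=> s01; have [x [x1 x2 x3 x4 x5]] := appr s s01.
  have [d1 d10 H1] := f3 s _ a'0; have [d2 d20 H2] := f4 s _ b'0.
  exists (Num.min d1 d2); first by rewrite lt_min d10.
  move=> u v u0 uv v1 uvd; have tau0 : 0 < v - u by rewrite subr_gt0.
  have tau1 : v - u <= 1 by lra.
  exists (bop_exp (T x) (v - u)), (bop_exp (T x) (- (v - u))); split.
  - by split; [exact: bop_expVr|exact: bop_expVl].
  - by apply: x5; rewrite tau0.
  - apply: (reach_le _ _ (reach_bop_exp o x tau0)).
      by rewrite mulrAC ler_wpM2r ?(ltW tau0) // ler_wpM2l.
    by move=> oo; split=> //; rewrite mulrAC ler_wpM2r ?(ltW tau0) // ler_wpM2l // x2.
  - move=> c c' r hr; have [c0 c'0] := reach_ge0 hr.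
    apply: (reach_le _ _ (reach_conj x (ltW tau0) hr)).
      by rewrite ler_wpM2r // ler_expR ler_wpM2r ?(ltW tau0) // ler_wpM2l.
    by move=> oo; split=> //; rewrite ler_wpM2r ?c'0 // ler_expR ler_wpM2r ?(ltW tau0) // ler_wpM2l // x2.
  - have := @reach_near_exp o (2 * a') (2 * b') u v x k kb w z z uv (fun r _ => f1 r)
      (fun r _ => der_in_sub (fun _ _ => I) (f2 r)) (fun r _ => cont_in_sub (fun _ _ => I) (f3 r))
      (fun r _ => cont_in_sub (fun _ _ => I) (f4 r)).
    have hr r : u < r < v -> [/\ z r = z r, clgraph (w r) (z r), `|w r - x| <= 2 * a' & o -> `|z r - T x| <= 2 * b'].
      move=> /uvd; rewrite lt_min => /andP[r1 r2]; split => //.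
        have -> : w r - x = (w r - w s) + (w s - x) by lmod R.
        have h1 := H1 r I r1; rewrite (le_trans (ler_normD _ _)) //; lra.
      move=> oo; have -> : z r - T x = (z r - z s) + (z s - T x) by lmod R.
      have h1 := H2 r I r2; have h2 := x4 oo; rewrite (le_trans (ler_normD _ _)) //; lra.
    move=> /(_ hr); apply: reach_le.
      have -> : 2 * (v - u) * (expR (C * `|x| * (v - u)) * (2 * a')) = 4 * (v - u) * (expR (C * `|x| * (v - u)) * a') by ring.
      rewrite ler_wpM2l ?mulr_ge0 ?(ltW tau0) // ler_wpM2r ?(ltW a'0) // ler_expR ler_wpM2r ?(ltW tau0) // ler_wpM2l //.
    move=> oo; split=> //.
    have -> : 2 * (v - u) * (expR (2 * `|T x| * (v - u)) * (2 * b')) = 4 * (v - u) * (expR (2 * `|T x| * (v - u)) * b') by ring.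
    by rewrite ler_wpM2l ?mulr_ge0 ?(ltW tau0) // ler_wpM2r ?(ltW b'0) // ler_expR ler_wpM2r ?(ltW tau0) // ler_wpM2l // x2.
apply: (local_to_global (P := fun u v => near_product Q o a b a' b' (kb u * k v) (v - u))) => //.
  move=> s t u s0 st tu u1 h1 h2.
  have -> : kb s * k u = (kb s * k t) * (kb t * k u).
    by have [e1 _] := f1 t; rewrite !bmulA -[_ * k t * kb t]bmulA e1 bmul1r.
  have -> : u - s = (t - s) + (u - t) by ring.
  by apply: near_product_mul => //; rewrite ?subr_gt0 // ltW.
move=> s s01; have [e e0 He] := loc s s01; have /andP[s0 s1] := s01.
exists e => //; split=> t /andP[h1 h2] h3; apply: He => // r /andP[r1 r2]; rewrite ltr_norml; lra.
Qed.

Lemma expR_small_factor (K e : R) : 0 < e ->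
  exists2 d : R, 0 < d & forall u v c, 0 <= c <= d -> u <= K -> v <= K ->
     4 * 1 * (expR u * c) <= e /\ 4 * 1 * (expR v * c) <= e.
Proof.
move=> e0; have E0 := expR_gt0 K.
exists (e / 4 / expR K); first by rewrite !divr_gt0.
move=> u v c /andP[c0 cd] uK vK.
have h x : x <= K -> 4 * 1 * (expR x * c) <= e.
  move=> xK; have -> : e = 4 * 1 * (expR K * (e / 4 / expR K)) by field; rewrite lt0r_neq0.
  by rewrite ler_wpM2l // ler_pM ?expR_ge0 // ler_expR.
by split; exact: h.
Qed.

(** Choosing x close to w with T x close to z, as the closed graph allows, makes the
    remainder small for both norms. *)
Lemma clgraph_refine a b q e : 0 < e -> reach clgraph true a b q ->
  exists h hb, [/\ inverse_of h hb, reach graph true (2 * a + e) (2 * b + e) h &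
    reach clgraph true e e (hb * q)].
Proof.
move=> e0 hq; have [a0 /(_ isT) b0] := reach_ge0 hq.
have [d0 d00 Hd] := expR_small_factor (C * (a + 1) + 2 * (b + 1)) e0.
pose d := Num.min (Num.min d0 1) (e / 2).
have dp : 0 < d by rewrite !lt_min d00 ltr01 divr_gt0.
have dd0 : d <= d0 by rewrite !ge_min lexx.
have d1 : d <= 1 by rewrite !ge_min lexx !orbT.
have de : d <= e / 2 by rewrite !ge_min lexx !orbT.
have [k [kb [w [z fp]]]] := hq.
have [] := @product_approximation (fun=> True) true true a b (a + d) (b + d) d d q k kb w z fp
  (fun _ _ _ _ => I) (addr_ge0 a0 (ltW dp)) (addr_ge0 b0 (ltW dp)) dp dp.
  move=> s _; have [x x1 x2] := fp_rel fp s d dp.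
  have wa := fp_w fp s; have zb := fp_z fp isT s.
  exists x; split => //; rewrite 1?[`|w s - x|]distrC 1?[`|z s - T x|]distrC //.
  - have -> : x = w s + (x - w s) by lmod R.
    by rewrite (le_trans (ler_normD _ _)) // lerD.
  - move=> _; have -> : T x = z s + (T x - z s) by lmod R.
    by rewrite (le_trans (ler_normD _ _)) // lerD.
move=> h [hb [ih _ rh _ rr]]; exists h, hb; split => //.
  by apply: reach_le rh; [|split => //]; lra.
have [h1 h2] := Hd (C * (a + d) * 1) (2 * (b + d) * 1) d (ltac:(by rewrite (ltW dp)))
  (ltac:(rewrite mulr1; have := ler_wpM2l C0 (_ : a + d <= a + 1); rewrite lerD2l => /(_ d1); lra))
  (ltac:(rewrite mulr1; have := ler_wpM2l C0 (_ : 0 <= a + 1); rewrite mulr0 => /(_ (ltac:(lra))); lra)).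
by apply: reach_le rr.
Qed.

Lemma quarter_gt0 n : 0 < (4^-1 : R) ^+ n. Proof. by rewrite exprn_gt0 // invr_gt0. Qed.

(** Iterating [clgraph_refine] writes hb0 q as a product h_0 ... h_(n-1) r_n in which
    the r_n tend to 1 and the h_n are joined to 1 in the graph with speeds that decrease
    geometrically. So hb0 q is the infinite product of the h_n. *)
Lemma reach_clgraph_graph o a b q e : 0 < e -> reach clgraph o a b q ->
  reach graph false (2 * a + e) 0 q.
Proof.
move=> e0 /reach_bounded[b' b'0 hq].
pose c := Num.min (2^-1) (e / 2).
have c0 : 0 < c by rewrite lt_min invr_gt0 ltr0n divr_gt0.
have c2 : c <= 2^-1 by rewrite ge_min lexx.
have ce : c <= e / 2 by rewrite ge_min lexx orbT.
(* The n-th factor has speed at most 2 ee n + ee (n+1), whence the division by 3. *)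
pose ee n := c * (4^-1) ^+ n.+1 / 3.
have ee0 n : 0 < ee n by rewrite divr_gt0 // mulr_gt0 // quarter_gt0.
have eeS n : 2 * ee n + ee n.+1 <= c * (4^-1) ^+ n.+1.
  have -> : ee n.+1 = 4^-1 * ee n by rewrite /ee exprS; ring.
  have -> : c * 4^-1 ^+ n.+1 = 3 * ee n by rewrite /ee; field.
  have := ee0 n; lra.
have [h0 [hb0 [[i0 j0] rh0 rr0]]] := clgraph_refine (ee0 0) hq.
pose S (nr : nat * B) (p : B * B) := reach clgraph true (ee nr.1) (ee nr.1) nr.2 ->
  [/\ inverse_of p.1 p.2, reach graph true (c * (4^-1) ^+ nr.1.+1) (c * (4^-1) ^+ nr.1.+1) p.1 &
      reach clgraph true (ee nr.1.+1) (ee nr.1.+1) (p.2 * nr.2)].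
have /choice[F HF] : forall nr, exists p, S nr p.
  move=> [n r]; rewrite /S /=.
  have [hr|hr] := EM (reach clgraph true (ee n) (ee n) r); last by exists (1, 1).
  have [h [hb [ih rh rr]]] := clgraph_refine (ee0 n.+1) hr.
  by exists (h, hb) => _; split => //; apply: reach_le rh; last split.
pose r := fix r n := if n is m.+1 then (F (m, r m)).2 * r m else hb0 * q.
have rP n : reach clgraph true (ee n) (ee n) (r n).
  by elim: n => // n IH; have [] := HF (n, r n) IH.
pose h n := (F (n, r n)).1.
have hP n : reach graph true (c * (4^-1) ^+ n.+1) (c * (4^-1) ^+ n.+1) (h n).
  by have [] := HF (n, r n) (rP n).
have /choice[X HX] : forall n, exists X : (R -> B) * (R -> B) * (R -> L) * (R -> B),
  flat_path graph true (c * (4^-1) ^+ n.+1) (c * (4^-1) ^+ n.+1) (h n) X.1.1.1 X.1.1.2 X.1.2 X.2.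
  by move=> n; have [k [kb [w [z Hz]]]] := hP n; exists (k, kb, w, z).
have [Q HQ rQ] := infinite_product graph_lin c2 HX.
have prodE n : hb0 * q = prodQ h n * r n.
  elim: n => [|n IH] /=; first by rewrite bmul1l.
  have [[i j] _ _] := HF (n, r n) (rP n).
  by rewrite bmulA -[prodQ h n * h n * _]bmulA i bmul1r.
(* The remainders tend to 1 since their speeds ee n tend to 0 in the operator norm
   too. *)
have QE : hb0 * q = Q.
  apply: seq_lim_unique HQ => d d0.
  have [N HN] := half_pow_small (e := d / 4) (ltac:(by rewrite divr_gt0)).
  exists N => n Nn.
  have [q2 _] := reach_small c2 (prodQ_flat graph_lin HX n).
  have en : ee n <= 2^-1 ^+ n.
    have h1 : (2^-1 : R) ^+ n.+1 <= 1 by rewrite exprn_ile1 ?invr_ge0 // invf_le1 // ler1n.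
    have h3 : 0 <= (2^-1 : R) ^+ n.+1 by rewrite exprn_ge0 // invr_ge0.
    have h4 : 2^-1 ^+ n.+1 = 2^-1 * 2^-1 ^+ n :> R by rewrite exprS.
    have h5 : c * (2^-1 ^+ n.+1 * 2^-1 ^+ n.+1) <= 1 * (1 * 2^-1 ^+ n.+1).
      rewrite ler_pM ?mulr_ge0 // ?(ltW c0) //; last by rewrite ler_pM.
      by rewrite (le_trans c2) // invf_le1 // ler1n.
    rewrite /ee quarter_pow; lra.
  have en2 : ee n <= 2^-1.
    by have := eeS n; have := ee0 n; have := ee0 n.+1; have h1 : (4^-1 : R) ^+ n.+1 <= 1 by [rewrite exprn_ile1 ?invr_ge0 // invf_le1 // ler1n]; have : c * 4^-1 ^+ n.+1 <= c by [rewrite ler_piMr // ltW]; move: c2; lra.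
  have [_ r1] := reach_small en2 (rP n).
  have hn := HN n Nn.
  have -> : prodQ h n - hb0 * q = - (prodQ h n * (r n - 1)).
    by rewrite (prodE n) bmulBr bmul1r; lmod R.
  rewrite normrN (le_trans (bop_normM _ _)) //.
  have -> : d = 2 * (2 * (d / 4)) by field.
  by rewrite ler_pM // (le_trans r1) // ler_wpM2l // (le_trans en).
have -> : q = h0 * Q by rewrite -QE bmulA i0 bmul1l.
have [a0 _] := reach_ge0 hq.
have eec : ee 0 <= c.
  rewrite /ee expr1 ler_pdivrMr // ler_wpM2l ?(ltW c0) //; lra.
have A0 : 0 < 2 * a + ee 0 by rewrite ltr_wpDl ?mulr_ge0.
by apply: reach_le (reach_add graph_lin (reach_forget rh0) (reach_forget rQ) A0 c0) => //; lra.
Qed.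

(** By Baire's theorem one of the closures of the sets S n contains a ball around some
    x0. Differences of points of S n then approximate all points of a ball around 0, and
    scaling gives the rest. This is the approximation step in the proof of the open
    mapping theorem. *)
Lemma baire_approximation : exists K : R, 0 <= K /\ forall (w : L) (d : R), 0 < d ->
  exists2 x, `|x - w| <= d & `|T x| <= K * `|w|.
Proof.
pose S (n : nat) := [set x : L | `|T x| <= n%:R].
pose D n : set L := ~` (closure (S n)).
have Dopen n : open (D n) by apply: closed_openC; exact: closed_closure.
have : exists n, ~ dense (D n).
  apply: contrapT => /forallNP dn.
  have dD n : dense (D n) by exact: contrapT (dn n).
  have := Baire (fun n => conj (Dopen n) (dD n)).
  move=> /(_ setT (ltac:(by exists 0)) openT) [x [_ Dx]].
  have [n Hn] : exists n : nat, `|T x| <= n%:R.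
    exists (Num.truncn `|T x|).+1; apply: ltW.
    by have /truncn_itv/andP[] := normr_ge0 (T x).
  have := Dx n I; apply; exact: (@subset_closure _ (S n)).
move=> [n /existsNP[U /not_implyP[Un0 /not_implyP[oU UD]]]].
have {UD} Osub x : U x -> closure (S n) x.
  by move=> Ux; apply: contrapT => nx; apply: UD; exists x.
have [x0 Ox0] := Un0.
have [r r0 Hr] : exists2 r : R, 0 < r & forall y, `|y - x0| < r -> U y.
  have /nbhs_ballP[r /= r0 Hr] : nbhs x0 U by exact: open_nbhs_nbhs.
  by exists r => // y yx; apply: Hr; rewrite -ball_normE /= distrC.
have apx y (d : R) : 0 < d -> U y -> exists2 x, `|x - y| <= d & `|T x| <= n%:R.
  move=> d0 /Osub /(_ (ball y d)) [|x [Sx]]; first by apply/nbhs_ballP; exists d.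
  by rewrite -ball_normE /= distrC => /ltW; exists x.
have base w (d : R) : 0 < d -> `|w| < r -> exists2 x, `|x - w| <= d & `|T x| <= 2 * n%:R.
  move=> d0 wr; have d20 : 0 < d / 2 by rewrite divr_gt0.
  have [x x1 x2] := apx (x0 + w) _ d20 (Hr (x0 + w) (ltac:(by rewrite [x0 + w]addrC addrK))).
  have [y y1 y2] := apx x0 _ d20 Ox0.
  exists (x - y).
    have -> : x - y - w = (x - (x0 + w)) - (y - x0) by lmod R.
    by rewrite (le_trans (ler_normB _ _)) // (splitr d) lerD.
  rewrite TB (le_trans (ler_normB _ _)) //; lra.
exists (4 * n%:R / r); split; first by rewrite divr_ge0 ?mulr_ge0 // ltW.
move=> w d d0; have [->|w0] := eqVneq w 0.
  by exists 0; rewrite ?subr0 ?T0 !normr0 ?mulr0 // ltW.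
have nw : 0 < `|w| by rewrite normr_gt0.
pose s := r / 2 / `|w|; have s0 : 0 < s by rewrite !divr_gt0.
have [|x x1 x2] := base (s *: w) (s * d) (mulr_gt0 s0 d0).
  by rewrite normrZ gtr0_norm // /s divfK ?lt0r_neq0 //; lra.
exists (s^-1 *: x).
  have -> : s^-1 *: x - w = s^-1 *: (x - s *: w).
    by rewrite scalerBr scalerA mulVf ?scale1r // lt0r_neq0.
  rewrite normrZ gtr0_norm ?invr_gt0 // -[d](mulKf (lt0r_neq0 s0)).
  by rewrite ler_wpM2l // invr_ge0 ltW.
have -> : T (s^-1 *: x) = s^-1 *: T x.
  by have := T_lin s^-1 x 0; rewrite T0 !addr0.
rewrite normrZ gtr0_norm ?invr_gt0 //.
have -> : 4 * n%:R / r * `|w| = s^-1 * (2 * n%:R).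
  by rewrite /s; field; rewrite !lt0r_neq0.
by rewrite ler_wpM2l // invr_ge0 ltW.
Qed.

(** Here x approximates w in L and satisfies the bound on T x, whereas T x need not be
    close to z. The remainder has therefore a closed-graph path of small speed, whose
    logarithmic derivative may be large in the operator norm, and [reach_clgraph_graph]
    brings it back to the graph. *)
Lemma controlled_approximation K : 0 <= K ->
  (forall (w : L) (d : R), 0 < d -> exists2 x, `|x - w| <= d & `|T x| <= K * `|w|) ->
  forall a b q e, reach graph false a b q -> 0 < e ->
  exists h hb, [/\ inverse_of h hb, reach graph true (2 * a + e) (2 * (K * a)) h &
    reach graph false e 0 (hb * q)].
Proof.
move=> K0 HK a b q e hq e0; have [a0 _] := reach_ge0 hq.
have [d0 d00 Hd] := expR_small_factor (C * (a + 1)) (ltac:(by rewrite divr_gt0) : 0 < e / 4).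
pose d := Num.min (Num.min d0 1) (e / 2).
have dp : 0 < d by rewrite !lt_min d00 ltr01 divr_gt0.
have dd0 : d <= d0 by rewrite !ge_min lexx.
have d1 : d <= 1 by rewrite !ge_min lexx !orbT.
have de : d <= e / 2 by rewrite !ge_min lexx !orbT.
have [b1 b10 [k [kb [w [z fp]]]]] := reach_bounded (reach_graph_cl hq).
have Ka : 0 <= K * a by rewrite mulr_ge0.
have b20 : 0 < b1 + K * a + 1 by rewrite ltr_wpDl // addr_ge0.
have [] := @product_approximation (fun=> True) true true a b1 (a + d) (K * a) d (b1 + K * a + 1) q k kb w z fp
  (fun _ _ _ _ => I) (addr_ge0 a0 (ltW dp)) Ka dp b20.
  move=> s _; have [x x1 x2] := HK (w s) d dp.
  have wa := fp_w fp s; have zb := fp_z fp isT s.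
  have xK : `|T x| <= K * a by rewrite (le_trans x2) // ler_wpM2l.
  exists x; split => //.
  - have -> : x = w s + (x - w s) by lmod R.
    by rewrite (le_trans (ler_normD _ _)) // lerD.
  - by rewrite distrC.
  - move=> _; rewrite (le_trans (ler_normB _ _)) //; lra.
move=> h [hb [ih _ rh _ rr]]; exists h, hb; split => //.
  by apply: reach_le rh; [|split => //]; lra.
have := reach_clgraph_graph (e := e / 2) (ltac:(by rewrite divr_gt0)) rr.
apply: reach_le => //.
have [||h1 _] := Hd (C * (a + d) * 1) (C * (a + d) * 1) d (ltac:(by rewrite (ltW dp))).
- by rewrite mulr1 ler_wpM2l // lerD2l.
- by rewrite mulr1 ler_wpM2l // lerD2l.
lra.
Qed.

(** The same argument, with x chosen among those whose exponentials have the property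
    [Q]. *)
Lemma dense_approximation (Q : B -> Prop) :
  (forall h h', Q h -> Q h' -> Q (h * h')) ->
  (forall (w : L) (d : R), 0 < d -> exists2 x, `|w - x| <= d & forall t, 0 < t <= 1 -> Q (bop_exp (T x) t)) ->
  forall a b q e, reach graph false a b q -> 0 < e ->
  exists h hb, [/\ inverse_of h hb, Q h & reach graph false e 0 (hb * q)].
Proof.
move=> Qm HQ a b q e hq e0; have [a0 _] := reach_ge0 hq.
have [d0 d00 Hd] := expR_small_factor (C * (a + 1)) (ltac:(by rewrite divr_gt0) : 0 < e / 4).
pose d := Num.min d0 1.
have dp : 0 < d by rewrite !lt_min d00 ltr01.
have dd0 : d <= d0 by rewrite !ge_min lexx.
have d1 : d <= 1 by rewrite !ge_min lexx !orbT.
have [b1 b10 [k [kb [w [z fp]]]]] := reach_bounded (reach_graph_cl hq).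
have [] := @product_approximation Q false true a b1 (a + d) 0 d 1 q k kb w z fp
  Qm (addr_ge0 a0 (ltW dp)) (lexx 0) dp ltr01.
  move=> s _; have [x x1 x2] := HQ (w s) d dp.
  exists x; split => //.
  have -> : x = w s - (w s - x) by lmod R.
  by rewrite (le_trans (ler_normB _ _)) // lerD // (fp_w fp).
move=> h [hb [ih Qh rh _ rr]]; exists h, hb; split => //.
have := reach_clgraph_graph (e := e / 2) (ltac:(by rewrite divr_gt0)) rr.
apply: reach_le => //.
have [||h1 _] := Hd (C * (a + d) * 1) (C * (a + d) * 1) d (ltac:(by rewrite (ltW dp))).
- by rewrite mulr1 ler_wpM2l // lerD2l.
- by rewrite mulr1 ler_wpM2l // lerD2l.
lra.
Qed.

End ClosedGraph.

(** * The Banach space of a Cameron-Martin inner product *)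

(** The data of g_inf, gathered to define a type of its elements. *)
Record cm_space (R : realType) (H : completeNormedModType R[i]) := CMSpace {
  cm_carrier : set (bop H);
  cm_ip : bop H -> bop H -> R[i];
  cm_sub : complex_subspace cm_carrier;
  cm_inner : hermitian_inner_product cm_carrier cm_ip;
  cm_compl : cm_complete cm_carrier cm_ip }.

Section CMNorm.
Context {R : realType} {H : completeNormedModType R[i]} (D : cm_space H).
Local Notation V := (cm_carrier D).
Local Notation ip := (cm_ip D).
Local Notation N := (cmnorm ip).

Lemma cm0 : V 0. Proof. by case: (cm_sub D). Qed.
Lemma cmZD (a : R) x y : V x -> V y -> V (a *: x + y).
Proof. by case: (cm_sub D) => _ h; exact: h. Qed.
Lemma cmZ (a : R) x : V x -> V (a *: x).
Proof. by move=> Vx; rewrite -[_ *: x]addr0; apply: cmZD => //; exact: cm0. Qed.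
Lemma cmD x y : V x -> V y -> V (x + y).
Proof. by move=> Vx Vy; rewrite -[x]scale1r; exact: cmZD. Qed.
Lemma cmB x y : V x -> V y -> V (x - y).
Proof. by move=> Vx Vy; rewrite addrC -scaleN1r; exact: cmZD. Qed.

Let r x y : R := complex.Re (ip x y).

Lemma re_ip_linear (a : R) x y z : V x -> V y -> V z -> r (a *: x + y) z = a * r x z + r y z.
Proof.
move=> Vx Vy Vz; rewrite /r (_ : a *: x = bop_cscale a%:C x) // (ip_linear (cm_inner D)) //.
by case: (ip x z) (ip y z) => [u v] [u' v'] /=; ring.
Qed.

Lemma re_ip_sym x y : V x -> V y -> r x y = r y x.
Proof.
by move=> Vx Vy; rewrite /r (ip_herm (cm_inner D) Vx Vy); case: (ip x y).
Qed.

Lemma re_ip_ge0 x : V x -> 0 <= r x x.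
Proof.
move=> Vx; have [->|x0] := eqVneq x 0.
  have := re_ip_linear (-1) cm0 cm0 cm0; rewrite scaler0 addr0 mulN1r addNr => ->; exact: lexx.
have := ip_pos (cm_inner D) Vx x0; rewrite /r; case: (ip x x) => u v.
by rewrite ltcE /= => /andP[_ /ltW].
Qed.

Lemma re_ip_eq0 x : V x -> r x x = 0 -> x = 0.
Proof.
move=> Vx r0; apply/eqP; apply: contraT => x0.
have := ip_pos (cm_inner D) Vx x0; move: r0; rewrite /r; case: (ip x x) => u v /= ->.
by rewrite ltcE /= ltxx andbF.
Qed.

Lemma re_ip_expand (t : R) x y : V x -> V y ->
  r (t *: x + y) (t *: x + y) = t * t * r x x + 2 * t * r x y + r y y.
Proof.
move=> Vx Vy; have Vtx : V (t *: x + y) by exact: cmZD.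
rewrite re_ip_linear // re_ip_sym // re_ip_linear // [r y (_ + _)]re_ip_sym // re_ip_linear // (re_ip_sym Vy Vx); ring.
Qed.

(** The expansion of the squared norm of t x + y is nonnegative at t = - Re (x, y) / (x,
    x). *)
Lemma cauchy_schwarz x y : V x -> V y -> r x y ^+ 2 <= r x x * r y y.
Proof.
move=> Vx Vy; have [x0|x0] := eqVneq (r x x) 0.
  rewrite x0 mul0r (re_ip_eq0 Vx x0).
  have -> : r 0 y = 0 by have := re_ip_linear (-1) cm0 cm0 Vy; rewrite scaler0 addr0 mulN1r addNr.
  by rewrite expr0n.
have xp : 0 < r x x by rewrite lt_neqAle eq_sym x0 re_ip_ge0.
have := re_ip_ge0 (cmZD (- r x y / r x x) Vx Vy); rewrite re_ip_expand //.
have -> : - r x y / r x x * (- r x y / r x x) * r x x + 2 * (- r x y / r x x) * r x y + r y y =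
  (r x x * r y y - r x y ^+ 2) / r x x by field.
by rewrite pmulr_lge0 ?invr_gt0 // subr_ge0.
Qed.

Lemma cmnormE x : N x = Num.sqrt (r x x). Proof. by []. Qed.

Lemma cmnormD x y : V x -> V y -> N (x + y) <= N x + N y.
Proof.
move=> Vx Vy.
have nn : 0 <= N x + N y by rewrite addr_ge0 // sqrtr_ge0.
rewrite -(ler_pXn2r (n := 2)) ?nnegrE ?sqrtr_ge0 //.
rewrite sqrrD !sqr_sqrtr ?re_ip_ge0 //; last exact: cmD.
rewrite -/(r x x) -/(r y y) -/(r (x + y) (x + y)).
have := re_ip_expand 1 Vx Vy; rewrite scale1r => ->.
have : r x y <= N x * N y.
  rewrite !cmnormE -sqrtrM ?re_ip_ge0 //; apply: (le_trans (ler_norm _)).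
  by rewrite -sqrtr_sqr ler_wsqrtr // cauchy_schwarz.
rewrite mulr2n; lra.
Qed.

Lemma cmnormZ (a : R) x : V x -> N (a *: x) = `|a| * N x.
Proof.
move=> Vx; rewrite !cmnormE -sqrtr_sqr -sqrtrM ?sqr_ge0 //.
have := re_ip_expand a Vx cm0; rewrite !addr0 => ->.
have z0 : r x 0 = 0.
  by rewrite (re_ip_sym Vx cm0); have := re_ip_linear (-1) cm0 cm0 Vx; rewrite scaler0 addr0 mulN1r addNr.
have z1 : r 0 0 = 0 by have := re_ip_linear (-1) cm0 cm0 cm0; rewrite scaler0 addr0 mulN1r addNr.
by rewrite z0 z1 mulr0 !addr0 expr2.
Qed.

Lemma cmnorm0_eq0 x : V x -> N x = 0 -> x = 0.
Proof.
move=> Vx /eqP; rewrite sqrtr_eq0 => h; apply: re_ip_eq0 => //; apply/eqP.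
by rewrite eq_le h re_ip_ge0.
Qed.

End CMNorm.

Section CMSpaceType.
Context {R : realType} {H : completeNormedModType R[i]} (D : cm_space H).

Definition cm_pred : {pred bop H} := [pred x | `[< cm_carrier D x >]].

Record cmsp := CMsp { cmval :> bop H; _ : cmval \in cm_pred }.

HB.instance Definition _ := [isSub for cmval].
HB.instance Definition _ := [Choice of cmsp by <:].

Lemma cm_predP x : reflect (cm_carrier D x) (x \in cm_pred).
Proof. exact: asboolP. Qed.

Lemma cm_pred_zmod : zmod_closed cm_pred.
Proof.
split; first by apply/cm_predP; exact: cm0.
by move=> x y /cm_predP Vx /cm_predP Vy; apply/cm_predP; exact: cmB.
Qed.

HB.instance Definition _ := GRing.isZmodClosed.Build (bop H) cm_pred cm_pred_zmod.
HB.instance Definition _ := [SubChoice_isSubZmodule of cmsp by <:].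

Lemma cmvalP (x : cmsp) : cm_carrier D (x : bop H).
Proof. by case: x => x p; apply/cm_predP. Qed.

Definition cm_of (x : bop H) (Vx : cm_carrier D x) : cmsp := CMsp (introT (cm_predP x) Vx).

Lemma cmval_inj (x y : cmsp) : (x : bop H) = y -> x = y.
Proof. exact: val_inj. Qed.

Definition cm_scale (a : R) (x : cmsp) : cmsp := cm_of (cmZ a (cmvalP x)).

Lemma cm_scaleA (a b : R) (x : cmsp) : cm_scale a (cm_scale b x) = cm_scale (a * b) x.
Proof. by apply: cmval_inj => /=; rewrite scalerA. Qed.
Lemma cm_scale1 : left_id 1 cm_scale.
Proof. by move=> x; apply: cmval_inj => /=; rewrite scale1r. Qed.
Lemma cm_scaleDr : right_distributive cm_scale +%R.
Proof. by move=> a x y; apply: cmval_inj; rewrite /= scalerDr. Qed.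
Lemma cm_scaleDl (x : cmsp) : {morph cm_scale^~ x : a b / a + b}.
Proof. by move=> a b; apply: cmval_inj; rewrite /= scalerDl. Qed.

HB.instance Definition _ := GRing.Zmodule_isLmodule.Build R cmsp
  cm_scaleA cm_scale1 cm_scaleDr cm_scaleDl.

Definition cmsp_norm (x : cmsp) : R := cmnorm (cm_ip D) x.

Lemma cmsp_normD (x y : cmsp) : cmsp_norm (x + y) <= cmsp_norm x + cmsp_norm y.
Proof. exact: cmnormD (cmvalP x) (cmvalP y). Qed.
Lemma cmsp_normZ (a : R) (x : cmsp) : cmsp_norm (a *: x) = `|a| * cmsp_norm x.
Proof. exact: cmnormZ (cmvalP x). Qed.
Lemma cmsp_norm0 (x : cmsp) : cmsp_norm x = 0 -> x = 0.
Proof. by move=> h; apply: cmval_inj; exact: cmnorm0_eq0 (cmvalP x) h. Qed.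

HB.instance Definition _ := Lmodule_isNormed.Build R cmsp cmsp_normD cmsp_normZ cmsp_norm0.

Lemma cmsp_normE (x : cmsp) : `|x| = cmnorm (cm_ip D) x. Proof. by []. Qed.

Lemma cmsp_complete_seq (u : nat -> cmsp) :
  (forall e : R, 0 < e -> exists N, forall m n,
      (N <= m)%N -> (N <= n)%N -> `|u m - u n| <= e) -> exists l, seq_lim u l.
Proof.
move=> cu.
have [|x Vx ux] := cm_compl (u := fun n => u n : bop H) (fun n => cmvalP (u n)).
  move=> e e0; have [N HN] := cu (e / 2) (ltac:(by rewrite divr_gt0)).
  exists N => m n Nm Nn; apply: (@le_lt_trans _ _ (e / 2)); last lra.
  exact: HN.
exists (cm_of Vx) => e e0.
have /cvgrPdist_le/(_ e e0)[N _ HN] := ux.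
exists N => n Nn; have := HN n Nn; rewrite sub0r normrN; apply: le_trans.
exact: ler_norm.
Qed.

HB.instance Definition _ := Uniform_isComplete.Build cmsp
  (complete_of_cauchy_seq cmsp_complete_seq).

Lemma cmval_lin (a : R) (x y : cmsp) : cmval (a *: x + y) = a *: cmval x + cmval y.
Proof. by []. Qed.

End CMSpaceType.

(** * Cameron-Martin paths *)

Section WithinLimits.
Context {R : realType}.

Lemma within_cvg0 (A : set R) (s : R) (h : R -> R) :
  h r @[r --> within A (nbhs s)] --> (0 : R) <->
  forall e : R, 0 < e -> exists2 d : R, 0 < d & forall r, A r -> `|r - s| < d -> `|h r| <= e.
Proof.
split=> [/cvgrPdist_le hc e e0|hc].
  have /nbhs_ballP[d /= d0 Hd] := hc e e0; exists d => // r Ar rs.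
  have := Hd r; rewrite -ball_normE /= distrC => /(_ rs Ar).
  by rewrite sub0r normrN.
apply/cvgrPdist_le => e e0; have [d d0 Hd] := hc e e0.
apply/nbhs_ballP; exists d => // r; rewrite -ball_normE /= distrC => rs Ar.
by rewrite sub0r normrN Hd.
Qed.

Lemma within_continuousP (V : normedModType R) (a b : R) (f : R -> V) :
  {within `[a, b], continuous f} <-> forall s, a <= s <= b -> cont_in `[a, b]%classic f s.
Proof.
rewrite subspace_continuousP; split=> h s sab.
  have sab' : `[a, b]%classic s by rewrite /= in_itv.
  move=> e e0; have /cvgrPdist_le/(_ e e0)/nbhs_ballP[d /= d0 Hd] := h s sab'.
  exists d => // r Ar rs; rewrite distrC.
  by apply: (Hd r) => //; rewrite -ball_normE /= distrC.
move: (sab); rewrite /= in_itv => /= sab'.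
apply/cvgrPdist_le => e e0; have [d d0 Hd] := h s sab' e e0.
apply/nbhs_ballP; exists d => // r; rewrite -ball_normE /= distrC => rs Ar.
by rewrite distrC Hd.
Qed.

Lemma path_derivativeP (H : completeNormedModType R[i]) (g dg : R -> bop H) :
  path_derivative g dg <-> forall s, 0 <= s <= 1 -> der_in `[0, 1]%classic g s (dg s).
Proof.
have key (s r : R) (v : bop H) (e : R) : r != s ->
    (`|dg s - (r - s)^-1 *: (g r - g s)| <= e) = (`|g r - g s - (r - s) *: dg s| <= e * `|r - s|).
  move=> rs; have rs0 : r - s != 0 by rewrite subr_eq0.
  have -> : g r - g s - (r - s) *: dg s = - ((r - s) *: (dg s - (r - s)^-1 *: (g r - g s))).
    by rewrite scalerBr scalerA mulfV // scale1r; lmod R.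
  by rewrite normrN normrZ mulrC ler_pM2r // normr_gt0.
split=> [h s s01|h s].
  have s01' : s \in `[0, 1] by rewrite in_itv.
  move=> e e0; have /cvgrPdist_le/(_ e e0)/nbhs_ballP[d /= d0 Hd] := h s s01'.
  exists d => // r Ar rs.
  have [->|rs0] := eqVneq r s; first by rewrite !subrr scale0r subrr !normr0 mulr0.
  rewrite -(key s r (dg s)) //; apply: Hd => //.
  by rewrite -ball_normE /= distrC.
rewrite in_itv /= => s01; apply/cvgrPdist_le => e e0; have [d d0 Hd] := h s s01 e e0.
apply/nbhs_ballP; exists d => // r; rewrite -ball_normE /= distrC => rs rs0 Ar.
by rewrite (key s r (dg s)) // Hd.
Qed.

(** Each integral is the supremum of those of the simple functions below the
    integrand. *)
Lemma integral_mono (A : set R) (f1 f2 : R -> \bar R) :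
  (forall s, A s -> 0 <= f1 s)%E -> (forall s, A s -> f1 s <= f2 s)%E ->
  (\int[lebesgue_measure]_(s in A) f1 s <= \int[lebesgue_measure]_(s in A) f2 s)%E.
Proof.
move=> f10 f12; have f20 s : A s -> (0 <= f2 s)%E.
  by move=> As; apply: le_trans (f12 s As); exact: f10.
rewrite !ge0_integralE //; apply: ereal_sup_le => _ [h /= hf <-]; exists h => //= x.
by apply: le_trans (hf x) _; exact: lee_restrict.
Qed.

End WithinLimits.

Section CMPaths.
Context {R : realType} {H : completeNormedModType R[i]} (D : cm_space H).
Local Notation B := (bop H).
Local Notation V := (cm_carrier D).
Local Notation N := (cmnorm (cm_ip D)).
Local Notation T := (@cmval R H D).

Lemma bop_invE (x y : B) : x * y = 1 -> y * x = 1 -> bop_inv x = y.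
Proof.
move=> xy yx; rewrite /bop_inv.
case: xgetP => [z _ [xz zx]|/(_ y)]; last by case.
by rewrite -[z]bmul1l -yx -bmulA xz bmul1r.
Qed.

Lemma GL_inv (x : B) : GL x -> x * bop_inv x = 1 /\ bop_inv x * x = 1.
Proof. by move=> [y [xy yx]]; rewrite (bop_invE xy yx). Qed.

(** The length of a path is at most its speed, since time runs over [0, 1]. *)
Lemma reach_cm_dist o a b (x xb q : B) : inverse_of x xb -> reach (graph T) o a b q ->
  (cm_dist V (cm_ip D) x (x * q)%R <= a%:E)%E.
Proof.
move=> [xxb xbx] [k [kb [w [z [f1 f2 f3 f4 f5 f6 f7 f8 f9]]]]].
pose g r := x * k r; pose gb r := kb r * xb; pose dg r := x * (k r * z r).
have gI r : g r * gb r = 1 /\ gb r * g r = 1.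
  have [e1 e2] := f1 r; split.
    by rewrite /g /gb bmulA -[x * k r * _]bmulA e1 bmul1r.
  by rewrite /g /gb bmulA -[kb r * xb * _]bmulA xbx bmul1r.
have ld r : log_derivative g dg r = z r.
  rewrite /log_derivative; have [e1 e2] := gI r; rewrite (bop_invE e1 e2).
  have -> : dg r = g r * z r by rewrite /dg /g bmulA.
  by rewrite bmulA e2 bmul1l.
have dgd S r : der_in S g r (dg r).
  by have := der_inM (der_in_cst S x r) (der_in_sub (fun _ _ => I) (f2 r)); rewrite bmul0l add0r.
have cdg S r : cont_in S dg r.
  apply: cont_inM; first exact: cont_in_cst.
  by apply: cont_inM; [exact: der_in_cont (der_in_sub (fun _ _ => I) (f2 r))|exact: cont_in_sub (fun _ _ => I) (f4 r)].
have [k0 _ _] := f8 0 (lexx _); have [k1 _ _] := f9 1 (lexx _).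
have pw0 (W : set B) (n : B -> R) (f : R -> B) : (forall s, W (f s)) ->
    continuous_on n [set` `[0, 1]] f -> piecewise_continuous W n f.
  move=> Wf cf; exists [:: 1]; split => //=; first by rewrite ltr01.
  by move=> [|//] _ /=; exists f.
have CM : C1CM V (cm_ip D) g dg.
  split.
  - by move=> s _; have [e1 e2] := gI s; exists (gb s).
  - by apply/within_continuousP => s _; exact: der_in_cont (dgd _ s).
  - by apply/path_derivativeP => s _; exact: dgd.
  - apply: pw0 => // s _; apply/within_cvg0 => e e0.
    have [d d0 Hd] := cdg setT s e e0; exists d => // r _ rs.
    by rewrite normr_id; exact: Hd.
  - by move=> s _; rewrite ld f5; exact: cmvalP.
  - apply: pw0; first by move=> s; rewrite ld f5; exact: cmvalP.
    move=> s _; apply/within_cvg0 => e e0.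
    have [d d0 Hd] := f3 s e e0; exists d => // r _ rs.
    by rewrite !ld !f5 ger0_norm ?sqrtr_ge0 //; exact: Hd.
apply: (@le_trans _ _ (cm_length (cm_ip D) g dg)).
  apply: ereal_inf_lbound; exists g, dg; split => //.
    by rewrite /g k0 bmul1r.
  by rewrite /g k1.
rewrite /cm_length.
apply: (@le_trans _ _ (\int[lebesgue_measure]_(s in `[0%R, 1%R]) (cst a%:E) s)%E).
  apply: integral_mono => s _; first by rewrite lee_fin sqrtr_ge0.
  by rewrite lee_fin ld f5; exact: f6.
by rewrite integral_cst //= lebesgue_measure_itv /= lte01 oppr0 adde0 mule1.
Qed.

Definition piece (W : set B) (n : B -> R) (f : R -> B) (u v : R) := exists F : R -> B,
  [/\ forall s, u <= s <= v -> W (F s),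
      forall s, u <= s <= v -> forall e : R, 0 < e ->
        exists2 d : R, 0 < d & forall r, u <= r <= v -> `|r - s| < d -> `|n (F r - F s)| <= e &
      forall s, u < s < v -> f s = F s].

Lemma piece_sub W n f u v u' v' : u <= u' -> v' <= v -> piece W n f u v -> piece W n f u' v'.
Proof.
move=> uu vv [F [F1 F2 F3]]; exists F.
have i s : u' <= s <= v' -> u <= s <= v.
  by move=> /andP[h1 h2]; rewrite (le_trans uu) //= (le_trans h2).
split.
- by move=> s /i; exact: F1.
- by move=> s /i h e /(F2 s h)[d d0 Hd]; exists d => // r /i; exact: Hd.
- by move=> s /andP[h1 h2]; apply: F3; rewrite (le_lt_trans uu) //= (lt_le_trans h2).
Qed.

(** In this form the pieces of a subdivision can be used by [local_to_global]. *)
Lemma pieces_local W n f a t : path <%R a t ->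
  (forall i, (i < size t)%N -> piece W n f (nth 0 (a :: t) i) (nth 0 t i)) ->
  (forall s, a <= s < last a t -> exists2 e : R, 0 < e & piece W n f s (s + e)) /\
  (forall s, a < s <= last a t -> exists2 e : R, 0 < e & piece W n f (s - e) s).
Proof.
elim: t a => [|t1 t IH] a /=; first by move=> _ _; split=> s; lra.
move=> /andP[at1 pt] Hp; have p0 := Hp 0%N isT; rewrite /= in p0.
have [IHr IHl] := IH t1 pt (fun i it => Hp i.+1 it).
split=> s /andP[s1 s2].
  have [st|ts] := ltP s t1; last by apply: IHr; rewrite ts.
  exists (t1 - s); first by rewrite subr_gt0.
  by apply: piece_sub p0 => //; rewrite addrC subrK.
have [st|ts] := leP s t1; last by apply: IHl; rewrite ts.
exists (s - a); first by rewrite subr_gt0.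
by apply: piece_sub p0 => //; rewrite opprB addrC subrK.
Qed.

Lemma pw_local W n f : piecewise_continuous W n f ->
  (forall s, 0 <= s < 1 -> exists2 e : R, 0 < e & piece W n f s (s + e)) /\
  (forall s, 0 < s <= 1 -> exists2 e : R, 0 < e & piece W n f (s - e) s).
Proof.
move=> [t [pt lt Hp]].
rewrite -lt; apply: pieces_local => // i it; have [F [F1 F2 F3]] := Hp i it.
exists F; split.
- by move=> s h; apply: F1; rewrite in_itv.
- move=> s h e e0; have h' : [set` `[nth 0 (0 :: t) i, nth 0 t i]] s by rewrite /= in_itv.
  have /within_cvg0/(_ e e0)[d d0 Hd] := F2 s h'.
  by exists d => // r hr; apply: Hd; rewrite /= in_itv.
- by move=> s h; apply: F3; rewrite in_itv.
Qed.

(** The number I is a lower bound of the integral of f over ]s, t[, witnessed by a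
    measurable function below f. Witnesses on consecutive intervals add up to a witness
    on their union. *)
Definition step_below (f : R -> R) (s t I : R) := exists h : R -> \bar R,
  [/\ measurable_fun setT h, forall r, (0 <= h r)%E,
      forall r, ~ (s < r < t) -> h r = 0%E, forall r, s < r < t -> (h r <= (f r)%:E)%E &
      (\int[lebesgue_measure]_r h r = I%:E)%E].

Lemma step_below_cst f s t c : s < t -> 0 <= c -> (forall r, s < r < t -> c <= f r) ->
  step_below f s t (c * (t - s)).
Proof.
move=> st c0 cf; exists ((cst c%:E) \_ `]s, t[%classic).
have mI : measurable (`]s, t[%classic : set R) by exact: measurable_itv.
split.
- by apply/(measurable_restrictT _ mI).
- by apply: erestrict_ge0 => r _; rewrite lee_fin.
- by move=> r nr; rewrite patchN // notin_setE /= in_itv.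
- by move=> r rst; rewrite patchT ?inE /= ?in_itv //= lee_fin cf.
- by rewrite -integral_mkcond integral_cst //= lebesgue_measure_itv /= lte_fin st -EFinD -EFinM.
Qed.

Lemma step_below_cat f s t u I J : s < t -> t < u -> (forall r, 0 <= f r) ->
  step_below f s t I -> step_below f t u J -> step_below f s u (I + J).
Proof.
move=> st tu f0 [h [h1 h2 h3 h4 h5]] [k [k1 k2 k3 k4 k5]].
exists (fun r => h r + k r)%E; split.
- exact: emeasurable_funD.
- by move=> r; rewrite adde_ge0.
- by move=> r nr; rewrite h3 ?k3 ?adde0 //; move=> /andP[a b]; apply: nr; rewrite ?a ?b ?(lt_trans st) ?(lt_trans b).
- move=> r /andP[sr ru]; have [rt|tr|->] := ltgtP r t.
  + by rewrite k3 ?adde0 ?h4 ?sr //; rewrite ltNge (ltW rt).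
  + by rewrite h3 ?add0e ?k4 ?tr //; rewrite [r < t]ltNge (ltW tr) andbF.
  + by rewrite h3 ?k3 ?adde0 ?lee_fin // ltxx ?andbF.
- by rewrite ge0_integralD // h5 k5 EFinD.
Qed.

(** On each side of a point, |g^-1 g'| stays within de / 4 of a constant on a short
    interval, and this piece of path then has speed 2 (I + de (t - s)), where I is that
    constant less the error, times the length of the interval, hence a lower bound of
    the integral. Both I and the speed are additive on concatenations; de is finally
    taken to be the gap between the length of g and l. *)
Lemma C1CM_reach g dg (l : R) : C1CM V (cm_ip D) g dg -> (cm_length (cm_ip D) g dg < l%:E)%E ->
  reach (graph T) false (2 * l) 0 (bop_inv (g 0) * g 1).
Proof.
move=> [c1 c2 c3 c4 c5 c6] lr.
pose f s := N (log_derivative g dg s).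
have f0 s : 0 <= f s by exact: sqrtr_ge0.
have gI s : 0 <= s <= 1 -> g s * bop_inv (g s) = 1 /\ bop_inv (g s) * g s = 1.
  by move=> s01; apply: GL_inv; apply: c1; rewrite in_itv.
have dgd : forall s, 0 <= s <= 1 -> der_in `[0, 1]%classic g s (dg s) by apply/path_derivativeP.
have [pr pl] := pw_local c4; have [qr ql] := pw_local c6.
have key (de : R) : 0 < de -> exists I, step_below f 0 1 I /\
    reach (graph T) false (2 * (I + de * (1 - 0))) 0 (bop_inv (g 0) * g 1).
  move=> de0.
  suff: exists I, [/\ 0 <= I, step_below f 0 1 I & reach (graph T) false (2 * (I + de * (1 - 0))) 0 (bop_inv (g 0) * g 1)].
    by move=> [I [_ h1 h2]]; exists I.
  apply: (local_to_global (P := fun s t => exists I, [/\ 0 <= I, step_below f s t I &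
     reach (graph T) false (2 * (I + de * (t - s))) 0 (bop_inv (g s) * g t)])) => //.
    move=> s t u s0 st tu u1 [I [I0 I1 I2]] [J [J0 J1 J2]]; exists (I + J); split.
    - exact: addr_ge0.
    - exact: step_below_cat I1 J1.
    - have -> : bop_inv (g s) * g u = (bop_inv (g s) * g t) * (bop_inv (g t) * g u).
        have [e1 _] := gI t (ltac:(by rewrite (le_trans s0 (ltW st)) (le_trans (ltW tu) u1))).
        by rewrite !bmulA -[_ * g t * bop_inv (g t)]bmulA e1 bmul1r.
      have st0 : 0 < t - s by rewrite subr_gt0.
      have tu0 : 0 < u - t by rewrite subr_gt0.
      pose A1 := I + de * (t - s); pose A2 := J + de * (u - t).
      have A10 : 0 < A1 by rewrite ltr_wpDl // mulr_gt0.
      have A20 : 0 < A2 by rewrite ltr_wpDl // mulr_gt0.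
      have -> : 2 * (I + J + de * (u - s)) = 2 * A1 + 2 * A2 by rewrite /A1 /A2; ring.
      by apply: reach_add I2 J2 _ _; rewrite ?mulr_gt0 //; exact: graph_lin (@cmval_lin R H D).
  (* On an interval around s where |F r - F s| is at most de / 4, the speed |g^-1 g'| lies
     between c and c + de. *)
  have loc s u v : 0 <= s <= 1 -> 0 <= u -> u < v -> v <= 1 -> u <= s <= v ->
      piece setT Num.norm dg u v -> forall F : R -> B,
      (forall r, u <= r <= v -> V (F r)) ->
      (forall r, u <= r <= v -> forall e : R, 0 < e ->
        exists2 d : R, 0 < d & forall r', u <= r' <= v -> `|r' - r| < d -> `|N (F r' - F r)| <= e) ->
      (forall r, u < r < v -> log_derivative g dg r = F r) ->
      (forall r, u <= r <= v -> `|N (F r - F s)| <= de / 4) ->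
      exists I, [/\ 0 <= I, step_below f u v I &
       reach (graph T) false (2 * (I + de * (v - u))) 0 (bop_inv (g u) * g v)].
    move=> s01 u0 uv v1 suv [F2 [_ F22 F23]] F F1 Fc Fe Fs.
    have uv01 r : u <= r <= v -> 0 <= r <= 1.
      by move=> /andP[h1 h2]; rewrite (le_trans u0) //= (le_trans h2).
    pose w1 r : cmsp D := insubd 0 (F r).
    have w1E r : u <= r <= v -> (w1 r : B) = F r.
      by move=> h; rewrite /w1 insubdK //; apply/cm_predP; exact: F1.
    have cw r : u <= r <= v -> cont_in `[u, v]%classic w1 r.
      move=> h e e0; have [d d0 Hd] := Fc r h e e0; exists d => // r'; rewrite /= in_itv /= => h' rr.
      rewrite cmsp_normE; have -> : (w1 r' - w1 r : cmsp D) = F r' - F r :> B by rewrite -(w1E r' h') -(w1E r h).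
      by apply: le_trans (Hd r' h' rr); exact: ler_norm.
    have near r : u <= r <= v -> `| `|w1 r| - `|w1 s| | <= de / 4.
      move=> h; apply: (le_trans (ler_dist_dist _ _)).
      rewrite cmsp_normE; have -> : (w1 r - w1 s : cmsp D) = F r - F s :> B by rewrite -(w1E r h) -(w1E s suv).
      by apply: le_trans (Fs r h); exact: ler_norm.
    pose A := `|w1 s| + de / 4.
    pose c := Num.max 0 (`|w1 s| - de / 4).
    have c0 : 0 <= c by rewrite le_max lexx.
    have cc : `|w1 s| - de / 4 <= c by rewrite le_max lexx orbT.
    have inn r : u < r < v -> u <= r <= v by move=> /andP[h1 h2]; rewrite !ltW.
    have fE r : u < r < v -> f r = `|w1 r|.
      by move=> h; rewrite /f Fe // cmsp_normE w1E // inn.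
    exists (c * (v - u)); split.
    - by rewrite mulr_ge0 // subr_ge0 ltW.
    - apply: step_below_cst => // r h; rewrite fE // ge_max normr_ge0 /=.
      by have := near r (inn r h); rewrite ler_norml; lra.
    - have [h1 h2] : inverse_of (g u) (bop_inv (g u)).
        by apply: gI; apply: uv01; rewrite lexx ltW.
      have key : reach (graph T) false (2 * (v - u) * A) (2 * (v - u) * 0) (bop_inv (g u) * g v).
        apply: (reach_reparam (w1 := w1) (z := log_derivative g dg) (kb := fun r => bop_inv (g r))
          (z1 := fun r => bop_inv (g r) * F2 r) (graph_lin (@cmval_lin R H D)) uv).
        + by move=> r /uv01; exact: gI.
        + move=> r h; have h01 := uv01 r h; have [e1 _] := gI r h01.
          rewrite /log_derivative bmulA e1 bmul1l.
          apply: der_in_sub (dgd r h01) => r'; rewrite /= !in_itv /=; exact: uv01.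
        + exact: cw.
        + move=> r h; apply: cont_inM.
            apply: (cont_in_inv (k := g)).
            * by rewrite /= in_itv.
            * by move=> r'; rewrite /= in_itv /= => /uv01; exact: gI.
            * have := der_in_cont (dgd r (uv01 r h)); apply: cont_in_sub => r'.
              by rewrite /= !in_itv /=; exact: uv01.
          move=> e e0; have [d d0 Hd] := F22 r h e e0; exists d => // r'.
          rewrite /= in_itv /= => h' rr.
          by apply: le_trans (Hd r' h' rr); rewrite normr_id.
        + move=> r h; have h' := inn r h; split => //.
          * by rewrite /log_derivative F23.
          * by rewrite /graph w1E // -Fe // /log_derivative F23.
          * by have := near r h'; rewrite ler_norml /A; lra.
      apply: (reach_le _ _ key) => //.
      have -> : 2 * (c * (v - u) + de * (v - u)) = 2 * (v - u) * (c + de) by ring.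
      by rewrite ler_wpM2l ?mulr_ge0 ?subr_ge0 ?(ltW uv) // /A; lra.
  have near_s s U W : 0 <= s <= 1 -> U <= s <= W ->
      piece setT Num.norm dg U W -> piece V N (log_derivative g dg) U W ->
      exists2 e : R, 0 < e & forall u v, 0 <= u -> u < v -> v <= 1 -> u <= s <= v ->
        U <= u -> v <= W -> v - u < e -> exists I, [/\ 0 <= I, step_below f u v I &
          reach (graph T) false (2 * (I + de * (v - u))) 0 (bop_inv (g u) * g v)].
    move=> s01 sUW pdg [F [Q1 Q2 Q3]].
    have [d d0 Hd] := Q2 s sUW (de / 4) (ltac:(by rewrite divr_gt0)).
    exists d => // u v u0 uv v1 suv Uu vW uvd.
    have sub r : u <= r <= v -> U <= r <= W.
      by move=> /andP[h1 h2]; rewrite (le_trans Uu) //= (le_trans h2).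
    apply: (loc s u v s01 u0 uv v1 suv (piece_sub Uu vW pdg) F).
    - by move=> r /sub; exact: Q1.
    - move=> r /sub h e e0; have [d' d'0 Hd'] := Q2 r h e e0.
      by exists d' => // r' /sub; exact: Hd'.
    - by move=> r /andP[h1 h2]; apply: Q3; rewrite (le_lt_trans Uu) //= (lt_le_trans h2).
    - move=> r h; apply: Hd; first exact: sub.
      by move: h suv => /andP[h1 h2] /andP[h3 h4]; rewrite ltr_norml; lra.
  move=> s s01; have /andP[s0 s1] := s01.
  have exr : exists2 e : R, 0 < e & forall t, s < t < s + e -> t <= 1 -> exists I, [/\ 0 <= I, step_below f s t I &
     reach (graph T) false (2 * (I + de * (t - s))) 0 (bop_inv (g s) * g t)].
    have [ss|ss] := ltP s 1; last by exists 1 => // t; lra.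
    have [e1 e10 P1] := pr s (ltac:(by rewrite s0)); have [e2 e20 P2] := qr s (ltac:(by rewrite s0)).
    pose m := Num.min e1 e2; have m0 : 0 < m by rewrite lt_min e10.
    have [|||e e0 He] := near_s s s (s + m) s01.
    - by rewrite lexx lerDl ltW.
    - by apply: piece_sub P1 => //; rewrite lerD2l ge_min lexx.
    - by apply: piece_sub P2 => //; rewrite lerD2l ge_min lexx orbT.
    exists (Num.min m e); first by rewrite lt_min m0.
    move=> t /andP[st]; rewrite -ltrBlDl lt_min => /andP[tm te] t1.
    by apply: He; rewrite ?lexx ?(ltW st) //; lra.
  have exl : exists2 e : R, 0 < e & forall t, s - e < t < s -> 0 <= t -> exists I, [/\ 0 <= I, step_below f t s I &
     reach (graph T) false (2 * (I + de * (s - t))) 0 (bop_inv (g t) * g s)].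
    have [ss|ss] := ltP 0 s; last by exists 1 => // t; lra.
    have [e1 e10 P1] := pl s (ltac:(by rewrite ss)); have [e2 e20 P2] := ql s (ltac:(by rewrite ss)).
    pose m := Num.min e1 e2; have m0 : 0 < m by rewrite lt_min e10.
    have [|||e e0 He] := near_s s (s - m) s s01.
    - by rewrite lexx gerBl ltW.
    - by apply: piece_sub P1 => //; rewrite lerB // ge_min lexx.
    - by apply: piece_sub P2 => //; rewrite lerB // ge_min lexx orbT.
    exists (Num.min m e); first by rewrite lt_min m0.
    move=> t /andP[ts st] t0; have : s - t < Num.min m e by lra.
    rewrite lt_min => /andP[tm te].
    by apply: He; rewrite ?lexx ?(ltW st) //; lra.
  have [e1 e10 H1] := exr; have [e2 e20 H2] := exl.
  exists (Num.min e1 e2); first by rewrite lt_min e10.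
  split=> t /andP[h1 h2] h3.
    by apply: H1 => //; rewrite h1 (lt_le_trans h2) // lerD2l ge_min lexx.
  by apply: H2 => //; rewrite h2 (le_lt_trans _ h1) // lerB // ge_min lexx orbT.
have [r' lr' rr'] : exists2 r' : R, (cm_length (cm_ip D) g dg <= r'%:E)%E & r' < l.
  have l0 : (0 <= cm_length (cm_ip D) g dg)%E.
    by apply: integral_ge0 => s _; rewrite lee_fin; exact: f0.
  exists (fine (cm_length (cm_ip D) g dg)); first by rewrite fineK // ge0_fin_numE // (lt_trans lr) // ltry.
  by rewrite -lte_fin fineK // ge0_fin_numE // (lt_trans lr) // ltry.
have [I [[h [h1 h2 h3 h4 h5]] hr]] := key (l - r') (ltac:(by rewrite subr_gt0)).
apply: (reach_le _ _ hr) => //.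
suff : I <= r' by lra.
rewrite -lee_fin -h5; apply: le_trans lr'.
have -> : (\int[lebesgue_measure]_s h s = \int[lebesgue_measure]_(s in `[0%R, 1%R]) h s)%E.
  rewrite [RHS]integral_mkcond; apply: eq_integral => s _.
  have [s01|s01] := boolP (0 <= s <= 1).
    by rewrite patchT // inE /= in_itv.
  rewrite patchN ?notin_setE /= ?in_itv /=; last exact/negP.
  by apply: h3 => /andP[a b]; move/negP: s01; apply; rewrite !ltW.
apply: integral_mono => // s _.
have [s01|s01] := boolP (0 < s < 1); first exact: h4.
by rewrite h3 ?lee_fin; [exact: f0|exact/negP].
Qed.

End CMPaths.

(** * Completeness and density *)

Section CameronMartinGroup.
Context {R : realType} {H : completeNormedModType R[i]} (D : cm_space H).
Local Notation B := (bop H).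
Local Notation L := (cmsp D).
Local Notation T := (@cmval R H D).
Local Notation V := (cm_carrier D).
Local Notation dist := (cm_dist V (cm_ip D)).
Context (br : L -> L -> L) (C : R) (C0 : 0 <= C).
Hypothesis br_lin : forall a w w' x, br (a *: w + w') x = a *: br w x + br w' x.
Hypothesis br_norm : forall w x, `|br w x| <= C * `|w| * `|x|.
Hypothesis T_br : forall w x, T (br w x) = bracket (T w) (T x).

Let T_lin := @cmval_lin R H D.
Let Glin := graph_lin T_lin.
Let Clin := clgraph_lin T_lin.

Lemma cm_dist_ge0 x y : (0 <= dist x y)%E.
Proof.
apply: le_ereal_inf_tmp => _ [g [dg [_ _ _ ->]]].
by apply: integral_ge0 => s _; rewrite lee_fin sqrtr_ge0.
Qed.

Lemma cm_dist_reach x y (l : R) : (dist x y < l%:E)%E ->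
  inverse_of x (bop_inv x) /\ reach (graph T) false (2 * l) 0 (bop_inv x * y).
Proof.
move=> /ereal_inf_lt[_ [g [dg [CM <- <- ->]]] lt]; split; last exact: C1CM_reach CM lt.
by apply: GL_inv; apply: (C1CM_GL CM); rewrite in_itv /= lexx ler01.
Qed.

Lemma reach_cm_dist' (x xb y : B) o a b : inverse_of x xb -> reach (graph T) o a b (xb * y) ->
  (dist x y <= a%:E)%E.
Proof.
move=> ix h; have := reach_cm_dist ix h.
by rewrite bmulA ix.1 bmul1l.
Qed.

Lemma G_CM_reach x : G_CM V (cm_ip D) x ->
  inverse_of x (bop_inv x) /\ exists2 a, 0 < a & reach (graph T) false a 0 x.
Proof.
rewrite /G_CM /= => h.
have [l hl l0] : exists2 l : R, (dist x 1%R < l%:E)%E & 0 < l.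
  have d0 := cm_dist_ge0 x 1; move: h d0.
  case: (dist x 1%R) => [d _ d0|//|//]; exists (d + 1); first by rewrite lte_fin ltrDl.
  by rewrite ltr_wpDl // -lee_fin.
have [ix hr] := cm_dist_reach hl; split => //.
exists (2 * l); first by rewrite mulr_gt0.
by apply: reach_inverse (inverse_sym ix) _ => //; rewrite bmul1r in hr.
Qed.

Lemma reach_G_CM o a b x : reach (graph T) o a b x -> G_CM V (cm_ip D) x.
Proof.
move=> h; have [xb [e1 e2 hb]] := reach_inv Glin h.
rewrite /G_CM /=; apply: le_lt_trans (ltry a).
by apply: (reach_cm_dist' (xb := xb) (o := o) (b := b)) => //; rewrite bmul1r.
Qed.

Lemma prodQ_shift (h : nat -> B) j i : prodQ h (i + j) = prodQ h j * prodQ (fun n => h (n + j)%N) i.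
Proof. by elim: i => [|i IH] /=; rewrite ?bmul1r // IH bmulA. Qed.

Lemma infinite_product_reach (c : R) (h : nat -> B) : c <= 2^-1 ->
  (forall n, reach (graph T) true (c * (4^-1) ^+ n.+1) (c * (4^-1) ^+ n.+1) (h n)) ->
  exists2 Q, seq_lim (prodQ h) Q & reach (graph T) true c c Q.
Proof.
move=> c2 hP.
have /choice[X HX] : forall n, exists X : (R -> B) * (R -> B) * (R -> L) * (R -> B),
  flat_path (graph T) true (c * (4^-1) ^+ n.+1) (c * (4^-1) ^+ n.+1) (h n) X.1.1.1 X.1.1.2 X.1.2 X.2.
  by move=> n; have [k [kb [w [z Hz]]]] := hP n; exists (k, kb, w, z).
by have [Q HQ rQ] := infinite_product Glin c2 HX; exists Q.
Qed.

(** Let MM j be ranks after which the terms of u are at distance less than de j, where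
    de j is a geometric sequence. Starting from v_0 = u (MM 0), elements v_j at distance
    at most de j from u (MM j) are built with increments h_j of size c / 4^(j+1) in both
    norms, by [controlled_approximation]. The limit is that of v_j = v_0 h_0 ...
    h_(j-1). *)
Lemma G_CM_complete : complete_for dist (G_CM V (cm_ip D)).
Proof.
move=> u uG cu.
have [K [K0 HK]] := baire_approximation T_lin.
have uI n : inverse_of (u n) (bop_inv (u n)) by have [] := G_CM_reach (uG n).
pose c : R := 2^-1; have c0 : 0 < c by rewrite invr_gt0.
(* The element v_j is joined to u (MM (j+1)) with speed at most 3 de j; the next factor
   then has speed 6 de j + de (j+1) in g_inf and 6 K de j in the operator norm. *)
have M0 : 0 < 7 + 6 * K by rewrite ltr_pwDl // mulr_ge0.
pose de n := c * (4^-1) ^+ n.+1 / (7 + 6 * K).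
have de0 n : 0 < de n by rewrite divr_gt0 // mulr_gt0 // quarter_gt0.
have deS n : de n.+1 <= de n.
  have -> : de n.+1 = 4^-1 * de n by rewrite /de exprS; ring.
  by rewrite ler_piMl ?(ltW (de0 n)) // invf_le1 // ler1n.
have deM n : (7 + 6 * K) * de n = c * (4^-1) ^+ n.+1 by rewrite /de mulrC divfK // lt0r_neq0.
have /choice[NN HN] : forall j, exists N, forall m n, (N <= m)%N -> (N <= n)%N -> (dist (u m) (u n) < (de j)%:E)%E.
  by move=> j; exact: cu.
pose MM j := \max_(i < j.+1) NN i.
have MMge j : (NN j <= MM j)%N by exact: (leq_bigmax (F := fun i : 'I_j.+1 => NN i) ord_max).
have MMS j : (MM j <= MM j.+1)%N.
  apply/bigmax_leqP => i _; exact: (leq_bigmax (F := fun i : 'I_j.+2 => NN i) (widen_ord (leqnSn _) i)).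
(* The pair p is a suitable increment, with its inverse, from jv = (j, v_j). *)
pose S (jv : nat * B) (p : B * B) := forall vb, inverse_of jv.2 vb ->
   reach (graph T) false (de jv.1) 0 (vb * u (MM jv.1)) ->
  [/\ inverse_of p.1 p.2, reach (graph T) true (c * (4^-1) ^+ jv.1.+1) (c * (4^-1) ^+ jv.1.+1) p.1 &
      reach (graph T) false (de jv.1.+1) 0 (p.2 * vb * u (MM jv.1.+1))].
have /choice[F HF] : forall jv, exists p, S jv p.
  move=> [j v]; rewrite /S /=.
  have [[vb iv]|nv] := EM (exists vb, inverse_of v vb); last first.
    by exists (1, 1) => vb iv; case: nv; exists vb.
  have uni vb' : inverse_of v vb' -> vb' = vb.
    by move=> iv'; rewrite (inverse_unique iv iv'.1).
  have [hr|hr] := EM (reach (graph T) false (de j) 0 (vb * u (MM j))); last first.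
    by exists (1, 1) => vb' /uni -> /hr.
  have h1 : (dist (u (MM j)) (u (MM j.+1)) < (de j)%:E)%E.
    by apply: HN => //; exact: leq_trans (MMge j) (MMS j).
  have [[_ iu] hu] := cm_dist_reach h1.
  have d20 : 0 < 2 * de j by rewrite mulr_gt0.
  have := reach_add Glin hr hu (de0 j) d20.
  rewrite bmulA -[vb * _ * bop_inv _]bmulA (uI (MM j)).1 bmul1r => hc.
  have [h [hb [ih hh hrr]]] := controlled_approximation T_lin C0 br_lin br_norm T_br K0 HK hc (de0 j.+1).
  exists (h, hb) => vb' /uni -> _; split => //=; last by rewrite -bmulA.
  have K1 : 0 <= K * de j by rewrite mulr_ge0 // ltW.
  apply: reach_le hh; last split => //; rewrite -deM; have := deS j; have := de0 j; lra.
pose v := fix v n := if n is m.+1 then v m * (F (m, v m)).1 else u (MM 0).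
pose vb := fix vb n := if n is m.+1 then (F (m, v m)).2 * vb m else bop_inv (u (MM 0)).
have vP n : inverse_of (v n) (vb n) /\ reach (graph T) false (de n) 0 (vb n * u (MM n)).
  elim: n => [|n [IH1 IH2]] /=.
    by split => //; rewrite (uI _).2; apply: reach1 => //; exact: ltW.
  by have [h1 h2 h3] := HF (n, v n) (vb n) IH1 IH2; split; [exact: inverse_mul|].
pose h n := (F (n, v n)).1.
have hP n : reach (graph T) true (c * (4^-1) ^+ n.+1) (c * (4^-1) ^+ n.+1) (h n).
  by have [IH1 IH2] := vP n; have [] := HF (n, v n) (vb n) IH1 IH2.
have vE n : v n = u (MM 0) * prodQ h n.
  by elim: n => [|n IH] /=; rewrite ?bmul1r // bmulA -IH.
have [Q HQ rQ] := infinite_product_reach (lexx _) hP.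
pose x := u (MM 0%N) * Q.
have vx j : reach (graph T) true (c * (4^-1) ^+ j) (c * (4^-1) ^+ j) (vb j * x).
  have cj : c * (4^-1) ^+ j <= 2^-1.
    by rewrite ler_piMr ?(ltW c0) // exprn_ile1 ?invr_ge0 // invf_le1 // ler1n.
  have [|Q' HQ' rQ'] := infinite_product_reach (h := fun n => h (n + j)%N) cj.
    by move=> n; have := hP (n + j)%N; rewrite -addSn exprD [4^-1 ^+ _ * _]mulrC mulrA.
  suff -> : vb j * x = Q' by [].
  have QE : Q = prodQ h j * Q'.
    apply: seq_lim_unique (seq_lim_shift j HQ) _.
    have lip : forall y z : B, `|prodQ h j * y - prodQ h j * z| <= `|prodQ h j| * `|y - z|.
      by move=> y z; rewrite -bmulBr bop_normM.
    have := seq_lim_lip lip HQ'; move=> A e /A[N HN']; exists N => n /HN'.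
    by rewrite prodQ_shift.
  by rewrite /x QE bmulA bmulA -[vb j * _ * _]bmulA -vE (vP j).1.2 bmul1l.
have xG : G_CM V (cm_ip D) x.
  have [_ [a a0 ha]] := G_CM_reach (uG (MM 0)).
  exact: reach_G_CM (reach_add Glin ha (reach_forget rQ) a0 c0).
exists x => //.
have small e : 0 < e -> exists N, forall n, (N <= n)%N -> (dist (u n) x <= e%:E)%E.
  move=> e0; have [j Hj] := half_pow_small (e := e / 2) (ltac:(by rewrite divr_gt0)).
  exists (MM j) => n Mn.
  have h1 : (dist (u n) (u (MM j)) < (de j)%:E)%E.
    by apply: HN => //; exact: leq_trans (MMge j) Mn.
  have [_ hu] := cm_dist_reach h1.
  have [iv hv] := vP j.
  have hv' := reach_inverse Glin (inverse_mul (inverse_sym iv) (uI (MM j))) hv.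
  have d20 : 0 < 2 * de j by rewrite mulr_gt0.
  have cj0 : 0 < c * (4^-1) ^+ j by rewrite mulr_gt0 // quarter_gt0.
  have := reach_add Glin (reach_add Glin hu hv' d20 (de0 j)) (reach_forget (vx j)) (addr_gt0 d20 (de0 j)) cj0.
  have -> : bop_inv (u n) * u (MM j) * (bop_inv (u (MM j)) * v j) * (vb j * x) = bop_inv (u n) * x.
    by rewrite !bmulA -[_ * u (MM j) * bop_inv _]bmulA (uI (MM j)).1 bmul1r -[_ * v j * vb j]bmulA iv.1 bmul1r.
  move=> /(reach_cm_dist' (uI n)) /le_trans; apply.
  rewrite lee_fin.
  have h2 := Hj j (leqnn j).
  have h3 : de j <= c * (4^-1) ^+ j.
    have -> : c * (4^-1) ^+ j = 4 * (c * 4^-1 ^+ j.+1) by rewrite exprS; field.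
    have : 7 * de j <= (7 + 6 * K) * de j by rewrite ler_wpM2r ?(ltW (de0 j)) // lerDl mulr_ge0.
    rewrite deM; have := de0 j; lra.
  have h4 : c * (4^-1) ^+ j <= 2^-1 * 2^-1 ^+ j.
    rewrite quarter_pow /c ler_wpM2l ?invr_ge0 // ler_piMr ?exprn_ge0 ?invr_ge0 //.
    by rewrite exprn_ile1 ?invr_ge0 // invf_le1 // ler1n.
  lra.
apply/fine_cvgP; split.
  have [N HN'] := small 1 ltr01; exists N => // n /= /HN' hn.
  by rewrite ge0_fin_numE ?cm_dist_ge0 // (le_lt_trans hn) // ltry.
apply/cvgrPdist_le => e e0; have [N HN'] := small e e0; exists N => // n /= /HN' hn.
rewrite sub0r normrN ger0_norm ?fine_ge0 ?cm_dist_ge0 // -lee_fin fineK //.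
by rewrite ge0_fin_numE ?cm_dist_ge0 // (le_lt_trans hn) // ltry.
Qed.

Section Density.
Context (G : set B).
Hypothesis GM : forall x y, G x -> G y -> G (x * y).
Hypothesis GI : forall x, G x -> exists2 xb, G xb & inverse_of x xb.
Hypothesis G_reach : forall x, G x -> exists a, reach (graph T) false a 0 x.
Context (g : set B).
Hypothesis g_dense : forall (w : L) (e : R), 0 < e -> exists2 x : L, g (x : B) & `|w - x| <= e.
(* The group G has elements that agree with exp(t x) up to o(t). *)
Hypothesis G_tangent : forall (x : L) (e : R), g (x : B) -> 0 < e ->
  exists2 t0 : R, 0 < t0 & forall t, 0 < t <= t0 ->
    exists2 y, G y & reach (clgraph T) false (t * e) 0 (bop_exp x (- t) * y).

(** With s = t / n, exp(s x) is y up to an error s d. Then exp(t x) is y^n, up to the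
    sum of n such errors, each of which is conjugated by exponentials of total duration
    at most t. *)
Lemma G_exp_approx (x : L) t (e : R) : g (x : B) -> 0 < t -> 0 < e ->
  exists2 y, G y & reach (clgraph T) false e 0 (bop_exp x (- t) * y).
Proof.
move=> gx t0 e0.
pose E s := expR (C * `|x| * s).
have E0 s : 0 < E s by exact: expR_gt0.
pose d := e / t / E t; have d0 : 0 < d by rewrite !divr_gt0.
have [t1 t10 H1] := G_tangent gx d0.
(* The number of steps is such that t / n falls below t1, where y is available. *)
pose n := (Num.truncn (t / t1)).+1.
have n0 : 0 < n%:R :> R by rewrite ltr0n.
have tn : t / n%:R <= t1.
  rewrite ler_pdivrMr // mulrC -ler_pdivrMr //; apply: ltW.
  by have /truncn_itv/andP[] : 0 <= t / t1 by rewrite divr_ge0 ?ltW.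
pose s := t / n%:R; have s0 : 0 < s by rewrite divr_gt0.
have [y Gy hy] := H1 s (ltac:(by rewrite s0)).
have step m : exists2 z, G z & reach (clgraph T) false (m.+1%:R * s * d * E (m%:R * s)) 0 (bop_exp x (- (m.+1%:R * s)) * z).
  elim: m => [|m [z Gz IH]].
    by exists y => //; rewrite /E mul0r mulr0 expR0 mulr1 !mul1r.
  exists (z * y); first exact: GM.
  have sd0 : 0 < s * d by rewrite mulr_gt0.
  have hm : 0 < E s * (m.+1%:R * s * d * E (m%:R * s)).
    have m0 : 0 < m.+1%:R :> R by rewrite ltr0n.
    by rewrite mulr_gt0 // mulr_gt0 // mulr_gt0 // mulr_gt0.
  have := reach_add Clin (reach_conj T_lin C0 br_lin br_norm T_br x (ltW s0) IH) hy hm sd0.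
  have -> : bop_exp x (- s) * (bop_exp x (- (m.+1%:R * s)) * z) * bop_exp x s * (bop_exp x (- s) * y) =
    bop_exp x (- (m.+2%:R * s)) * (z * y).
    have -> : - (m.+2%:R * s) = - s + - (m.+1%:R * s) by rewrite -[m.+2%:R]natr1; ring.
    by rewrite bop_expD !bmulA -[_ * bop_exp x s * bop_exp x (- s)]bmulA bop_expVr bmul1r.
  apply: reach_le => //.
  have EE : E s * E (m%:R * s) = E (m.+1%:R * s).
    by rewrite /E -expRD -mulrDr -[m.+1%:R]natr1; congr (expR (_ * _)); ring.
  have -> : E s * (m.+1%:R * s * d * E (m%:R * s)) = m.+1%:R * s * d * E (m.+1%:R * s) by rewrite -EE; ring.
  have E1 : 1 <= E (m.+1%:R * s).
    by rewrite -expR0 ler_expR !mulr_ge0 // ltW.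
  have -> : m.+2%:R * s * d * E (m.+1%:R * s) = m.+1%:R * s * d * E (m.+1%:R * s) + s * d * E (m.+1%:R * s).
    by rewrite -[m.+2%:R]natr1; ring.
  by rewrite lerD2l ler_peMr // ltW.
have [z Gz hz] := step n.-1; exists z => //.
have ns : n.-1.+1%:R * s = t by rewrite /s prednK // mulrC divfK // lt0r_neq0.
move: hz; rewrite ns; apply: reach_le => //.
have -> : e = t * d * E t by rewrite /d; field; rewrite !lt0r_neq0.
have td0 : 0 <= t * d by rewrite mulr_ge0 // ltW.
rewrite ler_wpM2l // /E ler_expR ler_wpM2l ?mulr_ge0 //.
by rewrite -ns ler_wpM2r ?(ltW s0) // ler_nat.
Qed.

(** The properties of exp(t x) that pass to products: conjugation by h distorts speeds
    by a bounded factor, so that an approximation of a product can be deduced from those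
    of its factors. *)
Definition approximable (h : B) :=
  (exists2 hb, inverse_of h hb & exists2 A : R, 0 < A & forall a r,
     reach (clgraph T) false a 0 r -> reach (clgraph T) false (A * a) 0 (hb * r * h)) /\
  forall e : R, 0 < e -> exists y yb, [/\ G y, inverse_of y yb & reach (clgraph T) false e 0 (yb * h)].

Lemma approximableM h h' : approximable h -> approximable h' -> approximable (h * h').
Proof.
move=> [[hb ih [A A0 HA]] happ] [[hb' ih' [A' A'0 HA']] happ']; split.
  exists (hb' * hb); first exact: inverse_mul.
  exists (A' * A); first by rewrite mulr_gt0.
  move=> a r /HA /HA'; rewrite mulrA.
  by have -> : hb' * (hb * r * h) * h' = hb' * hb * r * (h * h') by rewrite !bmulA.
move=> e e0; have [y [yb [Gy iy hy]]] := happ (e / 2 / A') (ltac:(by rewrite !divr_gt0)).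
have [y' [yb' [Gy' iy' hy']]] := happ' (e / 2) (ltac:(by rewrite divr_gt0)).
exists (y * y'), (yb' * yb); split; [exact: GM|exact: inverse_mul|].
have e2 : 0 < e / 2 by rewrite divr_gt0.
have := reach_add Clin hy' (HA' _ _ hy) e2 (ltac:(by rewrite mulr_gt0 // !divr_gt0)).
have -> : A' * (e / 2 / A') = e / 2 by rewrite mulrC divfK // lt0r_neq0.
rewrite -splitr.
suff -> : yb' * h' * (hb' * (yb * h) * h') = yb' * yb * (h * h') by [].
by rewrite !bmulA -[yb' * h' * hb']bmulA ih'.1 bmul1r.
Qed.

Lemma G_CM_dense : dense_for dist G (G_CM V (cm_ip D)).
Proof.
split; first by move=> x /G_reach[a ha]; exact: reach_G_CM ha.
move=> x xG e e0.
have [ix [a a0 ha]] := G_CM_reach xG.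
have e80 : 0 < e / 8 by rewrite divr_gt0.
have appr (w : L) (d : R) : 0 < d -> exists2 x : L, `|w - x| <= d & forall t, 0 < t <= 1 -> approximable (bop_exp x t).
  move=> d0; have [y gy wy] := g_dense w d0; exists y => // t /andP[t0 t1]; split.
    exists (bop_exp y (- t)); first by split; [exact: bop_expVr|exact: bop_expVl].
    exists (expR (C * `|y| * t)); first exact: expR_gt0.
    move=> a' r hr; apply: reach_forget.
    exact: (reach_conj T_lin C0 br_lin br_norm T_br y (ltW t0) hr).
  move=> d' d'0; have [z Gz hz] := G_exp_approx gy t0 d'0.
  have [zb _ iz] := GI Gz; exists z, zb; split => //.
  apply: (reach_inverse Clin _ hz).
  by have := inverse_mul (conj (bop_expVl y t) (bop_expVr y t)) iz.
have [h [hb [ih [_ happ] hh]]] := dense_approximation T_lin C0 br_lin br_norm T_br approximableM appr ha e80.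
have [y [yb [Gy iy hy]]] := happ _ e80.
exists y => //.
have := reach_add Glin (reach_clgraph_graph T_lin C0 br_lin br_norm T_br e80 hy) hh
  (ltac:(by rewrite addr_gt0 // mulr_gt0)) e80.
rewrite bmulA -[yb * h * hb]bmulA ih.1 bmul1r => /(reach_inverse Glin (inverse_mul (inverse_sym iy) ix)).
move=> /(reach_cm_dist' ix) /le_lt_trans; apply.
rewrite lte_fin; lra.
Qed.

End Density.
End CameronMartinGroup.

(** * Continuously differentiable maps on row vectors *)

Section DirectionalCalculus.
Context {R : realType}.
Implicit Types V W : normedModType R.

Lemma der_in_unique V (f : R -> V) s d1 d2 : der_in setT f s d1 -> der_in setT f s d2 -> d1 = d2.
Proof.
move=> h1 h2; apply/eqP; rewrite -subr_eq0 -normr_le0; apply/ler_addgt0Pr => e e0.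
have e2 : 0 < e / 2 by rewrite divr_gt0.
have [a a0 Ha] := h1 _ e2; have [b b0 Hb] := h2 _ e2.
(* Both expansions hold at s + h. *)
pose h := Num.min a b / 2; have ab0 : 0 < Num.min a b by rewrite lt_min a0.
have h0 : 0 < h by rewrite divr_gt0.
have hs : s + h - s = h by ring.
have hm : h < Num.min a b by rewrite /h; lra.
have := Ha (s + h) I; have := Hb (s + h) I; rewrite hs (gtr0_norm h0).
move: hm; rewrite lt_min => /andP[ha hb] /(_ hb) H2 /(_ ha) H1.
have E : h *: (d1 - d2) = (f (s + h) - f s - h *: d2) - (f (s + h) - f s - h *: d1) by lmod R.
rewrite add0r -(ler_pM2l h0) -[X in X * `|_|](gtr0_norm h0) -normrZ E (le_trans (ler_normB _ _)) //; lra.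
Qed.

Lemma line_der V W (f : V -> W) y v s : derivable f (y + s *: v) v ->
  der_in setT (fun r => f (y + r *: v)) s ('D_v f (y + s *: v)).
Proof.
move=> df e e0; have /cvgrPdist_le/(_ e e0)/nbhs_ballP[d /= d0 Hd] := df.
exists d => // r _ rs.
have [->|rs0] := eqVneq r s; first by rewrite !subrr scale0r subrr !normr0 mulr0.
have rs0' : r - s != 0 by rewrite subr_eq0.
have := Hd (r - s); rewrite -ball_normE /= sub0r normrN => /(_ rs rs0').
rewrite -/(derive f _ _).
have -> : (r - s) *: v + (y + s *: v) = y + r *: v by lmod R.
set l := 'D_v f _; set F := f _; set F' := f _ => h.
have -> : F - F' - (r - s) *: l = - ((r - s) *: (l - (r - s)^-1 *: (F - F'))).
  by rewrite scalerBr scalerA mulfV // scale1r; lmod R.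
by rewrite normrN normrZ mulrC ler_wpM2r.
Qed.

Lemma open_line V (U : set V) y v : open U -> U y ->
  exists2 d : R, 0 < d & forall r, `|r| <= d -> U (y + r *: v).
Proof.
move=> oU Uy; have /nbhs_ballP[e /= e0 He] : nbhs y U by exact: open_nbhs_nbhs.
have v0 : 0 < `|v| + 1 by rewrite ltr_wpDl.
exists (e / 2 / (`|v| + 1)); first by rewrite !divr_gt0.
move=> r rs; apply: He; rewrite -ball_normE /= opprD addrA subrr sub0r normrN normrZ.
apply: (@le_lt_trans _ _ (e / 2)); last by lra.
rewrite -[leRHS](divfK (lt0r_neq0 v0)); apply: ler_pM => //; by rewrite lerDl.
Qed.

Definition C1_on V W (U : set V) (f : V -> W) : Prop :=
  forall u, U u -> forall v, derivable f u v /\ {for u, continuous ('D_v f)}.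

Lemma smooth_C1 V W (U : set V) (f : V -> W) : smooth_on U f -> C1_on U f.
Proof.
move=> /(_ 1%N)[_ h] u Uu v; have [h1 h2] := h v; split; first exact: h1.
exact: h2.
Qed.

Lemma lip_norm_continuous V W (J : V -> W) M : (forall x y, `|J x - J y| <= M * `|x - y|) ->
  continuous (fun x => `|J x|).
Proof.
move=> JM w; apply/cvgrPdist_le => e e0.
have A0 : 0 < `|M| + 1 by rewrite ltr_wpDl.
apply/nbhs_ballP; exists (e / (`|M| + 1)); first by rewrite /= divr_gt0.
move=> w'; rewrite -ball_normE /= => ww; apply: (le_trans (ler_dist_dist _ _)).
rewrite (le_trans (JM _ _)) // (le_trans (ler_wpM2r _ (_ : M <= `|M| + 1))) //.
  by rewrite (le_trans (ler_norm _)) // lerDl.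
by rewrite mulrC -ler_pdivlMr // ltW.
Qed.

Section RowVectors.
Context {m : nat}.
Local Notation rV := 'rV[R]_m.

Lemma rV_coord_le (w : rV) k : `|w 0 k| <= `|w|.
Proof.
rewrite [leRHS]/Num.norm /= mx_normrE; apply: le_trans; last exact: (le_bigmax _ _ (0, k)).
by [].
Qed.

Lemma rV_norm_le (w : rV) M : 0 <= M -> (forall k, `|w 0 k| <= M) -> `|w| <= M.
Proof.
move=> M0 h; rewrite [leLHS]/Num.norm /= mx_normrE; apply: bigmax_le => // -[i j] _ /=.
by rewrite ord1.
Qed.

Definition rV_part (k : nat) (w : rV) : rV := \row_j (if (j < k)%N then w 0 j else 0).

Lemma rV_part0 w : rV_part 0 w = 0.
Proof. by apply/rowP => j; rewrite !mxE. Qed.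
Lemma rV_partm w : rV_part m w = w.
Proof. by apply/rowP => j; rewrite !mxE ltn_ord. Qed.
Lemma rV_partS (k : 'I_m) w : rV_part k.+1 w = rV_part k w + w 0 k *: delta_mx 0 k.
Proof.
apply/rowP => j; rewrite !mxE eqxx /= ltnS leq_eqVlt -val_eqE /=.
have [jk|jk] := eqVneq (j : nat) k.
  rewrite (_ : j = k); last exact: val_inj.
  by rewrite ltnn /= mulr1 add0r.
by rewrite mulr0 addr0.
Qed.

Context {W : normedModType R}.

(** The differential of f at u, expressed with the partial derivatives. *)
Definition Jac (f : rV -> W) (u w : rV) : W := \sum_(k < m) w 0 k *: 'D_(delta_mx 0 k) f u.

Lemma JacZD f u a w w' : Jac f u (a *: w + w') = a *: Jac f u w + Jac f u w'.
Proof.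
rewrite /Jac scaler_sumr -big_split; apply: eq_bigr => k _ /=.
by rewrite !mxE; lmod R.
Qed.

Lemma Jac_norm f u w : `|Jac f u w| <= (\sum_(k < m) `|'D_(delta_mx 0 k) f u|) * `|w|.
Proof.
rewrite mulr_suml (le_trans (ler_norm_sum _ _ _)) //; apply: ler_sum => k _.
by rewrite normrZ mulrC ler_wpM2l // rV_coord_le.
Qed.

(** The coordinates are changed one at a time, each step being a line on which the mean
    value inequality applies. *)
Lemma C1_frechet (U : set rV) (f : rV -> W) u : open U -> C1_on U f -> U u ->
  forall e : R, 0 < e -> exists2 d : R, 0 < d & forall w, `|w| < d ->
    `|f (u + w) - f u - Jac f u w| <= e * `|w|.
Proof.
move=> oU C1 Uu e e0.
pose eta := e / m.+1%:R; have eta0 : 0 < eta by rewrite divr_gt0.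
have nU : nbhs u U by exact: open_nbhs_nbhs.
have nD k : nbhs u [set y | `|'D_(delta_mx 0 k) f u - 'D_(delta_mx 0 k) f y| <= eta].
  by have [_ /cvgrPdist_le] := C1 u Uu (delta_mx 0 k); apply.
have /nbhs_ballP[d /= d0 Hd] : nbhs u (U `&` [set y | forall k : 'I_m, `|'D_(delta_mx 0 k) f u - 'D_(delta_mx 0 k) f y| <= eta]).
  apply: filterI => //.
  have X := @filter_forall _ _ (fun k => [set y | `|'D_(delta_mx 0 k) f u - 'D_(delta_mx 0 k) f y| <= eta]) (nbhs u) _ nD.
  exact: X.
exists d => // w wd.
have stp (k : 'I_m) : `|f (u + rV_part k.+1 w) - f (u + rV_part k w) - w 0 k *: 'D_(delta_mx 0 k) f u| <= eta * `|w|.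
  pose v := delta_mx 0 k : rV; pose y := u + rV_part k w.
  pose F (s : R) := f (y + (w 0 k * (s - 0)) *: v) + (- s) *: (w 0 k *: 'D_v f u).
  have F1 : F 1 = f (u + rV_part k.+1 w) - w 0 k *: 'D_v f u.
    by rewrite /F subr0 mulr1 rV_partS addrA scaleN1r.
  have F0 : F 0 = f (u + rV_part k w) by rewrite /F subr0 mulr0 scale0r addr0 oppr0 scale0r addr0.
  have -> : f (u + rV_part k.+1 w) - f (u + rV_part k w) - w 0 k *: 'D_v f u = F 1 - F 0.
    by rewrite F1 F0; lmod R.
  have near_u s : 0 <= s <= 1 -> ball u d (y + (w 0 k * (s - 0)) *: v).
    move=> /andP[s0 s1]; rewrite -ball_normE /= /y -addrA opprD addrA subrr sub0r normrN.
    apply: le_lt_trans wd; apply: rV_norm_le => // j; rewrite !mxE eqxx /= subr0.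
    have [->|jk] := eqVneq j k.
      rewrite ltnn add0r mulr1 normrM (ger0_norm s0); apply: le_trans (rV_coord_le w k).
      by rewrite ler_piMr.
    by rewrite mulr0 addr0; case: ifP => _; rewrite ?normr0 // rV_coord_le.
  have := @mean_value_le R W F (fun s => w 0 k *: ('D_v f (y + (w 0 k * (s - 0)) *: v) - 'D_v f u)) 0 1 (eta * `|w|) ler01.
  rewrite subr0 mulr1; apply.
    move=> s s01; have [Uy _] := Hd _ (near_u s s01).
    have h1 := der_in_comp (S := setT) (S' := `[0, 1]%classic) (fun _ _ => I) (der_in_aff _ (w 0 k) 0 s)
      (line_der (proj1 (C1 _ Uy v))).
    have h2 : der_in `[0, 1]%classic (fun r : R => (- r) *: (w 0 k *: 'D_v f u)) s (- (w 0 k *: 'D_v f u)).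
      by apply: der_in_affine => ?; lmod R.
    by have := der_inD h1 h2; rewrite -scalerBr.
  move=> s s01; have [_ Hk] := Hd _ (near_u s s01).
  by rewrite normrZ mulrC ler_pM ?rV_coord_le // distrC; exact: Hk.
have tel : f (u + w) - f u = \sum_(k < m) (f (u + rV_part k.+1 w) - f (u + rV_part k w)).
  rewrite -(big_mkord xpredT (fun k => f (u + rV_part k.+1 w) - f (u + rV_part k w))).
  by rewrite (telescope_sumr (fun k => f (u + rV_part k w))) // rV_part0 rV_partm addr0.
rewrite tel /Jac -sumrB (le_trans (ler_norm_sum _ _ _)) //.
apply: (@le_trans _ _ (\sum_(k < m) eta * `|w|)); first by apply: ler_sum => k _; exact: stp.
rewrite sumr_const card_ord -mulr_natl mulrA ler_wpM2r // /eta mulrCA ler_piMr ?(ltW e0) //.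
by rewrite ler_pdivrMr // mul1r ler_nat.
Qed.

Lemma der_in_chain (U : set rV) (f : rV -> W) (p : R -> rV) s w : open U -> C1_on U f -> U (p s) ->
  der_in setT p s w -> der_in setT (fun r => f (p r)) s (Jac f (p s) w).
Proof.
move=> oU C1 Us dp e e0.
pose M := \sum_(k < m) `|'D_(delta_mx 0 k) f (p s)|.
have M0 : 0 <= M by exact: sumr_ge0.
have M1 : 0 < M + 1 by rewrite ltr_wpDl.
have w1 : 0 < `|w| + 1 by rewrite ltr_wpDl.
have [d1 d10 H1] := C1_frechet oU C1 Us (e := e / 2 / (`|w| + 1)) (ltac:(by rewrite !divr_gt0)).
have [d2 d20 H2] := dp (e / 2 / (M + 1)) (ltac:(by rewrite !divr_gt0)).
have [d3 d30 H3] := der_in_lip dp.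
exists (Num.min (Num.min d2 d3) (d1 / (`|w| + 1))); first by rewrite !lt_min d20 d30 divr_gt0.
move=> r _; rewrite !lt_min => /andP[/andP[r2 r3] r1].
have pl := H3 r I r3; have pd := H2 r I r2.
have ps : `|p r - p s| < d1 by apply: (le_lt_trans pl); rewrite mulrC -ltr_pdivlMr.
have := H1 _ ps; rewrite [p s + _]addrC subrK => h1.
have JE : Jac f (p s) (p r - p s) = (r - s) *: Jac f (p s) w + Jac f (p s) (p r - p s - (r - s) *: w).
  by rewrite -JacZD; congr Jac; lmod R.
have -> : f (p r) - f (p s) - (r - s) *: Jac f (p s) w =
  (f (p r) - f (p s) - Jac f (p s) (p r - p s)) + Jac f (p s) (p r - p s - (r - s) *: w).
  by rewrite JE; lmod R.
rewrite (le_trans (ler_normD _ _)) // [e]splitr mulrDl lerD //.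
  apply: (le_trans h1); rewrite [leRHS](_ : _ = e / 2 / (`|w| + 1) * ((`|w| + 1) * `|r - s|)); last first.
    by field; rewrite lt0r_neq0.
  by rewrite ler_wpM2l // ltW // !divr_gt0.
apply: (le_trans (Jac_norm _ _ _)); rewrite -/M [leRHS](_ : _ = (M + 1) * (e / 2 / (M + 1) * `|r - s|)); last first.
  by field; rewrite lt0r_neq0.
by rewrite ler_pM // lerDl.
Qed.

Lemma deriveE_Jac (U : set rV) (f : rV -> W) u w : open U -> C1_on U f -> U u ->
  'D_w f u = Jac f u w.
Proof.
move=> oU C1 Uu.
have h1 : der_in setT (fun r : R => f (u + r *: w)) 0 ('D_w f u).
  by have := line_der (y := u) (s := 0) (v := w) (f := f); rewrite scale0r addr0; apply; exact: (C1 u Uu w).1.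
have h2 : der_in setT (fun r : R => u + r *: w) 0 w.
  by apply: der_in_affine => ?; lmod R.
have := der_in_chain (p := fun r : R => u + r *: w) (s := 0) oU C1; rewrite scale0r addr0 => /(_ w Uu h2) h3.
exact: der_in_unique h1 h3.
Qed.

(** The continuous function |J w| has a positive minimum on the unit sphere, which is
    compact. *)
Lemma injective_bounded_below (J : rV -> W) M : (forall a w w', J (a *: w + w') = a *: J w + J w') ->
  (forall w, `|J w| <= M * `|w|) -> (forall w, J w = 0 -> w = 0) ->
  exists2 K, 0 <= K & forall w, `|w| <= K * `|J w|.
Proof.
move=> Jl JM Ji.
have JZ a w : J (a *: w) = a *: J w.
  have J0 : J 0 = 0 by have := Jl (-1) 0 0; rewrite scaler0 addr0 scaleN1r addNr.
  by have := Jl a w 0; rewrite J0 !addr0.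
have JB w w' : J w - J w' = J (w - w').
  by have := Jl (-1) w' w; rewrite !scaleN1r ![- _ + _]addrC.
pose S := [set w : rV | `|w| = 1].
have unit w : w != 0 -> S (`|w|^-1 *: w).
  by move=> w0; rewrite /S /= normrZ normfV normr_id mulVf // normr_eq0.
have [S0|S0] := pselect (S !=set0); last first.
  exists 0 => // w; have [->|w0] := eqVneq w 0; first by rewrite normr0 mul0r.
  by case: S0; exists (`|w|^-1 *: w); exact: unit.
have Sc : compact S.
  apply: bounded_closed_compact.
    by exists 1; split => // M' M1 w /= ->; exact: ltW.
  have -> : S = (fun w : rV => `|w|) @^-1` [set 1] by [].
  apply: closed_comp => [w _|]; [exact: norm_continuous|exact: closed_eq].
have Jc : {within S, continuous (fun w => `|J w|)}.
  by apply: continuous_subspaceT; apply: (lip_norm_continuous (M := M)) => x y; rewrite JB.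
have [w0 /set_mem w0S Hmin] := EVT_min_rV S0 Sc Jc.
have mu0 : 0 < `|J w0|.
  rewrite normr_gt0; apply/eqP => /Ji w00; move: w0S; rewrite /S /= w00 normr0 => /esym/eqP.
  by rewrite oner_eq0.
exists (`|J w0|^-1); first by rewrite invr_ge0.
move=> w; have [->|wn0] := eqVneq w 0; first by rewrite normr0 mulr_ge0 // invr_ge0.
have := Hmin (`|w|^-1 *: w) (mem_set (unit w wn0)); rewrite JZ normrZ normfV normr_id => h.
have wp : 0 < `|w| by rewrite normr_gt0.
by rewrite mulrC ler_pdivlMr // -ler_pdivlMl.
Qed.

End RowVectors.
End DirectionalCalculus.

(** * Lie subgroups *)

Section LieSubgroup.
Context {R : realType} {H : completeNormedModType R[i]} (D : cm_space H).
Local Notation B := (bop H).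
Local Notation L := (cmsp D).
Local Notation T := (@cmval R H D).
Local Notation V := (cm_carrier D).
Local Notation N := (cmnorm (cm_ip D)).
Context (br : L -> L -> L) (C : R) (C0 : 0 <= C).
Hypothesis br_lin : forall a w w' x, br (a *: w + w') x = a *: br w x + br w' x.
Hypothesis br_norm : forall w x, `|br w x| <= C * `|w| * `|x|.
Hypothesis T_br : forall w x, T (br w x) = bracket (T w) (T x).
Let T_lin := @cmval_lin R H D.
Let Glin := graph_lin T_lin.

Context (G : set B) (m : nat) (A : set (@chart R H m)).
Hypothesis GA : @lie_subgroup R H G m A.
Hypothesis tangV : tangent_at_one A `<=` V.

Let rV := 'rV[R]_m.

Lemma chartC1 c : A c -> C1_on (dom c) (c : rV -> B).
Proof. by move=> Ac; apply: smooth_C1; exact: (chart_smooth GA Ac). Qed.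

Lemma chart_in c u : A c -> dom c u -> G (c u).
Proof. by move=> Ac cu; rewrite -(chart_cover GA); exists c => //; exists u. Qed.

Lemma in_chart x : G x -> exists c u, [/\ A c, dom c u & c u = x].
Proof. by rewrite -(chart_cover GA) => -[c Ac [u cu <-]]; exists c, u. Qed.

Lemma GA_inv x : G x -> inverse_of x (bop_inv x).
Proof. by move=> Gx; apply: GL_inv; exact: (lie_sub_GL GA). Qed.

Context (c0 : @chart R H m) (u0 : rV) (Ac0 : A c0) (c0u0 : dom c0 u0) (c01 : c0 u0 = 1).

Lemma coordE c u : A c -> dom c u -> Defs.coord c (c u) = u.
Proof.
move=> Ac cu; rewrite /Defs.coord; case: xgetP => [v _ [cv e]|/(_ u)]; last by case.
exact: (chart_inj GA Ac).
Qed.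

(** The curve (c u)^-1 c (u + r v) passes through 1 at r = 0. Since multiplication is
    smooth in charts, it is c0 (p r) for a differentiable curve p of coordinates around
    1. *)
Lemma log_derivative_tangent c u v : A c -> dom c u ->
  exists w, bop_inv (c u) * 'D_v (c : rV -> B) u = Jac (c0 : rV -> B) u0 w.
Proof.
move=> Ac cu; have Gx := chart_in Ac cu; have [xxb xbx] := GA_inv Gx.
have [ca [a [Aca ca_a e]]] := in_chart (lie_inv GA Gx).
have [] := chart_mul GA Aca Ac Ac0; set W := [set _ | _]; set phi := fun _ => _ => oW sW.
have Wau : W (a, u) by rewrite /W /= e xbx -c01; split => //; split => //; exists u0.
have phi_au : phi (a, u) = u0 by rewrite /phi /= e xbx -c01 coordE.
pose v' : (rV * rV)%type := (0, v).
have dphi : derivable phi ((a, u) + (0 : R) *: v') v'.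
  by rewrite scale0r addr0; exact: ((smooth_C1 sW) _ Wau v').1.
have pE (r : R) : (a, u) + r *: v' = (a, u + r *: v).
  by rewrite -[LHS]/(a + r *: 0, u + r *: v) scaler0 addr0.
pose p (r : R) := phi ((a, u) + r *: v').
have p0 : p 0 = u0 by rewrite /p pE scale0r addr0.
pose w := 'D_v' phi ((a, u) + (0 : R) *: v').
exists w.
have h1 : der_in setT (fun r => (c0 : rV -> B) (p r)) 0 (Jac (c0 : rV -> B) u0 w).
  rewrite -p0; apply: (der_in_chain (chart_open GA Ac0) (chartC1 Ac0)); first by rewrite p0.
  exact: line_der dphi.
have h2 : der_in setT (fun r : R => bop_inv (c u) * (c : rV -> B) (u + r *: v)) 0 (bop_inv (c u) * 'D_v (c : rV -> B) u).
  have := line_der (f := (c : rV -> B)) (y := u) (v := v) (s := 0); rewrite scale0r addr0.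
  move=> /(_ (chartC1 Ac cu v).1) h; have := der_inM (der_in_cst setT (bop_inv (c u)) 0) h.
  by rewrite bmul0l add0r.
have [d d0 Hd] := open_line v' oW Wau.
have cp r : `|r| <= d -> c0 (p r) = bop_inv (c u) * c (u + r *: v).
  move=> /Hd; rewrite /p pE /W /= => -[_ [_ [u1 c0u1 E]]].
  by rewrite /phi /= -E coordE // E e.
apply: der_in_unique h2 _; apply: (der_in_ext (e0 := d)) h1 => //.
  by move=> r _; rewrite subr0 => /ltW; exact: cp.
by apply: cp; rewrite normr0 ltW.
Qed.

Definition tangent0 (X : B) := exists w, X = Jac (c0 : rV -> B) u0 w.

Lemma tangent0B X Y : tangent0 X -> tangent0 Y -> tangent0 (X - Y).
Proof.
move=> [w ->] [w' ->]; exists ((-1) *: w' + w); rewrite JacZD scaleN1r addrC //.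
Qed.

Lemma tangent0_V X : tangent0 X -> V X.
Proof.
move=> [w ->]; apply: tangV; exists c0, u0, w; split => //.
by rewrite (deriveE_Jac w (chart_open GA Ac0) (chartC1 Ac0) c0u0).
Qed.

(** On the tangent space, which has finite dimension, |.| is bounded by a multiple of
    the operator norm. This is where the charts are used as immersions. *)
Lemma tangent0_norm : exists2 K, 0 <= K & forall X, tangent0 X -> N X <= K * `|X|.
Proof.
have Ji w : Jac (c0 : rV -> B) u0 w = 0 -> w = 0.
  move=> h; apply: (chart_immersion GA Ac0 c0u0).
  by rewrite (deriveE_Jac w (chart_open GA Ac0) (chartC1 Ac0) c0u0).
have [K K0 HK] := injective_bounded_below (JacZD (c0 : rV -> B) u0) (Jac_norm (c0 : rV -> B) u0) Ji.
pose b (k : 'I_m) := 'D_(delta_mx 0 k) (c0 : rV -> B) u0.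
have bV k : V (b k) by apply: tangV; exists c0, u0, (delta_mx 0 k).
pose M := \sum_(k < m) N (b k).
have M0 : 0 <= M by apply: sumr_ge0 => k _; exact: sqrtr_ge0.
have MN w : N (Jac (c0 : rV -> B) u0 w) <= M * `|w|.
  rewrite /M mulr_suml /Jac.
  suff [_] : V (\sum_(k < m) w 0 k *: b k) /\ N (\sum_(k < m) w 0 k *: b k) <= \sum_(k < m) N (b k) * `|w| by [].
  elim/big_ind2 : _ => [|x1 x2 y1 y2 [V1 n1] [V2 n2]|k _].
  - split; first exact: cm0.
    by have := cmnormZ 0 (cm0 D); rewrite scale0r normr0 mul0r => ->.
  - by split; [exact: cmD|rewrite (le_trans (cmnormD V1 V2)) // lerD].
  - split; first exact: cmZ.
    by rewrite (cmnormZ _ (bV k)) mulrC ler_wpM2l ?sqrtr_ge0 // rV_coord_le.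
exists (M * K); first exact: mulr_ge0.
by move=> X [w ->]; rewrite (le_trans (MN w)) // -mulrA ler_wpM2l.
Qed.

Section ChartLine.
Context (c : @chart R H m) (u v : rV) (a b : R) (ab : a < b).
Hypothesis Ac : A c.
Hypothesis dom_line : forall r, a <= r <= b -> dom c (u + r *: v).

Let k r : B := c (u + r *: v).
Let kb r := bop_inv (k r).
Let X r := kb r * 'D_v (c : rV -> B) (u + r *: v).

Lemma line_inv r : a <= r <= b -> k r * kb r = 1 /\ kb r * k r = 1.
Proof. by move=> /dom_line h; apply: GA_inv; exact: chart_in. Qed.

Lemma line_X r : a <= r <= b -> tangent0 (X r).
Proof. by move=> /dom_line h; have [w e] := log_derivative_tangent v Ac h; exists w. Qed.

Lemma line_d r : a <= r <= b -> der_in `[a, b]%classic k r (k r * X r).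
Proof.
move=> h; have [e1 _] := line_inv h; rewrite /X bmulA e1 bmul1l.
apply: (der_in_sub (S' := setT)) => //; apply: line_der.
exact: (chartC1 Ac (dom_line h) v).1.
Qed.

Lemma line_cont r : a <= r <= b -> cont_in `[a, b]%classic X r.
Proof.
move=> h; apply: cont_inM.
  apply: (cont_in_inv (k := k)); first by rewrite /= in_itv.
    by move=> r'; rewrite /= in_itv /=; exact: line_inv.
  exact: der_in_cont (line_d h).
have [_ cD] := chartC1 Ac (dom_line h) v.
move=> e e0; have /cvgrPdist_le/(_ e e0) := cD.
move=> /nbhs_ballP[d /= d0 Hd].
have v0 : 0 < `|v| + 1 by rewrite ltr_wpDl.
exists (d / (`|v| + 1)); first by rewrite divr_gt0.
move=> r' _ rr; rewrite distrC; apply: Hd; rewrite -ball_normE /=.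
have -> : u + r *: v - (u + r' *: v) = (r - r') *: v by lmod R.
rewrite normrZ distrC; apply: (@le_lt_trans _ _ (`|r' - r| * (`|v| + 1))).
  by rewrite ler_wpM2l // lerDl.
by rewrite -ltr_pdivlMr.
Qed.

Let w r : L := insubd 0 (X r).

Lemma line_wE r : a <= r <= b -> (w r : B) = X r.
Proof. by move=> h; rewrite /w insubdK //; apply/cm_predP; exact: tangent0_V (line_X h). Qed.

Lemma line_w_norm : exists2 K, 0 <= K & forall r s, a <= r <= b -> a <= s <= b ->
  `|w r - w s| <= K * `|X r - X s|.
Proof.
have [K K0 HK] := tangent0_norm; exists K => // r s hr hs.
rewrite cmsp_normE; have -> : (w r - w s : L) = X r - X s :> B by rewrite -(line_wE hr) -(line_wE hs).
by apply: HK; apply: tangent0B; exact: line_X.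
Qed.

Lemma line_w_cont r : a <= r <= b -> cont_in `[a, b]%classic w r.
Proof.
move=> h e e0; have [K K0 HK] := line_w_norm.
have K1 : 0 < K + 1 by rewrite ltr_wpDl.
have [d d0 Hd] := line_cont h (e := e / (K + 1)) (ltac:(by rewrite divr_gt0)).
exists d => // r'; rewrite /= in_itv /= => h' rr.
have := Hd r'; rewrite /= in_itv /= => /(_ h' rr) h1.
rewrite (le_trans (HK _ _ h' h)) // -[e](divfK (lt0r_neq0 K1)) mulrC ler_pM // lerDl //.
Qed.

Lemma line_reach : exists a', reach (graph T) false a' 0 (kb a * k b).
Proof.
have [M HM] := cont_in_bounded (ltW ab) line_w_cont.
exists (2 * (b - a) * M); apply: (reach_forget (o := false) (b := 2 * (b - a) * 0)).
apply: (reach_reparam (w1 := w) (z := X) (z1 := X) Glin ab line_inv line_d line_w_cont line_cont).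
move=> r /andP[/ltW ar /ltW rb]; have h : a <= r <= b by rewrite ar.
by split => //; [rewrite /graph line_wE|exact: HM].
Qed.

Lemma line_near_exp (x : L) d : (forall r, a <= r <= b -> `|w r - x| <= d) ->
  reach (clgraph T) false (2 * (b - a) * (expR (C * `|x| * (b - a)) * d)) 0
    (bop_exp x (- (b - a)) * (kb a * k b)).
Proof.
move=> hd.
have := @reach_near_exp _ _ _ T T_lin br C C0 br_lin br_norm T_br false d 0 a b x k kb w X X ab line_inv line_d line_w_cont line_cont.
move=> /(_ _)/reach_forget; apply.
move=> r /andP[/ltW ar /ltW rb]; have h : a <= r <= b by rewrite ar.
by split => //; [apply: graph_clgraph; rewrite /graph line_wE|exact: hd].
Qed.

End ChartLine.

(** The logarithmic derivative w of c (u + r v) takes the value x at r = 0 and is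
    continuous for |.|, so it is close to x for small r and [line_near_exp] applies. *)
Lemma lie_tangent (x : L) (e : R) : tangent_at_one A (x : B) -> 0 < e ->
  exists2 t0 : R, 0 < t0 & forall t, 0 < t <= t0 ->
    exists2 y, G y & reach (clgraph T) false (t * e) 0 (bop_exp x (- t) * y).
Proof.
move=> [c [u [v [Ac cu c1 Dx]]]] e0.
have [d d0 Hd] := open_line v (chart_open GA Ac) cu.
pose q := Num.min d 1; have q0 : 0 < q by rewrite lt_min d0 ltr01.
have dl r : 0 <= r <= q -> dom c (u + r *: v).
  move=> /andP[r0 rq]; apply: Hd; rewrite ger0_norm // (le_trans rq) // ge_min lexx //.
have one : bop_inv (1 : B) = 1 by apply: bop_invE; rewrite bmul1l.
have k0 : c (u + 0 *: v) = 1 by rewrite scale0r addr0.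
pose w r : L := insubd 0 (bop_inv (c (u + r *: v)) * 'D_v (c : rV -> B) (u + r *: v)).
have w0 : w 0 = x.
  apply: cmval_inj; rewrite (line_wE Ac dl) ?lexx ?(ltW q0) // k0 one bmul1l -Dx.
  by rewrite scale0r addr0.
pose E := expR (C * `|x|); have E0 : 0 < E by exact: expR_gt0.
have cw := line_w_cont Ac dl (r := 0) (ltac:(by rewrite lexx ltW)).
have [d1 d10 H1] := cw (e / 2 / E) (ltac:(by rewrite !divr_gt0)).
exists (Num.min q (d1 / 2)); first by rewrite lt_min q0 divr_gt0.
move=> t /andP[t0]; rewrite le_min => /andP[tq td].
have sub r : 0 <= r <= t -> 0 <= r <= q by move=> /andP[-> rt]; exact: le_trans tq.
have dlt r (h : 0 <= r <= t) := dl r (sub r h).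
exists (c (u + t *: v)); first by apply: chart_in => //; apply: dl; rewrite (ltW t0).
have := line_near_exp t0 Ac dlt (x := x) (d := e / 2 / E).
rewrite k0 one bmul1l subr0 => h; apply: (reach_le _ _ (h _)) => //.
  have -> : t * e = 2 * t * (E * (e / 2 / E)) by field; rewrite lt0r_neq0.
  rewrite ler_wpM2l ?mulr_ge0 ?(ltW t0) // ler_wpM2r ?divr_ge0 ?(ltW e0) ?(ltW E0) //.
  rewrite /E ler_expR ler_piMr ?mulr_ge0 // (le_trans tq) // ge_min lexx orbT //.
move=> r hr; rewrite -w0; apply: H1.
  by rewrite /= in_itv /= sub.
by rewrite subr0; have /andP[r0 rt] := hr; rewrite ger0_norm //; lra.
Qed.

Lemma reach_pos (a : R) (x : B) : reach (graph T) false a 0 x -> exists2 a', 0 < a' & reach (graph T) false a' 0 x.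
Proof.
move=> h; have [a0 _] := reach_ge0 h; exists (a + 1); first by rewrite ltr_wpDl.
by apply: reach_le h => //; rewrite lerDl.
Qed.

(** By [line_reach] the points of a chart close to a given one are reached if and only
    if this one is. So the set of reached elements is open, as well as its complement,
    and G is connected. *)
Lemma lie_reach : manifold_connected G A -> forall x, G x -> exists a, reach (graph T) false a 0 x.
Proof.
move=> Gconn.
pose O := [set x | G x /\ exists a, reach (graph T) false a 0 x].
have near c u : A c -> dom c u -> exists2 e : R, 0 < e & forall u', `|u' - u| < e ->
    dom c u' /\ exists a, reach (graph T) false a 0 (bop_inv (c u) * c u').
  move=> Ac cu; have /nbhs_ballP[e /= e0 He] : nbhs u (dom c) by exact: open_nbhs_nbhs (conj (chart_open GA Ac) cu).
  exists e => // u' uu; split; first by apply: He; rewrite -ball_normE /= distrC.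
  have dl r : 0 <= r <= 1 -> dom c (u + r *: (u' - u)).
    move=> /andP[r0 r1]; apply: He; rewrite -ball_normE /= opprD addrA subrr sub0r normrN normrZ.
    by apply: le_lt_trans uu; rewrite ger0_norm // ler_piMl.
  have := line_reach ltr01 Ac dl.
  by rewrite scale0r addr0 scale1r [u + _]addrC subrK.
have mul x y : G y -> (exists a, reach (graph T) false a 0 x) ->
    (exists a, reach (graph T) false a 0 (bop_inv x * y)) -> inverse_of x (bop_inv x) -> O y.
  move=> Gy [a ha] [b hb] ix; split => //.
  have [a' a'0 ha'] := reach_pos ha; have [b' b'0 hb'] := reach_pos hb.
  exists (a' + b'); have := reach_add Glin ha' hb' a'0 b'0.
  by rewrite bmulA ix.1 bmul1l.
suff -> : G = O by move=> x [].
apply/esym; apply: Gconn.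
- by move=> x [].
- exists 1; split; first exact: (lie_one GA).
  by exists 0; apply: reach1.
- move=> c Ac; rewrite openE /= => u [cu [Gu Ou]]; have [e e0 He] := near c u Ac cu.
  apply/nbhs_ballP; exists e => // u'; rewrite -ball_normE /= distrC => /He[cu' hr].
  split => //; apply: (mul (c u)) => //; first exact: chart_in.
  exact: GA_inv.
- move=> c Ac; rewrite openE /= => u [cu [Gu nOu]]; have [e e0 He] := near c u Ac cu.
  apply/nbhs_ballP; exists e => // u'; rewrite -ball_normE /= distrC => /He[cu' hr].
  split => //; split; first exact: chart_in.
  move=> [Gu' Ou']; apply: nOu.
  apply: (mul (c u')) => //; last exact: GA_inv.
  have [b hb] := hr; exists b.
  have i1 := GA_inv Gu; have i2 := GA_inv Gu'.
  exact: reach_inverse Glin (inverse_mul (inverse_sym i1) i2) hb.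
Qed.

End LieSubgroup.

(** * The Cameron-Martin group *)

Theorem theorem3p5 (R : realType)
  (H : completeNormedModType R[i]) (ipH : {dot H for Num.conj})
  (H_norm : forall x : H, `|x| ^+ 2 = ipH x x)
  (H_separable : exists D : set H, countable D /\ dense D)
  (G g : nat -> set (bop H))
  (G_lie : forall n, connected_lie_subgroup (G n) (g n))
  (G_incr : forall n, G n `<=` G n.+1)
  (g_subspace : complex_subspace (\bigcup_n g n))
  (ginf : set (bop H)) (ip : bop H -> bop H -> R[i])
  (ginf_subspace : complex_subspace ginf)
  (g_sub : \bigcup_n g n `<=` ginf)
  (ip_inner : hermitian_inner_product ginf ip)
  (ginf_complete : cm_complete ginf ip)
  (g_dense : forall x, ginf x -> forall e : R, 0 < e ->
    exists2 y, (\bigcup_n g n) y & cmnorm ip (x - y) < e)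
  (ginf_bracket : forall x y, ginf x -> ginf y -> ginf (bracket x y))
  (C : R) (C_gt0 : 0 < C)
  (bracket_bound : forall x y, ginf x -> ginf y ->
    cmnorm ip (bracket x y) <= C * cmnorm ip x * cmnorm ip y) :
  dense_for (cm_dist ginf ip) (\bigcup_n G n) (G_CM ginf ip) /\
  complete_for (cm_dist ginf ip) (G_CM ginf ip).
Proof.
pose D := CMSpace ginf_subspace ip_inner ginf_complete.
have br_in (x y : cmsp D) : cm_carrier D (bracket (x : bop H) y).
  by apply: ginf_bracket; exact: (cmvalP (D := D)).
pose br (x y : cmsp D) : cmsp D := cm_of (br_in x y).
have br_lin a w w' x : br (a *: w + w') x = a *: br w x + br w' x.
  apply: cmval_inj; rewrite cmval_lin /= /bracket bmulDl bmulDr -bop_scalerAl -bop_scalerAr.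
  by lmod R.
have br_norm w x : `|br w x| <= C * `|w| * `|x|.
  by apply: bracket_bound; exact: (cmvalP (D := D)).
have T_br w x : cmval (br w x) = bracket (cmval w) (cmval x) by [].
have C0 := ltW C_gt0.
have mono p q : (p <= q)%N -> G p `<=` G q.
  by move=> pq; rewrite -(subnK pq); elim: (q - p)%N => // i IH; exact: subset_trans IH (G_incr _).
split; last exact: (@G_CM_complete R H D br C C0 br_lin br_norm T_br).
have lie n : [/\ (forall x y, G n x -> G n y -> G n (x * y)),
    (forall x, G n x -> G n (bop_inv x) /\ inverse_of x (bop_inv x)),
    (forall x, G n x -> exists a, reach (graph (@cmval R H D)) false a 0 x) &
    (forall (x : cmsp D) (e : R), g n (x : bop H) -> 0 < e ->
      exists2 t0 : R, 0 < t0 & forall t, 0 < t <= t0 ->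
        exists2 y, G n y & reach (clgraph (@cmval R H D)) false (t * e) 0 (bop_exp x (- t) * y))].
  have [m [A [GA Gconn tg]]] := G_lie n.
  have tangV : tangent_at_one A `<=` cm_carrier D.
    by rewrite tg => x gx; apply: g_sub; exists n.
  have [c0 [u0 [Ac0 c0u0 c01]]] := in_chart GA (lie_one GA).
  split.
  - exact: (lie_mul GA).
  - by move=> x Gx; split; [exact: (lie_inv GA)|exact: GL_inv (lie_sub_GL GA Gx)].
  - exact: (lie_reach GA tangV Ac0 c0u0 c01 Gconn).
  - move=> x e gx e0; apply: (lie_tangent C0 br_lin br_norm T_br GA tangV Ac0 c0u0 c01) => //.
    by rewrite tg.
apply: (@G_CM_dense R H D br C C0 br_lin br_norm T_br _ _ _ _ (\bigcup_n g n)).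
- move=> x y [p _ px] [q _ qy]; exists (maxn p q) => //; have [h _ _ _] := lie (maxn p q).
  by apply: h; [apply: (mono p) => //; exact: leq_maxl|apply: (mono q) => //; exact: leq_maxr].
- move=> x [p _ px]; have [_ h _ _] := lie p; have [h1 h2] := h x px.
  by exists (bop_inv x) => //; exists p.
- by move=> x [p _ px]; have [_ _ h _] := lie p; exact: h.
- move=> w e e0; have [y gy wy] := g_dense (w : bop H) (cmvalP w) e e0.
  by exists (cm_of (D := D) (g_sub _ gy)) => //=; exact: ltW.
- move=> x e [p _ gx] e0; have [_ _ _ h] := lie p; have [t0 t00 Ht] := h x e gx e0.
  by exists t0 => // t /Ht[y Gy hy]; exists y => //; exists p.
Qed.
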